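(* Let $k\geq2$ be an integer, let $1\leq p\leq\infty$ and $0\leq t\leq1$, and consider the extremal problem $\Phi_k(p,t)$. Let $f_1$ denote the extremal function for $\Phi_1(p,t)$ given explicitly in the context. (a) If $1<p\leq\infty$, then the unique extremal for $\Phi_k(p,t)$ is $f_k(z)=f_1(z^k)$. (b) If $p=1$ and $1/2\leq t\leq1$, then the unique extremal for $\Phi_k(1,t)$ is $f_k(z)=f_1(z^k)$. (c) If $p=1$ and $0\leq t<1/2$, then the extremals for $\Phi_k(1,t)$ are precisely the functions of the form \[f(z)=C\prod_{j=1}^k\big(\lambda_j-z\big)\big(1-\overline{\lambda_j}z\big),\] with a constant $C$ and complex numbers $|\lambda_j|\leq1$ such that $\|f\|_{H^1}=1$, $f(0)=t$ and $f^{(k)}(0)>0$.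
   Context: Let $\mathbb{D}$ be the open unit disc. For $0<p<\infty$, $H^p$ is the space of analytic functions $f$ in $\mathbb{D}$ with $\|f\|_{H^p}^p=\lim_{r\to1^-}\int_0^{2\pi}|f(re^{i\theta})|^p\,\frac{d\theta}{2\pi}<\infty$; $H^\infty$ is the space of bounded analytic functions in $\mathbb{D}$ with the supremum norm. For an integer $k\geq1$ and $0\leq t\leq1$, \[\Phi_k(p,t)=\sup\left\{\operatorname{Re}\frac{f^{(k)}(0)}{k!}\,:\,f\in H^p,\ \|f\|_{H^p}\leq1\text{ and }f(0)=t\right\}.\] An extremal for $\Phi_k(p,t)$ is a function $f\in H^p$ with $\|f\|_{H^p}\leq1$ and $f(0)=t$ attaining this supremum. For $1\leq p\leq\infty$ the (unique) extremal $f_1$ for $\Phi_1(p,t)$ is the following function (with $1/p=2/p=0$ when $p=\infty$, and powers defined by the principal branch): - if $0\leq t<2^{-1/p}$, then $f_1(z)=\dfrac{\alpha+z}{1+\alpha z}\,\dfrac{(1+\alpha z)^{2/p}}{(1+\alpha^2)^{1/p}}$, where $\alpha$ is the unique real number with $0\leq\alpha<1$ and $t=\alpha(1+\alpha^2)^{-1/p}$; - if $2^{-1/p}\leq t\leq1$, then $f_1(z)=\dfrac{(1+\beta z)^{2/p}}{(1+\beta^2)^{1/p}}$, where $0\leq\beta\leq1$ satisfies $t=(1+\beta^2)^{-1/p}$ (such $\beta$ is unique if $p<\infty$; if $p=\infty$ then $t=1$ and $f_1\equiv1$ whatever $\beta$ is). *)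

(* Defs.v *)
From HB Require Import structures.
From mathcomp Require Import all_boot all_order all_algebra.
From mathcomp Require Import complex.
From mathcomp Require Import all_classical all_reals all_analysis.

Set Implicit Arguments.
Unset Strict Implicit.
Unset Printing Implicit Defensive.

Import Order.TTheory GRing.Theory Num.Theory numFieldNormedType.Exports.
Local Open Scope classical_set_scope.
Local Open Scope ring_scope.
Local Open Scope complex_scope.

(* [R[i]] packaged as a [numFieldType]: through numFieldNormedType it then
   carries the topology of the modulus and is a normed module over itself, so
   [derivable f z 1] is complex differentiability at [z] and [f^`(n)] is the
   n-th complex derivative.  The bare type [R[i]] has no topology, and
   packaging it as a numClosedFieldType makes the unification of the
   derivation lemmas diverge. *)
Definition Cplx (R : realType) : numFieldType := R[i].

Section Hardy.
Variable R : realType.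
Local Notation C := (Cplx R).
Implicit Types (f : C -> C) (p : \bar R) (t : R).

(* Real embedding and conjugation of [R[i]], retyped in [C] so that all ring
   operations below are those of the packaged structure. *)
Definition ofR (x : R) : C := x%:C.
Definition cconj (z : C) : C := conjc z.

(* [`|z|] lives in [C]; this is the same modulus, valued in [R]. *)
Definition modulus (z : C) : R := Normc.normc z.

Definition disc : set C := [set z | `|z| < 1].

Definition analytic_in_disc f : Prop :=
  forall z, disc z -> derivable f z 1.

Definition cis (theta : R) : C := cos theta +i* sin theta.

Definition circle_mean (q : R) f (r : R) : \bar R :=
  (((2 * pi)^-1)%:E *
   \int[lebesgue_measure]_(theta in `[0%R, (2 * pi)%R])
     (modulus (f (ofR r * cis theta)) `^ q)%:E)%E.

(* [p = +oo] is the else-branch; [p = -oo] is never used. *)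
Definition Hnorm p f : \bar R :=
  if p is q%:E
  then ((lim (circle_mean q f r @[r --> 1^'-])) `^ q^-1)%E
  else ereal_sup [set (modulus (f z))%:E | z in disc].

(* For analytic [f] the circular means are nondecreasing, so their limit in
   [0, +oo] exists; it is nevertheless required explicitly because the
   library's [lim] has a default value on divergent filters. *)
Definition Hardy p f : Prop :=
  [/\ analytic_in_disc f,
      (if p is q%:E then cvg (circle_mean q f r @[r --> 1^'-]) else True)
    & (Hnorm p f < +oo)%E].

Definition admissible p t f : Prop :=
  [/\ Hardy p f, (Hnorm p f <= 1)%E & f 0 = ofR t].

Definition Re_coef (k : nat) f : R :=
  complex.Re (derive1n k f 0 / k`!%:R : C).

Definition Phi (k : nat) p t : \bar R :=
  ereal_sup [set (Re_coef k f)%:E | f in admissible p t].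

Definition extremal (k : nat) p t f : Prop :=
  admissible p t f /\ (Re_coef k f)%:E = Phi k p t.

(* Functions in the disc are represented by total functions, which therefore
   only matter up to equality in the disc. *)
Definition unique_extremal (k : nat) p t f : Prop :=
  extremal k p t f /\
  forall g, extremal k p t g -> forall z, disc z -> g z = f z.

(* Principal argument in ]-pi, pi] (for nonzero [z]) and principal branch of
   the power with a real exponent. *)
Definition Arg (z : C) : R :=
  if 0 <= complex.Im z then acos (complex.Re z / modulus z)
  else - acos (complex.Re z / modulus z).

Definition cpow (z : C) (s : R) : C :=
  ofR (modulus z `^ s) * cis (s * Arg z).

Definition inv_exponent p : R := if p is q%:E then q^-1 else 0.

Definition alpha p t : R :=
  xget 0 [set a | 0 <= a < 1 /\ t = a * (1 + a ^+ 2) `^ (- inv_exponent p)].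

Definition beta p t : R :=
  xget 0 [set b | 0 <= b <= 1 /\ t = (1 + b ^+ 2) `^ (- inv_exponent p)].

Definition f1 p t (z : C) : C :=
  let s := inv_exponent p in
  if t < 2 `^ (- s) then
    let a := alpha p t in
    ((ofR a + z) / (1 + ofR a * z)) *
    (cpow (1 + ofR a * z) (2 * s) / ofR ((1 + a ^+ 2) `^ s))
  else
    let b := beta p t in
    cpow (1 + ofR b * z) (2 * s) / ofR ((1 + b ^+ 2) `^ s).

End Hardy.

(* Main.v *)
Require Import Defs.
From HB Require Import structures.
From mathcomp Require Import all_boot all_order all_algebra.
From mathcomp Require Import complex.
From mathcomp Require Import all_classical all_reals all_analysis.
From mathcomp Require Import ring lra.

Set Implicit Arguments.
Unset Strict Implicit.
Unset Printing Implicit Defensive.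

Import Order.TTheory GRing.Theory Num.Theory numFieldNormedType.Exports.
Local Open Scope classical_set_scope.
Local Open Scope ring_scope.
Local Open Scope complex_scope.

(** Put [s = 1/p] and [w = z^k], and multiply an admissible [f] by a function
    [h w] with [h 0 = h0 >= 0]: the [k]-th coefficient of [f h] is
    [h0 a_k + h'(0) t], where [a_k] is that of [f].  Taking
    [h = (1 + a w)^(2 - 2 s)] or [h = (b + w) (1 + b w)^(1 - 2 s)] makes
    [|h|^(1 / (1 - s)) <= |1 + g w|^2] with [g = a] or [g = b], so Hoelder's
    inequality bounds this coefficient by [(1 + g^2)^(1 - s)], which [f1 w] attains.
    Equality is analysed without boundary values: perturbing the multiplier
    [z^-k h] by a factor [1 + eps c z^n] and comparing the terms linear in [eps]
    determines all the coefficients of [f h], hence [f].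

    For [p = 1] the perturbation [1 + i eps Re (c z^n)] yields only the symmetry
    of the coefficients of [f h] about [k].  If [t > 1/2], then
    [h = (b + w) / (1 + b w)] with [b < 1] and the symmetry still determines [f].
    If [t <= 1/2], then [h = 1] and [f] is a polynomial of degree at most [2 k]
    with [z^-k f >= 0] on the circle; Fejer-Riesz factorises it, and for
    [t = 1/2] the equality case of the arithmetic-geometric mean leaves only
    [(1 + w)^2 / 2]. *)

(** The choice of [h] comes from duality. For finite [p], [|f1 w|^p] is proportional to
    [|1 + g w|^2] on the unit circle; equality in Hoelder's inequality asks for the same of
    [|h|^(1 / (1 - s))], and for [f1 h / w] to be nonnegative. For [g = a] a pure power of [1 + a w]
    does both, as [f1] already contains the factor [a + w]. For [g = b] the function [f1] has no
    zero in the disc, so one factor [1 + b w] of [h] is traded for [b + w], of equal modulus on the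
    circle. Either way [f1 h] is a constant multiple of [(g + w) (1 + g w)], the numerator of
    [kerQ].

    Means are bounded on circles of radius [r < 1] and compared only in the limit, so equality in
    Hoelder's inequality cannot be exploited pointwise; an inequality valid for all small [eps]
    takes its place. At [p = 1] the dual exponent is infinite: a perturbation [1 + eps c z^n] would
    break [|h| <= 1] at first order, an imaginary one does so only at second order. The conclusion
    there is weaker, which leaves room for several extremals when [h = 1]. *)

Section Basics.
Variable R : realType.
Local Notation C := (Cplx R).
Local Notation Re := (@complex.Re R).
Local Notation Im := (@complex.Im R).
Implicit Types (z w : C) (x y : R).

Lemma ReD z w : Re (z + w) = Re z + Re w. Proof. by case: z; case: w. Qed.
Lemma ImD z w : Im (z + w) = Im z + Im w. Proof. by case: z; case: w. Qed.
Lemma ReN z : Re (- z) = - Re z. Proof. by case: z. Qed.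
Lemma ImN z : Im (- z) = - Im z. Proof. by case: z. Qed.
Lemma ReM z w : Re (z * w) = Re z * Re w - Im z * Im w.
Proof. by case: z; case: w. Qed.
Lemma ImM z w : Im (z * w) = Re z * Im w + Im z * Re w.
Proof. by case: z; case: w. Qed.
Lemma Cext z w : Re z = Re w -> Im z = Im w -> z = w.
Proof. by case: z => a b; case: w => c d /= -> ->. Qed.

Lemma ofRD x y : ofR (x + y) = ofR x + ofR y.
Proof. by apply: Cext; rewrite ?ReD ?ImD //= addr0. Qed.
Lemma ofRN x : ofR (- x) = - ofR x.
Proof. by apply: Cext; rewrite ?ReN ?ImN //= oppr0. Qed.
Lemma ofRM x y : ofR (x * y) = ofR x * ofR y.
Proof. by apply: Cext; rewrite ?ReM ?ImM //= ?mul0r ?mulr0 ?addr0 ?subr0. Qed.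
Lemma ofR0 : ofR 0 = 0 :> C. Proof. by []. Qed.
Lemma ofR1 : ofR 1 = 1 :> C. Proof. by []. Qed.
Lemma ofRX x n : ofR (x ^+ n) = ofR x ^+ n.
Proof. by elim: n => // n ih; rewrite !exprS ofRM ih. Qed.
Lemma ofR_inj : injective (@ofR R). Proof. by move=> x y []. Qed.
Lemma ofRV x : ofR x^-1 = (ofR x)^-1.
Proof.
have [->|x0] := eqVneq x 0; first by rewrite invr0 ofR0 invr0.
apply: (mulfI (x := ofR x)).
  by apply/eqP => h; move/eqP: x0; apply; exact: ofR_inj.
by rewrite -ofRM !mulfV // -ofR0 (inj_eq ofR_inj).
Qed.
Lemma ofR_nat n : ofR n%:R = n%:R :> C.
Proof. by elim: n => // n ih; rewrite -!natr1 ofRD ih. Qed.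

Lemma norm_modulus z : `|z| = ofR (modulus z). Proof. by []. Qed.
Lemma ltofR x y : (ofR x < ofR y :> C) = (x < y). Proof. exact: ltcR. Qed.
Lemma leofR x y : (ofR x <= ofR y :> C) = (x <= y). Proof. exact: lecR. Qed.
Lemma modulusM z w : modulus (z * w) = modulus z * modulus w.
Proof. exact: Normc.normcM. Qed.
Lemma modulus_ge0 z : 0 <= modulus z.
Proof. by case: z => a b; rewrite sqrtr_ge0. Qed.
Lemma modulus0 : modulus (0 : C) = 0. Proof. exact: Normc.normc0. Qed.
Lemma modulus1 : modulus (1 : C) = 1. Proof. exact: Normc.normc1. Qed.
Lemma modulusD z w : modulus (z + w) <= modulus z + modulus w.
Proof. by rewrite -leofR ofRD -!norm_modulus ler_normD. Qed.
Lemma modulusN z : modulus (- z) = modulus z.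
Proof. by apply: ofR_inj; rewrite -!norm_modulus normrN. Qed.
Lemma modulusB z w : modulus (z - w) <= modulus z + modulus w.
Proof. by rewrite -(modulusN w) modulusD. Qed.
Lemma modulusBC z w : modulus (z - w) = modulus (w - z).
Proof. by rewrite -modulusN opprB. Qed.
Lemma modulusV z : modulus z^-1 = (modulus z)^-1.
Proof. exact: Normc.normcV. Qed.
Lemma modulusX z n : modulus (z ^+ n) = modulus z ^+ n.
Proof. by elim: n => [|n ih]; rewrite ?modulus1 // !exprS modulusM ih. Qed.
Lemma modulus_eq0 z : (modulus z == 0) = (z == 0).
Proof. by rewrite -(inj_eq ofR_inj) -norm_modulus normr_eq0. Qed.
Lemma modulus_gt0 z : (0 < modulus z) = (z != 0).
Proof. by rewrite lt_def modulus_eq0 modulus_ge0 andbT. Qed.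
Lemma modulus_ofR x : modulus (ofR x) = `|x|.
Proof. by rewrite /modulus /= expr0n /= addr0 sqrtr_sqr. Qed.
Lemma sqr_modulus z : modulus z ^+ 2 = Re z ^+ 2 + Im z ^+ 2.
Proof. by case: z => a b; rewrite /modulus /= sqr_sqrtr // addr_ge0 // sqr_ge0. Qed.
Lemma normRe_le z : `|Re z| <= modulus z.
Proof.
by rewrite -(@ler_pXn2r _ 2) ?nnegrE ?modulus_ge0 // sqr_modulus real_normK ?num_real // lerDl sqr_ge0.
Qed.
Lemma normIm_le z : `|Im z| <= modulus z.
Proof.
by rewrite -(@ler_pXn2r _ 2) ?nnegrE ?modulus_ge0 // sqr_modulus real_normK ?num_real // lerDr sqr_ge0.
Qed.
Lemma Re_le z : Re z <= modulus z.
Proof. exact: le_trans (ler_norm _) (normRe_le z). Qed.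
Lemma modulus_leD z : modulus z <= `|Re z| + `|Im z|.
Proof.
rewrite -(@ler_pXn2r _ 2) ?nnegrE ?modulus_ge0 ?addr_ge0 // sqr_modulus.
rewrite sqrrD !real_normK ?num_real // -addrA lerD2l lerDr.
by rewrite mulrn_wge0 // mulr_ge0.
Qed.

Lemma disc_modulus z : disc z <-> modulus z < 1.
Proof. by rewrite /disc /mkset norm_modulus -ofR1 ltofR. Qed.

Lemma cisD x y : cis (x + y) = cis x * cis y.
Proof.
by apply: Cext; rewrite ?ReM ?ImM /= ?cosD ?sinD // addrC [cos x * _]mulrC addrC mulrC.
Qed.
Lemma cis0 : cis 0 = 1 :> C.
Proof. by rewrite /cis cos0 sin0. Qed.
Lemma modulus_cis x : modulus (cis x) = 1.
Proof. by rewrite /modulus /= cos2Dsin2 sqrtr1. Qed.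
Lemma cis_neq0 x : cis x != 0.
Proof. by rewrite -modulus_eq0 modulus_cis oner_eq0. Qed.
Lemma cis2pi : cis (2 * pi) = 1 :> C.
Proof. by rewrite /cis mulr_natl cos2pi sin2pi. Qed.

Lemma Re_cconj z : Re (cconj z) = Re z. Proof. by case: z. Qed.
Lemma Im_cconj z : Im (cconj z) = - Im z. Proof. by case: z. Qed.
Lemma cconjD z w : cconj (z + w) = cconj z + cconj w.
Proof. by apply: Cext; rewrite !(Re_cconj, Im_cconj, ReD, ImD) // opprD. Qed.
Lemma cconjN z : cconj (- z) = - cconj z.
Proof. by apply: Cext; rewrite !(Re_cconj, Im_cconj, ReN, ImN). Qed.
Lemma cconjB z w : cconj (z - w) = cconj z - cconj w.
Proof. by rewrite cconjD cconjN. Qed.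
Lemma cconjM z w : cconj (z * w) = cconj z * cconj w.
Proof. by apply: Cext; rewrite !(Re_cconj, Im_cconj, ReM, ImM); ring. Qed.
Lemma cconj_ofR x : cconj (ofR x) = ofR x.
Proof. by apply: Cext; rewrite ?Re_cconj ?Im_cconj //= oppr0. Qed.
Lemma cconjX z n : cconj (z ^+ n) = cconj z ^+ n.
Proof. by elim: n => [|n ih]; [exact: (cconj_ofR 1)|rewrite !exprS cconjM ih]. Qed.
Lemma cconjK z : cconj (cconj z) = z.
Proof. by apply: Cext; rewrite !(Re_cconj, Im_cconj) ?opprK. Qed.
Lemma mul_cconj z : z * cconj z = ofR (modulus z ^+ 2).
Proof.
by apply: Cext; rewrite !(Re_cconj, Im_cconj, ReM, ImM) /= ?sqr_modulus; ring.
Qed.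
Lemma modulus_cconj z : modulus (cconj z) = modulus z.
Proof. by case: z => a b; rewrite /modulus /= sqrrN. Qed.
Lemma cconj_unit z : modulus z = 1 -> cconj z = z^-1.
Proof.
move=> z1; have z0 : z != 0 by rewrite -modulus_eq0 z1 oner_eq0.
by apply: (mulfI z0); rewrite mulfV // mul_cconj z1 expr1n.
Qed.

(** The balls of [C] have radii in [C] itself, but a positive element of [C] is real, so real radii
    suffice. *)
Lemma nbhs_modulus z (A : set C) :
  nbhs z A <-> exists2 e : R, 0 < e & forall w, modulus (w - z) < e -> A w.
Proof.
split=> [/nbhs_ballP[e /= e0 h]|[e e0 h]].
  have er : Im e = 0 by move: e0; rewrite ltcE => /andP[/eqP].
  have ee : e = ofR (Re e) by apply: Cext.
  exists (Re e); first by move: e0; rewrite ee -ofR0 ltofR.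
  move=> w hw; apply: h; rewrite /ball /= -opprB normrN norm_modulus ee ltofR //.
apply/nbhs_ballP; exists (ofR e); first by rewrite /= -ofR0 ltofR.
move=> w; rewrite /ball /= -opprB normrN norm_modulus ltofR; exact: h.
Qed.

Lemma cvg_modulus (T : Type) (F : set_system T) {FF : Filter F} (f : T -> C) z :
  f @ F --> z <-> forall e : R, 0 < e -> \forall t \near F, modulus (f t - z) < e.
Proof.
split=> [h e e0|h A].
  by apply: (h [set w | modulus (w - z) < e]); apply/nbhs_modulus; exists e.
by move=> /nbhs_modulus[e e0 hA]; apply: filterS (h e e0) => t; exact: hA.
Qed.

Lemma cvg_realE (T : Type) (F : set_system T) {FF : Filter F} (f : T -> R) x :
  f @ F --> x <-> forall e : R, 0 < e -> \forall t \near F, `|f t - x| < e.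
Proof.
split=> [h e e0|h].
  by move/cvgrPdistC_lt : h; apply.
by apply/cvgrPdistC_lt => e e0; exact: h.
Qed.

Lemma continuousCR_at (f : C -> R) z :
  (forall e : R, 0 < e -> exists2 d : R, 0 < d &
     forall w, modulus (w - z) < d -> `|f w - f z| < e) ->
  {for z, continuous f}.
Proof.
move=> h; apply: (proj2 (@cvg_realE _ (nbhs z) _ f (f z))) => e e0.
by apply/nbhs_modulus; exact: h.
Qed.

Lemma continuous_Re : continuous (Re : C -> R).
Proof.
move=> z; apply: continuousCR_at => e e0; exists e => // w.
by apply: le_lt_trans; rewrite -ReN -ReD normRe_le.
Qed.
Lemma continuous_Im : continuous (Im : C -> R).
Proof.
move=> z; apply: continuousCR_at => e e0; exists e => // w.
by apply: le_lt_trans; rewrite -ImN -ImD normIm_le.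
Qed.
Lemma modulus_dist z w : `|modulus z - modulus w| <= modulus (z - w).
Proof.
rewrite ler_norml; apply/andP; split.
  rewrite lerNl opprB lerBlDl; have := modulusD z (w - z); rewrite addrC subrK.
  by rewrite -opprB modulusN.
by rewrite lerBlDl -{1}(subrK w z) addrC; apply: modulusD.
Qed.
Lemma continuous_modulus : continuous (@modulus R : C -> R).
Proof.
move=> z; apply: continuousCR_at => e e0; exists e => // w.
exact: le_lt_trans (modulus_dist _ _).
Qed.
Lemma cvg_pair (T : Type) (F : set_system T) {FF : Filter F} (f : T -> C) z :
  Re \o f @ F --> Re z -> Im \o f @ F --> Im z -> f @ F --> z.
Proof.
move=> /cvg_realE hr /cvg_realE hi; apply/cvg_modulus => e e0.
have e2 : 0 < e / 2 by rewrite divr_gt0.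
near=> t; apply: le_lt_trans (modulus_leD _) _.
rewrite [e]splitr ltrD //.
  by rewrite ReD ReN; near: t; exact: hr.
by rewrite ImD ImN; near: t; exact: hi.
Unshelve. all: by end_near. Qed.
Lemma continuous_ofR : continuous (@ofR R).
Proof.
by move=> x; apply: cvg_pair; [exact: cvg_id|exact: cvg_cst].
Qed.
Lemma continuous_cis : continuous (@cis R).
Proof.
by move=> x; apply: cvg_pair; [exact: continuous_cos|exact: continuous_sin].
Qed.
End Basics.

(** * Goursat's theorem *)

Section RealIntegral.
Variable R : realType.
Implicit Types (g h : R -> R) (a b c : R).

Definition rint g a b : R := \int[@lebesgue_measure R]_(x in `[a, b]) g x.
Definition cont_on g a b := forall x, a <= x <= b -> {for x, continuous g}.

Lemma cont_on_integrable g a b : cont_on g a b ->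
  (@lebesgue_measure R).-integrable `[a, b] (EFin \o g).
Proof.
move=> cg; apply: continuous_compact_integrable; first exact: segment_compact.
apply: continuous_in_subspaceT => x; rewrite inE /= in_itv /=; exact: cg.
Qed.

Lemma eq_rint g h a b : (forall x, a <= x <= b -> g x = h x) ->
  rint g a b = rint h a b.
Proof.
by move=> gh; apply: eq_Rintegral => x; rewrite inE /= in_itv /=; exact: gh.
Qed.

Lemma rintD g h a b : cont_on g a b -> cont_on h a b ->
  rint (fun x => g x + h x) a b = rint g a b + rint h a b.
Proof. by move=> cg ch; rewrite /rint RintegralD //; exact: cont_on_integrable. Qed.

Lemma rintB g h a b : cont_on g a b -> cont_on h a b ->
  rint (fun x => g x - h x) a b = rint g a b - rint h a b.
Proof. by move=> cg ch; rewrite /rint RintegralB //; exact: cont_on_integrable. Qed.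

Lemma rintZ g a b k : cont_on g a b ->
  rint (fun x => k * g x) a b = k * rint g a b.
Proof. by move=> cg; rewrite /rint RintegralZl //; exact: cont_on_integrable. Qed.

Lemma rint_cst a b k : a <= b -> rint (fun=> k) a b = k * (b - a).
Proof.
move=> ab; rewrite /rint Rintegral_cst //= lebesgue_measure_itv /= lte_fin.
by case: ltgtP ab => // -> _; rewrite subrr.
Qed.

Lemma le_rint g h a b : cont_on g a b -> cont_on h a b ->
  (forall x, a <= x <= b -> g x <= h x) -> rint g a b <= rint h a b.
Proof.
move=> cg ch gh; by apply: le_Rintegral => //; exact: cont_on_integrable.
Qed.

Lemma rint_le_cst g a b M : a <= b -> cont_on g a b ->
  (forall x, a <= x <= b -> g x <= M) -> rint g a b <= M * (b - a).
Proof.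
move=> ab cg gM; rewrite -(rint_cst M ab); apply: le_rint => //.
by move=> x _; exact: cst_continuous.
Qed.

Lemma norm_rint_le g a b M : a <= b -> cont_on g a b ->
  (forall x, a <= x <= b -> `|g x| <= M) -> `|rint g a b| <= M * (b - a).
Proof.
move=> ab cg gM; rewrite ler_norml; apply/andP; split; last first.
  by apply: rint_le_cst => // x /gM; apply: le_trans; exact: ler_norm.
rewrite -mulNr -(rint_cst _ ab); apply: le_rint => //.
  by move=> x _; exact: cst_continuous.
by move=> x /gM; rewrite ler_norml => /andP[].
Qed.

Lemma rint_split g a b c : a <= c -> c <= b -> cont_on g a b ->
  rint g a b = rint g a c + rint g c b.
Proof.
move=> ac cb cg; rewrite /rint.
rewrite -(@Rintegral_itv_obnd_cbnd _ c); last first.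
  apply: (integrableS _ _ _ (cont_on_integrable cg)) => //.
  by apply: subset_itvScc; rewrite ?bnd_simp.
rewrite -(@Rintegral_itvB _ _ (BLeft a) (BRight b)) ?bnd_simp //.
  by rewrite addrC subrK.
exact: cont_on_integrable.
Qed.

Lemma cont_onB g h a b : cont_on g a b -> cont_on h a b ->
  cont_on (fun x => g x - h x) a b.
Proof. by move=> cg ch x ab; apply: cvgB; [exact: cg|exact: ch]. Qed.

End RealIntegral.

Section Bisection.
Variables (R : realType) (D : R -> R -> R -> R -> R).

(** The last quarter is taken without a test: if the other three fail theirs, additivity of [D] and
    the triangle inequality force the fourth to pass. *)
Definition quarter (q : R * R * R * R) : R * R * R * R :=
  let: (a, b, c, d) := q in
  let m := (a + b) / 2 in let n := (c + d) / 2 in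
  if `|D a b c d| <= 4 * `|D a m c n| then (a, m, c, n) else
  if `|D a b c d| <= 4 * `|D m b c n| then (m, b, c, n) else
  if `|D a b c d| <= 4 * `|D a m n d| then (a, m, n, d) else (m, b, n, d).

Variables a b c d : R.
Hypotheses (ab : a <= b) (cd : c <= d).
Hypothesis splitx : forall a' m b' c' d', a <= a' -> a' <= m -> m <= b' ->
  b' <= b -> c <= c' -> c' <= d' -> d' <= d ->
  D a' b' c' d' = D a' m c' d' + D m b' c' d'.
Hypothesis splity : forall a' b' c' m d', a <= a' -> a' <= b' -> b' <= b ->
  c <= c' -> c' <= m -> m <= d' -> d' <= d ->
  D a' b' c' d' = D a' b' c' m + D a' b' m d'.
Hypothesis small : forall x0 y0, a <= x0 <= b -> c <= y0 <= d ->
  forall e, 0 < e -> exists2 del : R, 0 < del & forall a' b' c' d',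
  a <= a' -> a' <= x0 <= b' -> b' <= b -> c <= c' -> c' <= y0 <= d' ->
  d' <= d -> b' - a' < del -> d' - c' < del ->
  `|D a' b' c' d'| <= e * ((b' - a') + (d' - c')) ^+ 2.

Let q n := iter n quarter (a, b, c, d).
Let qa n := (q n).1.1.1.
Let qb n := (q n).1.1.2.
Let qc n := (q n).1.2.
Let qd n := (q n).2.

Let valid n : [/\ a <= qa n, qa n <= qb n, qb n <= b, c <= qc n &
  qc n <= qd n] /\ qd n <= d.
Proof.
elim: n => [|n]; first by rewrite /qa /qb /qc /qd /q.
rewrite /qa /qb /qc /qd /q /= -/(q n); case: (q n) => [[[a' b'] c'] d'] /=.
move=> [[h1 h2 h3 h4 h5] h6].
rewrite /quarter.
by case: ifP => _; [|case: ifP => _; [|case: ifP => _]]; do ?split => /=; lra.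
Qed.

Let step n : [/\ qa n <= qa n.+1, qb n.+1 <= qb n, qc n <= qc n.+1 &
   qd n.+1 <= qd n] /\ [/\ qb n.+1 - qa n.+1 = (qb n - qa n) / 2,
    qd n.+1 - qc n.+1 = (qd n - qc n) / 2 &
    `|D (qa n) (qb n) (qc n) (qd n)| <=
      4 * `|D (qa n.+1) (qb n.+1) (qc n.+1) (qd n.+1)|].
Proof.
have := valid n.
rewrite /qa /qb /qc /qd /q /= -/(q n); case: (q n) => [[[a' b'] c'] d'] /=.
move=> [[h1 h2 h3 h4 h5] h6]; rewrite /quarter.
case: ifPn => [H|/negP H1]; first by do ?split => //=; lra.
case: ifPn => [H|/negP H2]; first by do ?split => //=; lra.
case: ifPn => [H|/negP H3]; first by do ?split => //=; lra.
do ?split => //=; try lra.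
rewrite leNgt; apply/negP => H4.
move/negP: H1; move/negP: H2; move/negP : H3; rewrite -!ltNge => H3 H2 H1.
set m := (a' + b') / 2 in H1 H2 H3 H4 *; set n' := (c' + d') / 2 in H1 H2 H3 H4 *.
have E : D a' b' c' d' = D a' m c' n' + D m b' c' n' + (D a' m n' d' + D m b' n' d').
  rewrite (@splity a' b' c' n' d') /n'; try lra.
  by congr (_ + _); apply: splitx; rewrite /m; lra.
have := ler_normD (D a' m c' n' + D m b' c' n') (D a' m n' d' + D m b' n' d').
have := ler_normD (D a' m c' n') (D m b' c' n').
have := ler_normD (D a' m n' d') (D m b' n' d').
by rewrite -E; lra.
Qed.

Let mono n k : [/\ qa n <= qa (n + k), qb (n + k) <= qb n, qc n <= qc (n + k)
   & qd (n + k) <= qd n].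
Proof.
elim: k => [|k [h1 h2 h3 h4]]; first by rewrite addn0.
by rewrite addnS; have [[g1 g2 g3 g4] _] := step (n + k)%N; split; lra.
Qed.

Let sizes n : [/\ qb n - qa n = (b - a) / 2 ^+ n, qd n - qc n = (d - c) / 2 ^+ n &
  `|D a b c d| <= 4 ^+ n * `|D (qa n) (qb n) (qc n) (qd n)|].
Proof.
elim: n => [|n [h1 h2 h3]].
  by rewrite /qa /qb /qc /qd /q /= expr0 !divr1 mul1r.
have [_ [g1 g2 g3]] := step n; split.
- by rewrite g1 h1 exprSr invfM mulrA.
- by rewrite g2 h2 exprSr invfM mulrA.
apply: le_trans h3 _; rewrite exprSr -mulrA ler_pM2l //.
Qed.

Let nest (u v : nat -> R) : (forall n k, u n <= u (n + k)%N) ->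
  (forall n k, v (n + k)%N <= v n) -> (forall n, u n <= v n) ->
  exists x, forall n, u n <= x <= v n.
Proof.
move=> hu hv huv.
have uv n m : u n <= v m.
  apply: (le_trans (hu n m)); apply: (le_trans (huv _)).
  by rewrite addnC.
exists (sup (range u)) => n; apply/andP; split.
  apply: ub_le_sup; last by exists n.
  by exists (v 0%N) => _ [m _ <-].
by apply: ge_sup; [exists (u 0%N); exists 0%N|move=> _ [m _ <-]].
Qed.

(* The contour integral [D a b c d] enters only through additivity ([splitx],
   [splity]) and the local estimate [small]. *)
Lemma bisection_eq0 : D a b c d = 0.
Proof.
have [x0 hx] : exists x, forall n, qa n <= x <= qb n.
  by apply: nest => [n k|n k|n]; [have [] := mono n k|have [] := mono n k|
    have [[]] := valid n].
have [y0 hy] : exists x, forall n, qc n <= x <= qd n.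
  by apply: nest => [n k|n k|n]; [have [] := mono n k|have [] := mono n k|
    have [[]] := valid n].
apply/eqP; rewrite -normr_le0; apply/ler_addgt0Pr => e e0; rewrite add0r.
set L := (b - a) + (d - c).
(* The [+ 1] keeps the divisor positive when the rectangle is degenerate. *)
have L2 : 0 < L ^+ 2 + 1 by rewrite ltr_wpDl // sqr_ge0.
have [del del0 hdel] := small (hx 0%N) (hy 0%N) (divr_gt0 e0 L2).
have [n hn] : exists n, L / del < 2 ^+ n.
  by exists (Num.Def.archi_bound (L / del)); exact: upper_nthrootP.
have [h1 h2 h3] := sizes n.
have [[v1 v2 v3 v4 v5] v6] := valid n.
have Ln : L / 2 ^+ n < del.
  by rewrite ltr_pdivrMr // -ltr_pdivrMl // mulrC.
have la : (b - a) / 2 ^+ n <= L / 2 ^+ n.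
  by rewrite ler_pM2r ?invr_gt0 // /L; lra.
have lc : (d - c) / 2 ^+ n <= L / 2 ^+ n.
  by rewrite ler_pM2r ?invr_gt0 // /L; lra.
have /(_ _ _ _ _) H := hdel (qa n) (qb n) (qc n) (qd n).
have {}H : `|D (qa n) (qb n) (qc n) (qd n)| <=
  e / (L ^+ 2 + 1) * ((qb n - qa n) + (qd n - qc n)) ^+ 2.
  by apply: H => //; rewrite ?h1 ?h2; apply: le_lt_trans Ln.
apply: (le_trans h3).
(* The factor [4 ^+ n] is cancelled by the square of the shrinking half-perimeter [L / 2 ^+ n],
   which leaves [e * L ^+ 2 / (L ^+ 2 + 1)]. *)
have E4 : (4 : R) ^+ n = (2 ^+ n) ^+ 2 by rewrite exprAC; congr (_ ^+ _); rewrite -natrX.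
rewrite E4.
apply: (@le_trans _ _ ((2 ^+ n) ^+ 2 * (e / (L ^+ 2 + 1) * (L / 2 ^+ n) ^+ 2))).
  by rewrite ler_pM2l ?exprn_gt0 // (le_trans H) // h1 h2 -mulrDl.
have -> : (2 ^+ n) ^+ 2 * (e / (L ^+ 2 + 1) * (L / 2 ^+ n) ^+ 2) =
   e * (L ^+ 2 / (L ^+ 2 + 1)).
  by field; rewrite !gt_eqF.
by rewrite ger_pMr // ler_pdivrMr // mul1r lerDl.
Qed.
End Bisection.

Section Goursat.
Variable R : realType.
Implicit Types (u v : R -> R -> R).

(* Real form of: [u + iv] has complex derivative [p + iq] at [(x0, y0)]; it keeps the
   Goursat argument within real one-variable integrals. *)
Definition crdiff u v (x0 y0 : R) := exists p q : R, forall e, 0 < e ->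
  exists2 del : R, 0 < del & forall x y, `|x - x0| < del -> `|y - y0| < del ->
    `|u x y - u x0 y0 - (p * (x - x0) - q * (y - y0))| <= e * (`|x - x0| + `|y - y0|) /\
    `|v x y - v x0 y0 - (q * (x - x0) + p * (y - y0))| <= e * (`|x - x0| + `|y - y0|).

Lemma lipschitz_at_continuous (f : R -> R) x0 (K del : R) : 0 < del ->
  (forall x, `|x - x0| < del -> `|f x - f x0| <= K * `|x - x0|) ->
  {for x0, continuous f}.
Proof.
move=> d0 h; apply: (proj2 (@cvg_realE _ _ (nbhs x0) _ f (f x0))) => e e0.
near=> x.
have xd : `|x - x0| < del by near: x; exact: cvgr_distC_lt.
have xe : `|x - x0| < e / (`|K| + 1).
  by near: x; apply: cvgr_distC_lt => //; rewrite divr_gt0.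
apply: le_lt_trans (h _ xd) _; apply: (@le_lt_trans _ _ (`|x - x0| * (`|K| + 1))).
  rewrite mulrC ler_wpM2l // (le_trans (ler_norm _)) // lerDl //.
by rewrite -ltr_pdivlMr.
Unshelve. all: by end_near. Qed.

Lemma crdiff_continuous u v x0 y0 : crdiff u v x0 y0 ->
  [/\ {for x0, continuous (u ^~ y0)}, {for y0, continuous (u x0)},
      {for x0, continuous (v ^~ y0)} & {for y0, continuous (v x0)}].
Proof.
move=> [p [q /(_ 1 ltr01)[del d0 h]]].
have hx x : `|x - x0| < del -> `|u x y0 - u x0 y0| <= (1 + `|p|) * `|x - x0| /\
    `|v x y0 - v x0 y0| <= (1 + `|q|) * `|x - x0|.
  move=> hh; have := h x y0 hh; rewrite subrr normr0 => /(_ d0).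
  rewrite !mulr0 subr0 !addr0 !mul1r => -[h1 h2].
  rewrite !mulrDl !mul1r -!normrM; split.
    rewrite -[u x y0 - _](subrK (p * (x - x0))); apply: le_trans (ler_normD _ _) _.
    by rewrite lerD2r.
  rewrite -[v x y0 - _](subrK (q * (x - x0))); apply: le_trans (ler_normD _ _) _.
  by rewrite lerD2r.
have hy y : `|y - y0| < del -> `|u x0 y - u x0 y0| <= (1 + `|q|) * `|y - y0| /\
    `|v x0 y - v x0 y0| <= (1 + `|p|) * `|y - y0|.
  move=> hh; have := h x0 y; rewrite subrr normr0 => /(_ d0 hh).
  rewrite !mulr0 sub0r !add0r opprK !mul1r => -[h1 h2].
  rewrite !mulrDl !mul1r -!normrM; split.
    rewrite -[u x0 y - _](addrK (q * (y - y0))).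
    by apply: le_trans (ler_normB _ _) _; rewrite lerD2r.
  rewrite -[v x0 y - _](subrK (p * (y - y0))); apply: le_trans (ler_normD _ _) _.
  by rewrite lerD2r.
split.
- by apply: (lipschitz_at_continuous d0) => x hh; exact: (hx _ hh).1.
- by apply: (lipschitz_at_continuous d0) => x hh; exact: (hy _ hh).1.
- by apply: (lipschitz_at_continuous d0) => x hh; exact: (hx _ hh).2.
- by apply: (lipschitz_at_continuous d0) => x hh; exact: (hy _ hh).2.
Qed.

Section Rectangle.
Variables (u v : R -> R -> R) (a b c d : R).
Hypothesis (ab : a <= b) (cd : c <= d).
Hypothesis H : forall x y, a <= x <= b -> c <= y <= d -> crdiff u v x y.

(** The real part of the contour integral of [u + i v] around the rectangle. *)
Let D a b c d := rint (fun x => u x c - u x d) a b - rint (fun y => v b y - v a y) c d.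

Let contu a' b' y : a <= a' -> b' <= b -> c <= y <= d -> cont_on (u ^~ y) a' b'.
Proof.
move=> h1 h2 hy x /andP[hx1 hx2].
by have [] // := crdiff_continuous (@H x y _ hy); apply/andP; split; lra.
Qed.
Let contv c' d' x : c <= c' -> d' <= d -> a <= x <= b -> cont_on (v x) c' d'.
Proof.
move=> h1 h2 hx y /andP[hy1 hy2].
by have [] // := crdiff_continuous (@H x y hx _); apply/andP; split; lra.
Qed.

Let splitx a' m b' c' d' : a <= a' -> a' <= m -> m <= b' ->
  b' <= b -> c <= c' -> c' <= d' -> d' <= d ->
  D a' b' c' d' = D a' m c' d' + D m b' c' d'.
Proof.
move=> h1 h2 h3 h4 h5 h6 h7; rewrite /D (@rint_split _ _ a' b' m) //; last first.
  by apply: cont_onB; apply: contu; rewrite ?h1 //; apply/andP; split; lra.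
rewrite addrACA -opprD; congr (_ - _).
rewrite -rintD; last 2 first.
- by apply: cont_onB; apply: contv => //; apply/andP; split; lra.
- by apply: cont_onB; apply: contv => //; apply/andP; split; lra.
by apply: eq_rint => y _; rewrite addrAC subrKC // addrC.
Qed.

Let splity a' b' c' m d' : a <= a' -> a' <= b' -> b' <= b ->
  c <= c' -> c' <= m -> m <= d' -> d' <= d ->
  D a' b' c' d' = D a' b' c' m + D a' b' m d'.
Proof.
move=> h1 h2 h3 h4 h5 h6 h7; rewrite /D (@rint_split _ _ c' d' m) //; last first.
  by apply: cont_onB; apply: contv; rewrite ?h4 //; apply/andP; split; lra.
rewrite addrACA -opprD; congr (_ - _).
rewrite -rintD; last 2 first.
- by apply: cont_onB; apply: contu => //; apply/andP; split; lra.
- by apply: cont_onB; apply: contu => //; apply/andP; split; lra.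
by apply: eq_rint => y _; rewrite subrKA.
Qed.

(** The affine approximation at [(x0, y0)] contributes [q (b' - a') (d' - c')] to each of the two
    integrals, and these cancel; what remains is the error of the approximation on the four
    sides. *)
Let small x0 y0 : a <= x0 <= b -> c <= y0 <= d ->
  forall e, 0 < e -> exists2 del : R, 0 < del & forall a' b' c' d',
  a <= a' -> a' <= x0 <= b' -> b' <= b -> c <= c' -> c' <= y0 <= d' ->
  d' <= d -> b' - a' < del -> d' - c' < del ->
  `|D a' b' c' d'| <= e * ((b' - a') + (d' - c')) ^+ 2.
Proof.
move=> hx0 hy0 e e0; have [p [q h]] := H hx0 hy0.
have [del d0 {}h] := h (e / 2) (divr_gt0 e0 (ltr0Sn _ 1)).
exists del => // a' b' c' d' aa /andP[ax xb] bb cc /andP[cy yd] dd hdx hdy.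
set L := (b' - a') + (d' - c').
have est x y : a' <= x <= b' -> c' <= y <= d' ->
    `|u x y - u x0 y0 - (p * (x - x0) - q * (y - y0))| <= e / 2 * L /\
    `|v x y - v x0 y0 - (q * (x - x0) + p * (y - y0))| <= e / 2 * L.
  move=> /andP[x1 x2] /andP[y1 y2].
  have nx : `|x - x0| <= b' - a' by rewrite ler_norml; apply/andP; split; lra.
  have ny : `|y - y0| <= d' - c' by rewrite ler_norml; apply/andP; split; lra.
  have [h1 h2] := h x y (le_lt_trans nx hdx) (le_lt_trans ny hdy).
  have hL : e / 2 * (`|x - x0| + `|y - y0|) <= e / 2 * L.
    by rewrite ler_pM2l ?divr_gt0 // lerD.
  by split; [exact: le_trans h1 _|exact: le_trans h2 _].
have ab' : a' <= b' by lra.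
have cd' : c' <= d' by lra.
have c1 : cont_on (fun x => u x c' - u x d') a' b'.
  by apply: cont_onB; apply: contu => //; apply/andP; split; lra.
have c2 : cont_on (fun y => v b' y - v a' y) c' d'.
  by apply: cont_onB; apply: contv => //; apply/andP; split; lra.
have ck k a1 b1 : cont_on (fun=> k : R) a1 b1 by move=> x _; exact: cst_continuous.
have e1 : `|rint (fun x => u x c' - u x d' - q * (d' - c')) a' b'| <= e * L * (b' - a').
  apply: norm_rint_le => //; first exact: cont_onB.
  move=> x hx.
  have [h1 _] := est x c' hx (introT andP (conj (lexx _) cd')).
  have [h2 _] := est x d' hx (introT andP (conj cd' (lexx _))).
  have := ler_normB (u x c' - u x0 y0 - (p * (x - x0) - q * (c' - y0)))
   (u x d' - u x0 y0 - (p * (x - x0) - q * (d' - y0))).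
  have -> : u x c' - u x0 y0 - (p * (x - x0) - q * (c' - y0)) -
   (u x d' - u x0 y0 - (p * (x - x0) - q * (d' - y0))) =
   u x c' - u x d' - q * (d' - c') by ring.
  by move=> h3; lra.
have e2 : `|rint (fun y => v b' y - v a' y - q * (b' - a')) c' d'| <= e * L * (d' - c').
  apply: norm_rint_le => //; first exact: cont_onB.
  move=> y hy.
  have [_ h1] := est b' y (introT andP (conj ab' (lexx _))) hy.
  have [_ h2] := est a' y (introT andP (conj (lexx _) ab')) hy.
  have := ler_normB (v b' y - v x0 y0 - (q * (b' - x0) + p * (y - y0)))
   (v a' y - v x0 y0 - (q * (a' - x0) + p * (y - y0))).
  have -> : v b' y - v x0 y0 - (q * (b' - x0) + p * (y - y0)) -
   (v a' y - v x0 y0 - (q * (a' - x0) + p * (y - y0))) =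
   v b' y - v a' y - q * (b' - a') by ring.
  by move=> h3; lra.
rewrite rintB // rint_cst // in e1; rewrite rintB // rint_cst // in e2.
have := ler_normB (rint (fun x => u x c' - u x d') a' b' - q * (d' - c') * (b' - a'))
 (rint (fun y => v b' y - v a' y) c' d' - q * (b' - a') * (d' - c')).
have -> : rint (fun x => u x c' - u x d') a' b' - q * (d' - c') * (b' - a') -
  (rint (fun y => v b' y - v a' y) c' d' - q * (b' - a') * (d' - c')) = D a' b' c' d'.
  by rewrite /D; ring.
have -> : e * L ^+ 2 = e * L * (b' - a') + e * L * (d' - c') by rewrite /L; ring.
by move=> h3; lra.
Qed.

Lemma goursat_rectangle :
  rint (fun x => u x c - u x d) a b = rint (fun y => v b y - v a y) c d.
Proof. by apply/eqP; rewrite -subr_eq0; apply/eqP; exact: (bisection_eq0 ab cd splitx splity small). Qed.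
End Rectangle.
End Goursat.

(** * Complex differentiation and the exponential *)

Section ComplexDerivative.
Variable R : realType.
Local Notation C := (Cplx R).
Local Notation Re := (@complex.Re R).
Local Notation Im := (@complex.Im R).
Implicit Types (z w : C) (f g : C -> C).

(** A derivative with real tolerances and without quotients, so that [w = z] is no exception and
    remainders can be estimated directly. *)
Definition cder f z (d : C) := forall e : R, 0 < e ->
  exists2 del : R, 0 < del & forall w, modulus (w - z) < del ->
    modulus (f w - f z - d * (w - z)) <= e * modulus (w - z).

Lemma derivable_cder f z : derivable f z 1 -> cder f z (derive1 f z).
Proof.
move=> /cvg_ex[d hd].
have -> : derive1 f z = d.
  by rewrite derive1E; apply: cvg_lim => //; exact: hd.
move=> e e0.
have : nbhs d [set w | modulus (w - d) < e] by apply/nbhs_modulus; exists e.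
move=> /hd; rewrite /nbhs /= /dnbhs /within /= => /nbhs_modulus[del d0 H].
exists del => // w wz; have [->|nwz] := eqVneq w z.
  by rewrite !subrr mulr0 subrr modulus0 mulr0.
have := H (w - z); rewrite subr0 subr_eq0 => /(_ wz nwz).
rewrite /GRing.scale /= mulr1 subrK => /ltW h.
have wz0 : w - z != 0 by rewrite subr_eq0.
rewrite -[f w - f z](divfK wz0) -mulrBl modulusM ler_wpM2r ?modulus_ge0 //.
by rewrite [X in X - d]mulrC.
Qed.

Lemma cder_is_derive f z d : cder f z d -> is_derive z 1 f d.
Proof.
move=> H; have hd : (fun h : C => h^-1 *: ((f \o shift z) (h *: 1) - f z)) @ 0^' --> d.
  apply/cvg_modulus => e e0.
  have [del d0 {}H] := H (e / 2) (divr_gt0 e0 (ltr0Sn _ 1)).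
  rewrite /dnbhs /within /=; apply/nbhs_modulus; exists del => // h.
  rewrite subr0 => hd h0; have := H (h + z); rewrite addrK => /(_ hd).
  rewrite /GRing.scale /= mulr1 => {}H.
  have -> : h^-1 * (f (h + z) - f z) - d = h^-1 * (f (h + z) - f z - d * h).
    by field.
  rewrite modulusM modulusV mulrC ltr_pdivrMr ?modulus_gt0 //.
  apply: le_lt_trans H _; rewrite ltr_pM2r ?modulus_gt0 // ltr_pdivrMr //; lra.
apply: DeriveDef; last by apply: cvg_lim => //; exact: hd.
by apply/cvg_ex; exists d; exact: hd.
Qed.

Lemma derivable_continuous f z : derivable f z 1 -> {for z, continuous f}.
Proof. by move=> /derivable1_diffP /differentiable_continuous. Qed.

Lemma derivable_compC f g z : derivable f z 1 -> derivable g (f z) 1 ->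
  derivable (fun w => g (f w)) z 1.
Proof.
move=> /derivable1_diffP df /derivable1_diffP dg; apply/derivable1_diffP.
have := @differentiable_comp C _ _ _ f g z df dg.
exact.
Qed.

Lemma derivable_MC f g z : derivable f z 1 -> derivable g z 1 ->
  derivable (fun w => f w * g w) z 1.
Proof. exact: derivableM. Qed.
Lemma derivable_DC f g z : derivable f z 1 -> derivable g z 1 ->
  derivable (fun w => f w + g w) z 1.
Proof. exact: derivableD. Qed.
Lemma derivable_BC f g z : derivable f z 1 -> derivable g z 1 ->
  derivable (fun w => f w - g w) z 1.
Proof. exact: derivableB. Qed.
Lemma derivable_VC f z : f z != 0 -> derivable f z 1 ->
  derivable (fun w => (f w)^-1) z 1.
Proof. exact: derivableV. Qed.
Lemma derivable_XC f n z : derivable f z 1 -> derivable (fun w => f w ^+ n) z 1.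
Proof.
move=> df; elim: n => [|n ih]; first by under eq_fun do rewrite expr0; exact: derivable_cst.
by under eq_fun do rewrite exprS; exact: derivable_MC.
Qed.
Lemma derivable_idC z : derivable (fun w : C => w) z 1.
Proof. exact: derivable_id. Qed.
Lemma derivable_cstC (a : C) z : derivable (fun w : C => a) z 1.
Proof. exact: derivable_cst. Qed.

Definition cexp z : C := ofR (expR (Re z)) * cis (Im z).

Lemma cexpD z w : cexp (z + w) = cexp z * cexp w.
Proof. by rewrite /cexp ReD ImD expRD ofRM cisD mulrACA. Qed.

Lemma cexp0 : cexp 0 = 1. Proof. by rewrite /cexp expR0 cis0 mulr1. Qed.
Lemma modulus_cexp z : modulus (cexp z) = expR (Re z).
Proof. by rewrite modulusM modulus_cis mulr1 modulus_ofR ger0_norm // expR_ge0. Qed.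
Lemma cexp_neq0 z : cexp z != 0.
Proof. by rewrite -modulus_eq0 modulus_cexp gt_eqF // expR_gt0. Qed.

Lemma is_derive_linear (g : R -> R) (x d : R) : is_derive x 1 g d ->
  forall e : R, 0 < e -> exists2 del : R, 0 < del &
  forall y, `|y - x| < del -> `|g y - g x - d * (y - x)| <= e * `|y - x|.
Proof.
case=> /cvg_ex[d' hd] dd; have {dd}-> : d = d'.
  by rewrite -dd; apply: cvg_lim => //; exact: hd.
move=> e e0.
have : nbhs d' (ball d' e) by exact: nbhsx_ballx.
move=> /hd; rewrite /nbhs /= /dnbhs /within /= => /nbhs_ballP[del d0 H].
exists del => // y wz; have [->|nwz] := eqVneq y x.
  by rewrite !subrr mulr0 subrr normr0 mulr0.
have := H (y - x); rewrite /ball /= sub0r normrN subr_eq0 => /(_ wz nwz).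
rewrite /GRing.scale /= mulr1 subrK distrC => /ltW h.
have wz0 : y - x != 0 by rewrite subr_eq0.
rewrite -[g y - g x](divfK wz0) -mulrBl normrM ler_wpM2r //.
by rewrite [X in X - d']mulrC.
Qed.

Lemma cder_cexp0 : cder cexp 0 1.
Proof.
move=> e e0; have e4 : 0 < e / 4 by rewrite divr_gt0.
have [d1 d10 h1] := is_derive_linear (is_derive_expR 0) e4.
have [d2 d20 h2] := is_derive_linear (is_derive_cos 0) e4.
have [d3 d30 h3] := is_derive_linear (is_derive_sin 0) e4.
(* The bounds [1 / 4] and [e / 16] on [|w|] serve the product [Re w (cis (Im w) - 1)]: its second
   factor is at most [2 |w| + e / 2 |w|], hence at most [e / 4]. *)
exists (Num.min (Num.min d1 (1/4)) (Num.min (Num.min d2 d3) (e / 16))).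
  by rewrite !lt_min d10 d20 d30 !divr_gt0.
move=> w; rewrite subr0 !lt_min => /andP[/andP[w1 w1'] /andP[/andP[w2 w3] we]].
have := h1 (Re w); have := h2 (Im w); have := h3 (Im w).
rewrite expR0 cos0 sin0 !subr0 oppr0 mul0r subr0 !mul1r.
have rw := normRe_le w; have iw := normIm_le w.
move=> /(_ (le_lt_trans iw w3)) H3 /(_ (le_lt_trans iw w2)) H2 /(_ (le_lt_trans rw w1)) H1.
have E : cexp w - cexp 0 - w = ofR (expR (Re w) - 1 - Re w) * cis (Im w) +
   (cis (Im w) - 1 - Complex 0 (Im w)) + ofR (Re w) * (cis (Im w) - 1).
  rewrite cexp0; apply: Cext; rewrite /cexp; do ?rewrite ?ReD ?ImD ?ReN ?ImN ?ReM ?ImM /=; ring.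
have H4 : modulus (cis (Im w) - 1 - Complex 0 (Im w) : C) <= e / 2 * modulus w.
  apply: le_trans (modulus_leD _) _; do ?rewrite ?ReD ?ImD ?ReN ?ImN /=.
  rewrite !subr0.
  have : e / 4 * `|Im w| <= e / 4 * modulus w by rewrite ler_pM2l.
  by lra.
have H5 : modulus (cis (Im w) - 1 : C) <= 2 * modulus w + e / 2 * modulus w.
  have -> : cis (Im w) - 1 = cis (Im w) - 1 - Complex 0 (Im w) + Complex 0 (Im w) :> C by rewrite subrK.
  apply: le_trans (modulusD _ _) _; rewrite addrC lerD //.
  apply: le_trans (modulus_leD _) _; rewrite /= normr0 add0r.
  by have := modulus_ge0 w; lra.
rewrite E.
apply: le_trans (modulusD _ _) _.
have := modulusD (ofR (expR (Re w) - 1 - Re w) * cis (Im w)) (cis (Im w) - 1 - Complex 0 (Im w)).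
rewrite !modulusM modulus_cis mulr1 !modulus_ofR.
have H6 : `|Re w| * modulus (cis (Im w) - 1 : C) <= modulus w * (e / 4).
  apply: ler_pM; rewrite ?modulus_ge0 //; apply: (le_trans H5).
  have : e / 2 * modulus w <= e / 2 * (1 / 4).
    by rewrite ler_pM2l ?divr_gt0 // ltW.
  by lra.
have : e / 4 * `|Re w| <= e / 4 * modulus w by rewrite ler_pM2l.
lra.
Qed.

Lemma cder_cexp z : cder cexp z (cexp z).
Proof.
move=> e e0; have ez0 : 0 < expR (Re z) by exact: expR_gt0.
have [del d0 H] := cder_cexp0 (divr_gt0 e0 ez0).
exists del => // w wz; have := H (w - z); rewrite subr0 => /(_ wz).
rewrite cexp0 mul1r => {}H.
have -> : cexp w - cexp z - cexp z * (w - z) = cexp z * (cexp (w - z) - 1 - (w - z)).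
  by have := cexpD (w - z) z; rewrite subrK => ->; ring.
rewrite modulusM modulus_cexp; apply: le_trans (ler_wpM2l (ltW ez0) H) _.
by rewrite mulrA mulrCA divff ?gt_eqF // mulr1.
Qed.

Lemma derivable_cexp z : derivable cexp z 1.
Proof. by have [] := cder_is_derive (cder_cexp z). Qed.

End ComplexDerivative.

(** * Circle means and Cauchy's formula *)

Section Means.
Variable R : realType.
Local Notation C := (Cplx R).
Local Notation Re := (@complex.Re R).
Local Notation Im := (@complex.Im R).
Implicit Types (g h : R -> R) (F G : R -> C) (f : C -> C) (r : R).

Definition mean g : R := (2 * pi)^-1 * rint g 0 (2 * pi).
Definition cmean F : C := Complex (mean (fun t => Re (F t))) (mean (fun t => Im (F t))).
Definition pt r (t : R) : C := ofR r * cis t.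

Lemma twopi_gt0 : 0 < 2 * pi :> R. Proof. by rewrite mulr_gt0 // pi_gt0. Qed.
Lemma twopi_ge0 : 0 <= 2 * pi :> R. Proof. exact: ltW twopi_gt0. Qed.

Lemma continuous_cont_on g a b : continuous g -> cont_on g a b.
Proof. by move=> cg x _; exact: cg. Qed.
Local Hint Resolve continuous_cont_on : core.

Lemma eq_mean g h : g =1 h -> mean g = mean h.
Proof. by move=> gh; congr (_ * _); apply: eq_rint => x _. Qed.
Lemma meanD g h : continuous g -> continuous h ->
  mean (fun t => g t + h t) = mean g + mean h.
Proof. by move=> cg ch; rewrite /mean rintD ?mulrDr; auto. Qed.
Lemma meanB g h : continuous g -> continuous h ->
  mean (fun t => g t - h t) = mean g - mean h.
Proof. by move=> cg ch; rewrite /mean rintB ?mulrBr; auto. Qed.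
Lemma meanZ g k : continuous g -> mean (fun t => k * g t) = k * mean g.
Proof. by move=> cg; rewrite /mean rintZ; [rewrite mulrCA|exact: continuous_cont_on]. Qed.
Lemma mean_cst k : mean (fun=> k) = k.
Proof.
rewrite /mean rint_cst ?twopi_ge0 // subr0 mulrC mulfK //.
by rewrite gt_eqF // twopi_gt0.
Qed.
Lemma le_mean g h : continuous g -> continuous h -> (forall t, g t <= h t) ->
  mean g <= mean h.
Proof.
move=> cg ch gh; rewrite ler_wpM2l ?invr_ge0 ?twopi_ge0 //.
by apply: le_rint => [x _|x _|x _]; [exact: cg|exact: ch|exact: gh].
Qed.
Lemma mean_ge0 g : continuous g -> (forall t, 0 <= g t) -> 0 <= mean g.
Proof.
by move=> cg gh; rewrite -(mean_cst 0); apply: le_mean => // t; exact: cst_continuous.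
Qed.
Lemma mean_le_cst g k : continuous g -> (forall t, g t <= k) -> mean g <= k.
Proof.
by move=> cg gh; rewrite -(mean_cst k); apply: le_mean => // t; exact: cst_continuous.
Qed.

Lemma contRe F : continuous F -> continuous (fun t => Re (F t)).
Proof. by move=> cF t; apply: (@continuous_comp _ _ _ F); [exact: cF|exact: continuous_Re]. Qed.
Lemma contIm F : continuous F -> continuous (fun t => Im (F t)).
Proof. by move=> cF t; apply: (@continuous_comp _ _ _ F); [exact: cF|exact: continuous_Im]. Qed.
Lemma contmod F : continuous F -> continuous (fun t => modulus (F t)).
Proof. by move=> cF t; apply: (@continuous_comp _ _ _ F); [exact: cF|exact: continuous_modulus]. Qed.
Lemma contD F G : continuous F -> continuous G -> continuous (fun t => F t + G t).
Proof. by move=> cF cG t; apply: cvgD; [exact: cF|exact: cG]. Qed.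
Lemma contB F G : continuous F -> continuous G -> continuous (fun t => F t - G t).
Proof. by move=> cF cG t; apply: cvgB; [exact: cF|exact: cG]. Qed.
Lemma contM F G : continuous F -> continuous G -> continuous (fun t => F t * G t).
Proof. by move=> cF cG t; apply: cvgM; [exact: cF|exact: cG]. Qed.
Lemma contcst (c : C) : continuous (fun _ : R => c).
Proof. by move=> t; exact: cst_continuous. Qed.
Lemma contZ (c : C) F : continuous F -> continuous (fun t => c * F t).
Proof. by move=> cF t; apply: cvgM; [exact: cvg_cst|exact: cF]. Qed.
Lemma contDr g h : continuous g -> continuous h -> continuous (fun t => g t + h t).
Proof. by move=> cF cG t; apply: cvgD; [exact: cF|exact: cG]. Qed.
Lemma contBr g h : continuous g -> continuous h -> continuous (fun t => g t - h t).
Proof. by move=> cF cG t; apply: cvgB; [exact: cF|exact: cG]. Qed.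
Lemma contMr g h : continuous g -> continuous h -> continuous (fun t => g t * h t).
Proof. by move=> cF cG t; apply: cvgM; [exact: cF|exact: cG]. Qed.
Lemma contcstr (c : R) : continuous (fun _ : R => c).
Proof. by move=> t; exact: cst_continuous. Qed.

Lemma eq_cmean F G : F =1 G -> cmean F = cmean G.
Proof. by move=> FG; apply: Cext; apply: eq_mean => t /=; rewrite FG. Qed.
Lemma cmeanD F G : continuous F -> continuous G ->
  cmean (fun t => F t + G t) = cmean F + cmean G.
Proof.
move=> cF cG; apply: Cext; rewrite ?ReD ?ImD /=.
  by rewrite -meanD; [apply: eq_mean => t; rewrite ReD|exact: contRe|exact: contRe].
by rewrite -meanD; [apply: eq_mean => t; rewrite ImD|exact: contIm|exact: contIm].
Qed.
Lemma cmeanZ F c : continuous F -> cmean (fun t => c * F t) = c * cmean F.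
Proof.
move=> cF; apply: Cext; rewrite ?ReM ?ImM /=.
  rewrite -!meanZ -?meanB; try (by [exact: contRe|exact: contIm]).
  - by apply: eq_mean => t; rewrite ReM.
  - by apply: contMr; [exact: contcstr|exact: contRe].
  - by apply: contMr; [exact: contcstr|exact: contIm].
rewrite -!meanZ -?meanD; try (by [exact: contRe|exact: contIm]).
- by apply: eq_mean => t; rewrite ImM.
- by apply: contMr; [exact: contcstr|exact: contIm].
- by apply: contMr; [exact: contcstr|exact: contRe].
Qed.
Lemma cmeanB F G : continuous F -> continuous G ->
  cmean (fun t => F t - G t) = cmean F - cmean G.
Proof.
move=> cF cG; have cm : continuous (fun t => (-1) * G t) by exact: contZ.
rewrite -[- cmean G]mulN1r -cmeanZ // -cmeanD //.
by apply: eq_cmean => t; rewrite mulN1r.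
Qed.
Lemma cmean_cst c : cmean (fun=> c) = c.
Proof. by case: c => a b; rewrite /cmean /= !mean_cst. Qed.

Lemma Re_cmean_le F : continuous F -> Re (cmean F) <= mean (fun t => modulus (F t)).
Proof.
move=> cF; apply: le_mean; [exact: contRe|exact: contmod|].
by move=> t; exact: Re_le.
Qed.

(** A unimodular constant [c] rotates the mean onto the positive real axis, where [Re_cmean_le]
    applies. *)
Lemma modulus_cmean_le F : continuous F ->
  modulus (cmean F) <= mean (fun t => modulus (F t)).
Proof.
move=> cF; have [->|m0] := eqVneq (cmean F) 0.
  by rewrite modulus0 mean_ge0 //; [exact: contmod|move=> t; exact: modulus_ge0].
set m := cmean F; pose c := ofR (modulus m) / m.
have mm : modulus m != 0 by rewrite modulus_eq0.
have c1 : modulus c = 1.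
  by rewrite modulusM modulusV modulus_ofR ger0_norm ?modulus_ge0 // divff.
have -> : modulus m = Re (cmean (fun t => c * F t)).
  by rewrite cmeanZ // /c divfK.
apply: le_trans (Re_cmean_le _) _; first exact: contZ.
by under eq_mean do rewrite modulusM c1 mul1r.
Qed.

Lemma modulus_cmean_le_cst F k : continuous F -> (forall t, modulus (F t) <= k) ->
  modulus (cmean F) <= k.
Proof.
by move=> cF hF; apply: le_trans (modulus_cmean_le cF) _; apply: mean_le_cst => //; exact: contmod.
Qed.

Lemma modulus_pt r t : 0 <= r -> modulus (pt r t) = r.
Proof. by move=> r0; rewrite modulusM modulus_cis mulr1 modulus_ofR ger0_norm. Qed.

Lemma continuous_pt r : continuous (pt r).
Proof. by apply: contM; [exact: contcst|exact: continuous_cis]. Qed.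

Lemma continuous_circle f r : 0 <= r ->
  (forall z, modulus z = r -> {for z, continuous f}) ->
  continuous (fun t => f (pt r t)).
Proof.
move=> r0 cf t; apply: (@continuous_comp _ _ _ (pt r)); first exact: continuous_pt.
by apply: cf; rewrite modulus_pt.
Qed.

Lemma derivable_crdiff f z : derivable f z 1 ->
  crdiff (fun x y => Re (f (Complex x y))) (fun x y => Im (f (Complex x y))) (Re z) (Im z).
Proof.
move=> /derivable_cder; set d := derive1 f z => H; exists (Re d), (Im d) => e e0.
have [del d0 {}H] := H e e0; exists (del / 2); first by rewrite divr_gt0.
move=> x y hx hy; have zE : Complex (Re z) (Im z) = z :> C by case: (z).
rewrite zE; set w : C := Complex x y.
have hm : modulus (w - z) <= `|x - Re z| + `|y - Im z|.
  by apply: le_trans (modulus_leD _) _; rewrite ReD ReN ImD ImN.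
have wd : modulus (w - z) < del by lra.
have h1 : modulus (f w - f z - d * (w - z)) <= e * (`|x - Re z| + `|y - Im z|).
  by apply: le_trans (H _ wd) _; rewrite ler_pM2l.
split; apply: le_trans h1.
  by apply: le_trans (normRe_le _); rewrite !(ReD, ReN, ImD, ImN, ReM).
apply: le_trans (normIm_le _); rewrite !(ReD, ReN, ImD, ImN, ImM) /=.
by rewrite [Im d * _ + _]addrC.
Qed.

Lemma cexp_ln r t : 0 < r -> cexp (Complex (ln r) t) = pt r t.
Proof. by move=> r0; rewrite /cexp /= lnK. Qed.

(* Goursat for [f (exp w)] on [ln r1, ln r2] x [0, 2 pi]: the horizontal sides
   cancel by periodicity. *)
Let mean_Im_const f r1 r2 : 0 < r1 -> r1 <= r2 ->
  (forall z, r1 <= modulus z <= r2 -> derivable f z 1) ->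
  mean (fun t => Im (f (pt r1 t))) = mean (fun t => Im (f (pt r2 t))).
Proof.
move=> r10 r12 df; have r20 : 0 < r2 by exact: lt_le_trans r12.
pose F z := f (cexp z).
pose u x y := Re (F (Complex x y)); pose v x y := Im (F (Complex x y)).
have dF x y : ln r1 <= x <= ln r2 -> crdiff u v x y.
  move=> /andP[h1 h2]; apply: (@derivable_crdiff F (Complex x y)).
  apply: derivable_compC; first exact: derivable_cexp.
  apply: df; rewrite modulus_cexp /=.
  by move: h1 h2; rewrite -(ler_expR _ x) -(ler_expR x) !lnK // => -> ->.
have l12 : ln r1 <= ln r2 by rewrite ler_ln.
have := @goursat_rectangle _ u v (ln r1) (ln r2) 0 (2 * pi) l12 twopi_ge0
  (fun x y hx _ => dF x y hx).
rewrite (@eq_rint _ _ (fun=> 0)); last first.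
  move=> x _; rewrite /u /F; have -> : cexp (Complex x (2 * pi)) = cexp (Complex x 0).
    by rewrite /cexp /= cis2pi cis0.
  by rewrite subrr.
have cf r : r1 <= r <= r2 -> continuous (fun t => f (pt r t)).
  move=> /andP[h1 h2]; apply: continuous_circle; first lra.
  move=> z hz; apply: derivable_continuous; apply: df; rewrite hz; exact/andP.
rewrite rint_cst // mul0r => /esym; rewrite rintB; last 2 first.
- move=> y _; rewrite (_ : v _ = fun t => Im (f (pt r2 t))).
    by apply: contIm; apply: cf; rewrite r12 lexx.
  by apply/funext => t; rewrite /v /F cexp_ln.
- move=> y _; rewrite (_ : v _ = fun t => Im (f (pt r1 t))).
    by apply: contIm; apply: cf; rewrite r12 lexx.
  by apply/funext => t; rewrite /v /F cexp_ln.
move=> /subr0_eq h; rewrite /mean; congr (_ * _).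
rewrite (@eq_rint _ _ (v (ln r1))); last by move=> t _; rewrite /v /F cexp_ln.
by rewrite -h; apply: eq_rint => t _; rewrite /v /F cexp_ln.
Qed.

(** [mean_Im_const] settles the imaginary part; applied to [i f] it settles the real part. *)
Lemma cmean_circle_const f r1 r2 : 0 < r1 -> r1 <= r2 ->
  (forall z, r1 <= modulus z <= r2 -> derivable f z 1) ->
  cmean (fun t => f (pt r1 t)) = cmean (fun t => f (pt r2 t)).
Proof.
move=> r10 r12 df; apply: Cext => /=; last exact: mean_Im_const.
have := @mean_Im_const (fun z => Complex 0 1 * f z) r1 r2 r10 r12.
have E r : mean (fun t => Im (Complex 0 1 * f (pt r t))) = mean (fun t => Re (f (pt r t))).
  by apply: eq_mean => t; rewrite ImM /= mul0r add0r mul1r.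
rewrite !E; apply => z hz; apply: derivable_MC; [exact: derivable_cstC|exact: df].
Qed.
End Means.

(** * Passage to the limit in circle means *)

Section Limits.
Variable R : realType.
Local Notation C := (Cplx R).
Local Notation Re := (@complex.Re R).
Local Notation Im := (@complex.Im R).

Lemma le_mean_on (g h : R -> R) : continuous g -> continuous h ->
  (forall t, 0 <= t <= 2 * pi -> g t <= h t) -> mean g <= mean h.
Proof.
move=> cg ch gh; rewrite ler_wpM2l // ?invr_ge0 ?twopi_ge0 //; apply: le_rint => //;
  exact: continuous_cont_on.
Qed.

(** Closeness is assumed only locally around each [t]; compactness of [[0, 2 pi]] makes it
    uniform. *)
Lemma mean_cvg (S : Type) (F : set_system S) {FF : Filter F} (g : S -> R -> R) (g0 : R -> R) :
  (\forall s \near F, continuous (g s)) -> continuous g0 ->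
  (forall t, 0 <= t <= 2 * pi -> forall e : R, 0 < e ->
    \forall t' \near t & s \near F, `|g s t' - g0 t'| < e) ->
  mean (g s) @[s --> F] --> mean g0.
Proof.
move=> cg cg0 H; apply/cvg_realE => e e0; have e2 : 0 < e / 2 by rewrite divr_gt0.
have /compact_near_coveringP K := @segment_compact _ (0 : R) (2 * pi).
have := K S F (fun s t => `|g s t - g0 t| < e / 2) FF.
move=> /(_ _)/wrap [t|]; first by rewrite /= in_itv /= => ht; exact: H.
move=> {}K; near=> s.
have cs : continuous (g s) by near: s.
have hs : forall t, 0 <= t <= 2 * pi -> `|g s t - g0 t| < e / 2.
  move=> t ht; have : `[0, 2 * pi]%classic t by rewrite /= in_itv.
  by move: t {ht}; near: s.
have h1 : mean (g s) <= mean (fun t => g0 t + e / 2).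
  apply: le_mean_on => //; first by apply: contDr => //; exact: contcstr.
  by move=> t /hs; rewrite ltr_norml => /andP[]; lra.
have h2 : mean (fun t => g0 t - e / 2) <= mean (g s).
  apply: le_mean_on => //; first by apply: contBr => //; exact: contcstr.
  by move=> t /hs; rewrite ltr_norml => /andP[]; lra.
rewrite meanD ?mean_cst // in h1; last exact: contcstr.
rewrite meanB ?mean_cst // in h2; last exact: contcstr.
by rewrite ltr_norml; apply/andP; split; lra.
Unshelve. all: by end_near. Qed.

Lemma cmean_cvg (S : Type) (F : set_system S) {FF : Filter F} (g : S -> R -> C) (g0 : R -> C) :
  (\forall s \near F, continuous (g s)) -> continuous g0 ->
  (forall t, 0 <= t <= 2 * pi -> forall e : R, 0 < e ->
    \forall t' \near t & s \near F, modulus (g s t' - g0 t') < e) ->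
  cmean (g s) @[s --> F] --> cmean g0.
Proof.
move=> cg cg0 H; apply: cvg_pair; apply: mean_cvg.
- by apply: filterS cg => s cs; exact: contRe.
- exact: contRe.
- move=> t ht e e0; apply: filterS (H t ht e e0) => -[t' s] /=.
  by apply: le_lt_trans; rewrite -ReN -ReD normRe_le.
- by apply: filterS cg => s cs; exact: contIm.
- exact: contIm.
- move=> t ht e e0; apply: filterS (H t ht e e0) => -[t' s] /=.
  by apply: le_lt_trans; rewrite -ImN -ImD normIm_le.
Qed.

Lemma pt_joint_cvg (s0 t0 : R) : pt p.2 p.1 @[p --> (t0, s0)] --> pt s0 t0.
Proof.
apply: cvgM.
  by apply: (cvg_comp _ _ cvg_snd); exact: continuous_ofR.
by apply: (cvg_comp _ _ cvg_fst); exact: continuous_cis.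
Qed.

Lemma pt_close (f : C -> C) (s0 t0 e : R) : 0 < e -> {for pt s0 t0, continuous f} ->
  \forall t \near t0 & s \near s0, modulus (f (pt s t) - f (pt s0 t)) < e.
Proof.
move=> e0 cf; have e2 : 0 < e / 2 by rewrite divr_gt0.
have h1 : f (pt p.2 p.1) @[p --> (t0, s0)] --> f (pt s0 t0).
  apply: (cvg_comp (fun p : R * R => pt p.2 p.1) f); [exact: pt_joint_cvg|exact: cf].
have h2 : f (pt s0 t) @[t --> t0] --> f (pt s0 t0).
  apply: (cvg_comp (pt s0) f); [exact: continuous_pt|exact: cf].
move/cvg_modulus : h1 => /(_ _ e2) h1; move/cvg_modulus : h2 => /(_ _ e2) h2.
have h3 : \forall t \near t0 & s \near s0, modulus (f (pt s0 t) - f (pt s0 t0)) < e / 2.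
  exact: (cvg_fst h2).
near=> p => /=.
rewrite [e]splitr -(subrKA (f (pt s0 t0))).
apply: le_lt_trans (modulusD _ _) _; rewrite ltrD //.
  by near: p; exact: h1.
by rewrite modulusBC; near: p; exact: h3.
Unshelve. all: by end_near. Qed.

Lemma cmean_radius_cvg (f : C -> C) (s0 : R) :
  (\forall s \near s0, forall t, {for pt s t, continuous f}) ->
  cmean (fun t => f (pt s t)) @[s --> s0] --> cmean (fun t => f (pt s0 t)).
Proof.
have cc s : (forall t, {for pt s t, continuous f}) -> continuous (fun t => f (pt s t)).
  by move=> h t; apply: (@continuous_comp _ _ _ (pt s)); [exact: continuous_pt|exact: h].
move=> cf; have cf0 := nbhs_singleton cf.
apply: cmean_cvg.
- by apply: filterS cf => s; exact: cc.
- exact: cc.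
- by move=> t _ e e0; exact: pt_close.
Qed.

Lemma mean_radius_cvg (f : C -> R) (s0 : R) :
  (\forall s \near s0, forall t, {for pt s t, continuous f}) ->
  mean (fun t => f (pt s t)) @[s --> s0] --> mean (fun t => f (pt s0 t)).
Proof.
move=> cf.
have := @cmean_radius_cvg (fun z => ofR (f z)) s0 => /(_ _)/wrap[|h].
  apply: filterS cf => s cs t; apply: (@continuous_comp _ _ _ f); first exact: cs.
  exact: continuous_ofR.
have := cvg_comp _ _ h (@continuous_Re R _); exact.
Qed.
End Limits.

Section Cauchy.
Variable R : realType.
Local Notation C := (Cplx R).
Local Notation Re := (@complex.Re R).
Local Notation Im := (@complex.Im R).
Implicit Types (f : C -> C) (z w : C) (r : R).

Lemma near_neq (w z : C) : w != z -> \forall x \near w, x != z.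
Proof.
move=> wz; apply/nbhs_modulus; exists (modulus (w - z)).
  by rewrite modulus_gt0 subr_eq0.
by move=> x; apply: contraTneq => ->; rewrite modulusBC ltxx.
Qed.

(** Used with its mirror image to carry a constant circle mean across the radius [modulus z0], where
    differentiability is not known, and down to radius 0. *)
Lemma cvg_right_const (J : R -> C) (a b : R) (c : C) : a < b -> J s @[s --> a] --> J a ->
  (forall s, a < s < b -> J s = c) -> J a = c.
Proof.
move=> ab hJ hc; apply/eqP; rewrite -subr_eq0 -modulus_eq0 -normr_le0.
apply/ler_addgt0Pr => e e0; rewrite add0r ger0_norm ?modulus_ge0 //.
move/cvg_modulus : hJ => /(_ _ e0) /nbhs_ballP [d /= d0 h].
pose s := a + Num.min (d / 2) ((b - a) / 2).
have sm : 0 < Num.min (d / 2) ((b - a) / 2).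
  by rewrite lt_min !divr_gt0 // subr_gt0.
have sd : Num.min (d / 2) ((b - a) / 2) <= d / 2 by rewrite ge_min lexx.
have sb : Num.min (d / 2) ((b - a) / 2) <= (b - a) / 2 by rewrite ge_min lexx orbT.
have hs : a < s < b by rewrite /s; apply/andP; split; lra.
have := h s; rewrite /ball /= => /(_ _)/wrap[|].
  by rewrite /s opprD addNKr normrN gtr0_norm //; lra.
by rewrite hc // modulusBC => /ltW.
Qed.

Lemma cvg_left_const (J : R -> C) (a b : R) (c : C) : b < a -> J s @[s --> a] --> J a ->
  (forall s, b < s < a -> J s = c) -> J a = c.
Proof.
move=> ab hJ hc.
have := @cvg_right_const (fun s => J (- s)) (- a) (- b) c; rewrite opprK; apply.
- by rewrite ltrN2.
- have h : - s @[s --> - a] --> a.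
    by have := @cvgN _ _ _ _ _ (fun s : R => s) (- a) cvg_id; rewrite opprK => hh; exact: hh.
  exact: (cvg_comp _ J h hJ).
- by move=> s /andP[h1 h2]; apply: hc; apply/andP; split; lra.
Qed.

Lemma disc_near z : disc z -> \forall w \near z, disc w.
Proof.
move/disc_modulus => hz; apply/nbhs_modulus; exists (1 - modulus z); first by rewrite subr_gt0.
move=> w hw; apply/disc_modulus; have := modulusD (w - z) z; rewrite subrK; lra.
Qed.

Lemma disc_pt r t : -1 < r < 1 -> disc (pt r t : C).
Proof.
move=> /andP[h1 h2]; apply/disc_modulus.
by rewrite modulusM modulus_cis mulr1 modulus_ofR ltr_norml h1.
Qed.

(** The kernel is [1 + z0 / (pt r t - z0)]. The mean of [(pt s t - z0)^-1] is the same for all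
    [s >= r] and at most [1 / (s - modulus z0)], so it vanishes. *)
Lemma cauchy_kernel_mean z0 r : modulus z0 < r ->
  cmean (fun t => pt r t / (pt r t - z0)) = 1.
Proof.
move=> hr; have r0 : 0 < r by apply: le_lt_trans hr; exact: modulus_ge0.
have nz s t : r <= s -> pt s t - z0 != 0.
  move=> rs; rewrite subr_eq0; apply: contraTneq hr => <-.
  by rewrite modulus_pt -?leNgt // (le_trans (ltW r0)).
have cpart s : r <= s -> continuous (fun t => (pt s t - z0)^-1).
  move=> rs t; apply: cvgV; first exact: nz.
  by apply: contB; [exact: continuous_pt|exact: contcst].
have E t : pt r t / (pt r t - z0) = 1 + z0 * (pt r t - z0)^-1.
  by rewrite -[X in X / _](subrK z0) mulrDl divff ?nz.
rewrite (eq_cmean E) cmeanD; last 2 first.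
- exact: contcst.
- by apply: contZ; exact: cpart.
rewrite cmean_cst -[RHS]addr0; congr (_ + _).
rewrite cmeanZ; last exact: cpart.
apply/eqP; rewrite mulf_eq0; apply/orP; right.
rewrite -modulus_eq0 -normr_le0; apply/ler_addgt0Pr => e e0; rewrite add0r.
rewrite ger0_norm ?modulus_ge0 //.
pose s := r + modulus z0 + e^-1.
have ei : 0 < e^-1 by rewrite invr_gt0.
have m0 := modulus_ge0 z0.
have rs : r <= s by rewrite /s; lra.
rewrite (@cmean_circle_const _ (fun z => (z - z0)^-1) r s) //; last first.
  move=> z /andP[hz _]; apply: derivable_VC.
    by rewrite subr_eq0; apply: contraTneq hr => <-; rewrite -leNgt.
  by apply: derivable_BC; [exact: derivable_idC|exact: derivable_cstC].
apply: modulus_cmean_le_cst; first exact: cpart.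
move=> t; rewrite modulusV -[e]invrK lef_pV2 ?posrE //; last first.
  by rewrite modulus_gt0 nz.
have := modulusD (pt s t - z0) z0; rewrite subrK modulus_pt /s; lra.
Qed.

(** The difference quotient of [f] at [z0], times [z], is known to be differentiable off [z0] and
    continuous at [z0]. So its circle means are constant on radii away from [modulus z0] and
    continuous in the radius; all equal the value 0 at radius 0. *)
Lemma cauchy_formula f z0 r : analytic_in_disc f -> modulus z0 < r -> r < 1 ->
  cmean (fun t => f (pt r t) * (pt r t / (pt r t - z0))) = f z0.
Proof.
move=> af z0r r1; have m0 := modulus_ge0 z0.
have r0 : 0 < r by lra.
have dz0 : disc z0 by apply/disc_modulus; lra.
pose raw z := (f z - f z0) / (z - z0).
pose q (z : C) : C := if z == z0 then derive1 f z0 else raw z.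
pose G (z : C) : C := q z * z.
have draw z : disc z -> z != z0 -> derivable raw z 1.
  move=> dz nz; apply: derivable_MC.
    by apply: derivable_BC; [exact: af|exact: derivable_cstC].
  apply: derivable_VC; first by rewrite subr_eq0.
  by apply: derivable_BC; [exact: derivable_idC|exact: derivable_cstC].
have dG z : disc z -> z != z0 -> derivable G z 1.
  move=> dz nz; apply: derivable_MC; last exact: derivable_idC.
  apply: (@near_eq_derivable _ _ _ raw); last exact: draw.
  by apply: filterS (near_neq nz) => x /negPf xz; rewrite /q xz.
have cq0 : {for z0, continuous q}.
  apply: (proj2 (@cvg_modulus _ _ (nbhs z0) _ q (q z0))) => e e0.
  have e2 : 0 < e / 2 by rewrite divr_gt0.
  have [d d0 h] := derivable_cder (af _ dz0) e2.
  apply/nbhs_modulus; exists d => // w wd; rewrite /q eqxx.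
  case: eqVneq => [_|nw]; first by rewrite subrr modulus0.
  have w0 : w - z0 != 0 by rewrite subr_eq0.
  have -> : raw w - f^`()%classic z0 =
    (f w - f z0 - f^`()%classic z0 * (w - z0)) / (w - z0) by rewrite /raw; field.
  rewrite modulusM modulusV ltr_pdivrMr ?modulus_gt0 //.
  apply: le_lt_trans (h w wd) _; rewrite ltr_pM2r ?modulus_gt0 //; lra.
have cG z : disc z -> {for z, continuous G}.
  move=> dz; have [->|nz] := eqVneq z z0; last exact: derivable_continuous (dG z dz nz).
  apply: (@continuousM _ _ q (fun z => z)); [exact: cq0|exact: cvg_id].
pose J s := cmean (fun t => G (pt s t)).
have cJ (s : R) : -1 < s < 1 -> J x @[x --> s] --> J s.
  move=> /andP[s1 s2]; apply: cmean_radius_cvg.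
  near=> x => t; apply: cG; apply: disc_pt; apply/andP; split; near: x.
    exact: lt_nbhsr.
  exact: lt_nbhsl.
have Jc s s' : 0 < s -> s <= s' -> s' < 1 -> ~~ (s <= modulus z0 <= s') -> J s = J s'.
  move=> s0 ss s1 hs; apply: (@cmean_circle_const _ G s s' s0 ss) => z hz; apply: dG.
    by apply/disc_modulus; case/andP: hz; lra.
  by apply: contraNneq hs => <-.
have J0 : J 0 = 0.
  rewrite /J (@eq_cmean _ _ (fun=> 0)) ?cmean_cst // => t.
  by rewrite /pt ofR0 mul0r /G mulr0.
have Jr : J r = 0.
  have Jm : J (modulus z0) = J r.
    apply: (@cvg_right_const J _ r _ z0r); first by apply: cJ; apply/andP; split; lra.
    move=> s /andP[s1 s2]; by apply: Jc; lra.
  rewrite -Jm; have [->//|mz] := eqVneq (modulus z0) 0.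
  have mz0 : 0 < modulus z0 by rewrite lt_def mz.
  have Jh s : 0 < s < modulus z0 -> J s = J (modulus z0 / 2).
    move=> /andP[s1 s2]; have [h|h] := leP s (modulus z0 / 2).
      by apply: Jc; lra.
    by apply/esym; apply: Jc; lra.
  rewrite (@cvg_left_const J (modulus z0) 0 _ mz0 _ Jh); last first.
    by apply: cJ; apply/andP; split; lra.
  rewrite -J0; apply/esym; apply: (@cvg_right_const J 0 (modulus z0) _ mz0 _ Jh).
  by apply: cJ; rewrite ltr01 ltrN10.
have nz t : pt r t - z0 != 0.
  rewrite subr_eq0; apply: contraTneq z0r => <-.
  by rewrite modulus_pt ?ltxx // ltW.
have ck : continuous (fun t => pt r t / (pt r t - z0)).
  apply: contM; first exact: continuous_pt.
  move=> t; apply: cvgV; first exact: nz.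
  by apply: contB; [exact: continuous_pt|exact: contcst].
have cf : continuous (fun t => f (pt r t)).
  apply: continuous_circle; first exact: ltW.
  by move=> z hz; apply: derivable_continuous; apply: af; apply/disc_modulus; rewrite hz.
have E : f z0 = cmean (fun t => f z0 * (pt r t / (pt r t - z0))).
  by rewrite (cmeanZ _ ck) (cauchy_kernel_mean z0r) mulr1.
apply/subr0_eq; rewrite [X in _ - X]E -cmeanB; last 2 first.
- exact: contM cf ck.
- exact: contZ.
rewrite -Jr; apply: eq_cmean => t; rewrite /G /q -subr_eq0 (negPf (nz t)) /raw.
by ring.
Unshelve. all: by end_near. Qed.
End Cauchy.

(** * Taylor coefficients *)

Section Coefficients.
Variable R : realType.
Local Notation C := (Cplx R).
Local Notation Re := (@complex.Re R).
Local Notation Im := (@complex.Im R).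
Implicit Types (f g : C -> C) (z w : C) (r : R) (n : int).

(** Meant for [x = (u - w)^-1], [y = (u - z)^-1] and [h = w - z], which satisfy [x - y = h x y]. The
    remainder is quadratic in [h] uniformly in [u], so powers of Cauchy's kernel can be
    differentiated under the mean. *)
Lemma kernel_estimate (B : R) (m : nat) : 0 <= B -> exists c : R, 0 <= c /\ forall x y h : C,
  modulus x <= B -> modulus y <= B -> x - y = h * x * y ->
  modulus (x ^+ m - y ^+ m - m%:R * h * y ^+ m.+1) <= c * modulus h ^+ 2.
Proof.
move=> B0; elim: m => [|m [c [c0 ih]]].
  exists 0; split=> // x y h _ _ _.
  by rewrite !expr0 subrr !mul0r subr0 modulus0.
exists (B * c + B ^+ m.+3 + m%:R * B ^+ m.+3); split.
  apply: addr_ge0; [apply: addr_ge0; [exact: mulr_ge0|exact: exprn_ge0]|].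
  by apply: mulr_ge0; [exact: ler0n|exact: exprn_ge0].
move=> x y h hx hy xy.
have -> : x ^+ m.+1 - y ^+ m.+1 - m.+1%:R * h * y ^+ m.+2 =
   x * (x ^+ m - y ^+ m - m%:R * h * y ^+ m.+1)
   + h ^+ 2 * (x * y ^+ m.+2) + h ^+ 2 * (m%:R * (x * y ^+ m.+2)).
  rewrite !exprS -natr1.
  transitivity (x * (x ^+ m - y ^+ m - m%:R * h * (y * y ^+ m)) +
    ((x - y) * y ^+ m - h * (y * (y * y ^+ m))) + m%:R * h * y * y ^+ m * (x - y)).
    by ring.
  rewrite xy.
  have -> : h * x * y * y ^+ m - h * (y * (y * y ^+ m)) = h * y * y ^+ m * (x - y) by ring.
  rewrite xy; ring.
have hxy : modulus (x * y ^+ m.+2) <= B ^+ m.+3.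
  rewrite modulusM modulusX [B ^+ _]exprS.
  apply: ler_pM; [exact: modulus_ge0|exact/exprn_ge0/modulus_ge0|exact: hx|].
  by apply: lerXn2r; rewrite ?nnegrE ?modulus_ge0.
apply: le_trans (modulusD _ _) _; rewrite !mulrDl lerD //.
  apply: le_trans (modulusD _ _) _; rewrite lerD //.
    rewrite modulusM -[leRHS]mulrA.
    by apply: ler_pM; [exact: modulus_ge0|exact: modulus_ge0|exact: hx|exact: ih].
  by rewrite modulusM modulusX mulrC ler_wpM2r // sqr_ge0.
rewrite modulusM modulusX mulrC ler_wpM2r ?sqr_ge0 // modulusM.
rewrite -ofR_nat modulus_ofR ger0_norm ?ler0n // ler_wpM2l ?ler0n //.
Qed.

Definition kmean (phi : R -> C) r (m : nat) z := cmean (fun t => phi t * (pt r t - z)^-1 ^+ m).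

Lemma pt_neq r t z : modulus z < r -> pt r t - z != 0.
Proof.
move=> hz; rewrite subr_eq0; apply: contraTneq hz => <-.
by rewrite modulusM modulus_cis mulr1 modulus_ofR -leNgt ler_norm.
Qed.

Lemma contX (F : R -> C) m : continuous F -> continuous (fun t => F t ^+ m).
Proof.
move=> cF; elim: m => [|m ih]; first by under eq_fun do rewrite expr0; exact: contcst.
by under eq_fun do rewrite exprS; exact: contM.
Qed.

Lemma cont_kernel (phi : R -> C) r m z : continuous phi -> modulus z < r ->
  continuous (fun t => phi t * (pt r t - z)^-1 ^+ m).
Proof.
move=> cphi hz; apply: contM; first exact: cphi.
apply: contX => t; apply: cvgV; first exact: pt_neq.
by apply: contB; [exact: continuous_pt|exact: contcst].
Qed.

Lemma kmean_derive (phi : R -> C) r m z : continuous phi -> modulus z < r ->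
  is_derive z 1 (kmean phi r m) (m%:R * kmean phi r m.+1 z).
Proof.
move=> cphi hz; apply: cder_is_derive => e e0.
pose rho := (r - modulus z) / 2; have rho0 : 0 < rho by rewrite divr_gt0 // subr_gt0.
have rhoV : 0 <= rho^-1 by rewrite invr_ge0 ltW.
have [c [c0 hc]] := kernel_estimate m rhoV.
pose M := mean (fun t => modulus (phi t)).
have M0 : 0 <= M by apply: mean_ge0; [exact: contmod|move=> t; exact: modulus_ge0].
have cM0 : 0 < c * M + 1 by rewrite ltr_wpDl // mulr_ge0.
exists (Num.min rho (e / (c * M + 1))); first by rewrite lt_min rho0 divr_gt0.
move=> w; rewrite lt_min => /andP[w1 w2].
have zr : modulus z + rho < r by rewrite /rho; lra.
have hw : modulus w < r.
  by have := modulusD (w - z) z; rewrite subrK; lra.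
have ck m' v : modulus v < r -> continuous (fun t => phi t * (pt r t - v)^-1 ^+ m').
  exact: cont_kernel.
have E : kmean phi r m w - kmean phi r m z - m%:R * kmean phi r m.+1 z * (w - z) =
  cmean (fun t => phi t * ((pt r t - w)^-1 ^+ m - (pt r t - z)^-1 ^+ m -
     m%:R * (w - z) * (pt r t - z)^-1 ^+ m.+1)).
  rewrite -[_ * _ * (w - z)]mulrAC /kmean -(cmeanZ _ (ck m.+1 z hz)).
  rewrite -(cmeanB (ck m w hw) (ck m z hz)) -cmeanB.
  - by apply: eq_cmean => t; ring.
  - by apply: contB; exact: ck.
  - by apply: contZ; exact: ck.
rewrite E; set d := fun t => _; have cd : continuous d.
  rewrite (_ : d = fun t => phi t * (pt r t - w)^-1 ^+ m - phi t * (pt r t - z)^-1 ^+ m -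
     m%:R * (w - z) * (phi t * (pt r t - z)^-1 ^+ m.+1)).
    by apply: contB; [apply: contB; exact: ck|apply: contZ; exact: ck].
  by apply/funext => t; rewrite /d; ring.
apply: le_trans (modulus_cmean_le cd) _.
apply: (@le_trans _ _ (mean (fun t => c * modulus (w - z) ^+ 2 * modulus (phi t)))).
  apply: le_mean; [exact: contmod| |].
    by apply: contMr; [exact: contcstr|exact: contmod].
  move=> t; rewrite modulusM mulrC ler_wpM2r ?modulus_ge0 //; apply: hc.
  - rewrite modulusV lef_pV2 ?posrE ?modulus_gt0 ?pt_neq //.
    have := modulusD (pt r t - w) w; rewrite subrK modulus_pt; last by have := modulus_ge0 z; lra.
    have := modulusD (w - z) z; rewrite subrK /rho in w1 *; lra.
  - rewrite modulusV lef_pV2 ?posrE ?modulus_gt0 ?pt_neq //.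
    have := modulusD (pt r t - z) z; rewrite subrK modulus_pt; last by have := modulus_ge0 z; lra.
    rewrite /rho; have := modulus_ge0 z; lra.
  by field; rewrite !pt_neq.
rewrite meanZ; last exact: contmod.
rewrite -/M; have -> : c * modulus (w - z) ^+ 2 * M = c * M * modulus (w - z) * modulus (w - z) by ring.
rewrite ler_wpM2r ?modulus_ge0 //.
apply: (@le_trans _ _ ((c * M + 1) * modulus (w - z))).
  by rewrite ler_wpM2r ?modulus_ge0 // lerDl.
by rewrite -ler_pdivlMl // mulrC ltW.
Qed.

Definition coefr f r n : C := cmean (fun t => f (pt r t) * pt r t ^ (- n)).
(* The radius 1/2 is immaterial ([coefrE]); [n] ranges over the integers, with
   value 0 for negative [n] when [f] is analytic. *)
Definition coef f n := coefr f 2^-1 n.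

Lemma pt_neq0 r t : 0 < r -> pt r t != 0.
Proof. by move=> r0; rewrite -modulus_eq0 modulus_pt ?ltW // gt_eqF. Qed.

Lemma derivable_exprz n z : z != 0 -> derivable (fun w : C => w ^ n) z 1.
Proof.
move=> z0; case: n => n; first exact/derivable_XC/derivable_idC.
apply: (@derivable_VC _ (fun w : C => w ^+ n.+1)); first by rewrite expf_neq0.
exact/derivable_XC/derivable_idC.
Qed.

Lemma continuous_circle_disc f r : analytic_in_disc f -> 0 <= r -> r < 1 ->
  continuous (fun t => f (pt r t)).
Proof.
move=> af r0 r1; apply: continuous_circle => // z hz.
by apply: derivable_continuous; apply: af; apply/disc_modulus; rewrite hz.
Qed.

Lemma cont_exprz r n : 0 < r -> continuous (fun t => pt r t ^ n).
Proof.
move=> r0; apply: (@continuous_circle _ (fun z => z ^ n)); first exact: ltW.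
move=> z hz; apply/derivable_continuous/derivable_exprz.
by rewrite -modulus_eq0 hz gt_eqF.
Qed.

Lemma cont_coef f r n : analytic_in_disc f -> 0 < r -> r < 1 ->
  continuous (fun t => f (pt r t) * pt r t ^ n).
Proof.
move=> af r0 r1; apply: contM; last exact: cont_exprz.
by apply: continuous_circle_disc => //; exact: ltW.
Qed.

Lemma coefrE f r n : analytic_in_disc f -> 0 < r -> r < 1 -> coefr f r n = coef f n.
Proof.
move=> af.
have H a b : 0 < a -> a <= b -> b < 1 -> coefr f a n = coefr f b n.
  move=> a0 ab b1; apply: (@cmean_circle_const _ (fun z => f z * z ^ (- n)) a b a0 ab).
  move=> z /andP[h1 h2]; apply: derivable_MC.
    by apply: af; apply/disc_modulus; lra.
  by apply: derivable_exprz; rewrite -modulus_eq0 gt_eqF //; lra.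
move=> r0 r1; have [h|h] := leP r 2^-1; first by apply: H => //; lra.
by apply/esym/H; lra.
Qed.

Lemma modulus_exprz z n : modulus (z ^ n) = modulus z ^ n.
Proof. by case: n => n; rewrite ?NegzE /exprz ?modulusV modulusX. Qed.

(** Cauchy's estimate with a free radius: small in [coef_neg] and [coef_mul_kfold], close to 1 in
    [l1_rigidity]. *)
Lemma coef_bound f r n : analytic_in_disc f -> 0 < r -> r < 1 ->
  modulus (coef f n) <= r ^ (- n) * mean (fun t => modulus (f (pt r t))).
Proof.
move=> af r0 r1; rewrite -(coefrE n af r0 r1) /coefr.
apply: le_trans (modulus_cmean_le (cont_coef af r0 r1)) _.
rewrite -meanZ; last by apply: contmod; apply: continuous_circle_disc => //; exact: ltW.
apply: le_mean.
- by apply: contmod; exact: cont_coef.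
- apply: contMr; first exact: contcstr.
  by apply: contmod; apply: continuous_circle_disc => //; exact: ltW.
by move=> t; rewrite modulusM mulrC modulus_exprz modulus_pt // ltW.
Qed.

(** For [n < 0] the factor [r ^ (- n)] of [coef_bound] is at most [r], while [f] stays bounded near
    0; [r] tends to 0. *)
Lemma coef_neg f n : analytic_in_disc f -> n < 0 -> coef f n = 0.
Proof.
move=> af n0; have d0 : disc (0 : C) by apply/disc_modulus; rewrite modulus0.
have := derivable_continuous (af 0 d0).
move=> /(@cvg_modulus _ _ (nbhs (0 : C)) _ f (f 0)) /(_ 1 ltr01) /nbhs_modulus[d d00 hd].
pose M := modulus (f 0) + 1; have M0 : 0 < M by rewrite ltr_wpDl ?modulus_ge0.
apply/eqP; rewrite -modulus_eq0 -normr_le0; apply/ler_addgt0Pr => e e0; rewrite add0r.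
rewrite ger0_norm ?modulus_ge0 //.
pose r := Num.min (d / 2) (Num.min 2^-1 (e / M)).
have r0 : 0 < r by rewrite !lt_min !divr_gt0 // invr_gt0 ltr0n.
have rd : r <= d / 2 by rewrite ge_min lexx.
have r2 : r <= 2^-1 by rewrite !ge_min lexx orbT.
have re : r <= e / M by rewrite !ge_min lexx !orbT.
apply: le_trans (coef_bound n af r0 _) _; first lra.
have hm : mean (fun t => modulus (f (pt r t))) <= M.
  apply: mean_le_cst; first by apply/contmod/continuous_circle_disc => //; lra.
  move=> t; have := hd (pt r t); rewrite subr0 modulus_pt ?(ltW r0) // => /(_ _)/wrap[|/ltW h]; first lra.
  by have := modulusD (f (pt r t) - f 0) (f 0); rewrite subrK /M; lra.
have rn : r ^ (- n) <= r.
  case: n n0 => // m _; rewrite NegzE opprK -exprnP exprSr -[leRHS]mul1r ler_wpM2r ?(ltW r0) //.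
  by apply: exprn_ile1; [exact: ltW|lra].
apply: (@le_trans _ _ (r * M)).
  apply: ler_pM => //; first by rewrite exprz_ge0 // ltW.
  apply: mean_ge0; last by move=> t; exact: modulus_ge0.
  by apply/contmod/continuous_circle_disc => //; lra.
by rewrite -ler_pdivlMr.
Qed.

Lemma derive1n_kmean f r z (m : nat) : analytic_in_disc f -> modulus z < r -> r < 1 ->
  derive1n m f z = m`!%:R * kmean (fun t => f (pt r t) * pt r t) r m.+1 z.
Proof.
move=> af + r1; elim: m z => [|m ih] z zr.
  rewrite fact0 mul1r -[LHS](cauchy_formula af zr r1).
  by apply: eq_cmean => t; rewrite expr1 mulrA.
have r0 : 0 <= r by have := modulus_ge0 z; lra.
have cphi : continuous (fun t => f (pt r t) * pt r t).
  by apply: contM; [exact: continuous_circle_disc|exact: continuous_pt].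
have near_r : \forall w \near z, modulus w < r.
  apply/nbhs_modulus; exists (r - modulus z); first by rewrite subr_gt0.
  by move=> w hw; have := modulusD (w - z) z; rewrite subrK; lra.
rewrite derive1nS derive1E.
rewrite (@near_eq_derive _ _ _ _ (fun w => m`!%:R * kmean (fun t => f (pt r t) * pt r t) r m.+1 w)); last first.
  by apply: filterS near_r => w hw; rewrite (ih w hw).
have [dk ek] := kmean_derive m.+1 cphi zr.
have -> : (fun w => m`!%:R * kmean (fun t => f (pt r t) * pt r t) r m.+1 w) =
   (m`!%:R : C) *: kmean (fun t => f (pt r t) * pt r t) r m.+1 by [].
rewrite deriveZ //= ek /GRing.scale /= mulrA -natrM mulnC factS.
by rewrite mulnC.
Qed.

Lemma coef_derive1n f (m : nat) : analytic_in_disc f ->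
  derive1n m f 0 / m`!%:R = coef f m.
Proof.
move=> af; rewrite (@derive1n_kmean f 2^-1) ?modulus0 ?invr_gt0 //; last lra.
rewrite mulrAC divff ?mul1r; last by rewrite pnatr_eq0 -lt0n fact_gt0.
apply: eq_cmean => t; rewrite subr0 exprS mulrA mulfK; last first.
  by apply: pt_neq0; rewrite invr_gt0.
by rewrite exprVn -exprnN.
Qed.

Lemma coef0 f : analytic_in_disc f -> coef f 0 = f 0.
Proof. by move=> af; rewrite -(coef_derive1n 0 af) fact0 divr1. Qed.

(** When the coefficients vanish, Cauchy's formula remains true with an extra factor
    [(z / pt r t) ^+ N]: passing from [N] to [N.+1] changes the mean by [z ^+ N] times the [N]-th
    coefficient. That factor has modulus [(modulus z / r) ^+ N], which tends to 0. *)
Lemma analytic_coef_eq0 f : analytic_in_disc f -> (forall m : nat, coef f m = 0) ->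
  forall z, disc z -> f z = 0.
Proof.
move=> af c0 z /disc_modulus dz.
pose r := (modulus z + 1) / 2; have m0 := modulus_ge0 z.
have zr : modulus z < r by rewrite /r; lra.
have r1 : r < 1 by rewrite /r; lra.
have r0 : 0 < r by lra.
have cf : continuous (fun t => f (pt r t)) by apply: continuous_circle_disc => //; exact: ltW.
have ck : continuous (fun t => pt r t / (pt r t - z)).
  apply: contM; first exact: continuous_pt.
  move=> t; apply: cvgV; first exact: pt_neq.
  by apply: contB; [exact: continuous_pt|exact: contcst].
have E N : f z = cmean (fun t => f (pt r t) * (pt r t / (pt r t - z)) * (z / pt r t) ^+ N).
  elim: N => [|N ih].
    by rewrite -[LHS](cauchy_formula af zr r1); apply: eq_cmean => t; rewrite expr0 mulr1.
  rewrite ih; have cc N' : continuous (fun t => f (pt r t) * (pt r t / (pt r t - z)) * (z / pt r t) ^+ N').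
    apply: contM; first exact: contM.
    apply: contX; apply: contZ => t; apply: cvgV; first exact: pt_neq0.
    exact: continuous_pt.
  apply/subr0_eq; rewrite -(cmeanB (cc N) (cc N.+1)).
  rewrite (@eq_cmean _ _ (fun t => z ^+ N * (f (pt r t) * pt r t ^ (- N%:Z)))).
    rewrite cmeanZ; last exact: cont_coef.
    by rewrite -/(coefr f r N) (coefrE _ af r0 r1) c0 mulr0.
  move=> t; rewrite exprS -exprnN exprMn exprVn.
  by field; rewrite expf_neq0 ?pt_neq ?pt_neq0.
apply/eqP; rewrite -modulus_eq0 -normr_le0; apply/ler_addgt0Pr => e e0; rewrite add0r.
rewrite ger0_norm ?modulus_ge0 //.
pose M := mean (fun t => modulus (f (pt r t) * (pt r t / (pt r t - z)))).
have cM : continuous (fun t => modulus (f (pt r t) * (pt r t / (pt r t - z)))).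
  by apply: contmod; exact: contM.
have Mb N : modulus (f z) <= (modulus z / r) ^+ N * M.
  rewrite (E N) -(meanZ _ cM); apply: le_trans (modulus_cmean_le _) _.
    apply: contM; first exact: contM.
    apply: contX; apply: contZ => t; apply: cvgV; first exact: pt_neq0.
    exact: continuous_pt.
  apply: le_mean.
  - apply: contmod; apply: contM; first exact: contM.
    apply: contX; apply: contZ => t; apply: cvgV; first exact: pt_neq0.
    exact: continuous_pt.
  - by apply: contMr; [exact: contcstr|exact: cM].
  move=> t; rewrite modulusM mulrC ler_wpM2r ?modulus_ge0 //.
  by rewrite modulusX modulusM modulusV modulus_pt // ltW.
have q1 : `|modulus z / r| < 1.
  have q0 : 0 <= modulus z / r by apply: divr_ge0; [exact: m0|exact: ltW].
  by rewrite (ger0_norm q0) ltr_pdivrMr ?mul1r.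
have := cvg_geometric M q1.
move=> /cvgrPdist_lt /(_ _ e0) [N _ /(_ N (leqnn N))] /=.
rewrite sub0r normrN => h; apply: le_trans (Mb N) _.
by apply: ltW; apply: le_lt_trans h; rewrite mulrC ler_norm.
Qed.

End Coefficients.

(** * Coefficients of sums and products, and Moebius factors *)

Section CoefficientAlgebra.
Variable R : realType.
Local Notation C := (Cplx R).
Local Notation Re := (@complex.Re R).
Local Notation Im := (@complex.Im R).
Implicit Types (f g : C -> C) (z w : C) (r : R) (n : int).

Lemma half_bounds : 0 < 2^-1 :> R /\ 2^-1 < 1 :> R.
Proof. by split; lra. Qed.

Lemma coef_ext f g n : (forall z, disc z -> f z = g z) -> coef f n = coef g n.
Proof.
move=> fg; apply: eq_cmean => t; rewrite fg //.
by apply: disc_pt; apply/andP; split; lra.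
Qed.

Lemma analyticD f g : analytic_in_disc f -> analytic_in_disc g ->
  analytic_in_disc (fun z => f z + g z).
Proof. by move=> af ag z dz; apply: derivable_DC; [exact: af|exact: ag]. Qed.
Lemma analyticB f g : analytic_in_disc f -> analytic_in_disc g ->
  analytic_in_disc (fun z => f z - g z).
Proof. by move=> af ag z dz; apply: derivable_BC; [exact: af|exact: ag]. Qed.
Lemma analyticM f g : analytic_in_disc f -> analytic_in_disc g ->
  analytic_in_disc (fun z => f z * g z).
Proof. by move=> af ag z dz; apply: derivable_MC; [exact: af|exact: ag]. Qed.
Lemma analytic_cst (c : C) : analytic_in_disc (fun _ : C => c).
Proof. by move=> z dz; exact: derivable_cstC. Qed.
Lemma analyticX (m : nat) : analytic_in_disc (fun z : C => z ^+ m).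
Proof. by move=> z dz; exact/derivable_XC/derivable_idC. Qed.
Lemma analyticZ (c : C) f : analytic_in_disc f -> analytic_in_disc (fun z => c * f z).
Proof. by move=> af; apply: analyticM; [exact: analytic_cst|exact: af]. Qed.

Lemma coefD f g n : analytic_in_disc f -> analytic_in_disc g ->
  coef (fun z => f z + g z) n = coef f n + coef g n.
Proof.
move=> af ag; have [h1 h2] := half_bounds; rewrite /coef /coefr -cmeanD.
- by apply: eq_cmean => t; rewrite mulrDl.
- exact: cont_coef.
- exact: cont_coef.
Qed.
Lemma coefB f g n : analytic_in_disc f -> analytic_in_disc g ->
  coef (fun z => f z - g z) n = coef f n - coef g n.
Proof.
move=> af ag; have [h1 h2] := half_bounds; rewrite /coef /coefr -cmeanB.
- by apply: eq_cmean => t; rewrite mulrBl.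
- exact: cont_coef.
- exact: cont_coef.
Qed.
Lemma coefZ (c : C) f n : analytic_in_disc f -> coef (fun z => c * f z) n = c * coef f n.
Proof.
move=> af; have [h1 h2] := half_bounds; rewrite /coef /coefr -cmeanZ; last exact: cont_coef.
by apply: eq_cmean => t; rewrite mulrA.
Qed.
Lemma coef_mulX (m : nat) f n : coef (fun z => z ^+ m * f z) n = coef f (n - m%:Z).
Proof.
have [h1 h2] := half_bounds.
apply: eq_cmean => t; rewrite opprB expfzDr; last exact: pt_neq0.
by rewrite -exprnP -mulrA mulrCA.
Qed.

Lemma coef_cst (c : C) n : coef (fun=> c) n = if n == 0 then c else 0.
Proof.
case: n => [[|m]|m]; last 2 first.
- rewrite -coef_derive1n; last exact: analytic_cst.
  have H (a : C) z : derive1n m.+1 (fun=> a) z = 0.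
    elim: m z => [|m ih] z; first by rewrite derive1n1; exact: derive1_cst.
    rewrite derive1nS; rewrite (_ : derive1n _ _ = cst 0) ?derive1_cst //.
    by apply/funext => w; rewrite ih.
  by rewrite H mul0r.
- by rewrite (coef_neg (@analytic_cst c)).
by rewrite (coef0 (@analytic_cst c)).
Qed.

Lemma analytic_coef_inj f g : analytic_in_disc f -> analytic_in_disc g ->
  (forall m : nat, coef f m = coef g m) -> forall z, disc z -> f z = g z.
Proof.
move=> af ag h z dz; apply/subr0_eq.
apply: (@analytic_coef_eq0 _ (fun z => f z - g z) (analyticB af ag)); last exact: dz.
by move=> m; rewrite (coefB _ af ag) h subrr.
Qed.

Lemma cont_cis_exprz n : continuous (fun t : R => cis t ^ n).
Proof.
have -> : (fun t : R => cis t ^ n) = fun t => pt 1 t ^ n.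
  by apply/funext => t; rewrite /pt ofR1 mul1r.
exact: cont_exprz.
Qed.

Lemma coef_cis f r n : analytic_in_disc f -> 0 < r -> r < 1 ->
  cmean (fun t => f (pt r t) * cis t ^ (- n)) = ofR r ^ n * coef f n.
Proof.
move=> af r0 r1; rewrite -(coefrE n af r0 r1) /coefr -cmeanZ; last exact: cont_coef.
apply: eq_cmean => t; rewrite /pt expfzMl mulrCA [_ ^ n * (_ * _)]mulrA -expfzDr ?subrr ?expr0z ?mul1r //.
by rewrite -modulus_eq0 modulus_ofR gtr0_norm // gt_eqF.
Qed.

Lemma disc_exprn (k : nat) z : (0 < k)%N -> disc z -> disc (z ^+ k).
Proof.
move=> k0 /disc_modulus dz; apply/disc_modulus; rewrite modulusX.
by rewrite exprn_ilt1 ?modulus_ge0 // -lt0n.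
Qed.

Lemma analytic_kfold (k : nat) (h : C -> C) : (0 < k)%N -> analytic_in_disc h ->
  analytic_in_disc (fun z => h (z ^+ k)).
Proof.
move=> k0 ah z dz; apply: (@derivable_compC _ (fun z => z ^+ k)); first exact/derivable_XC/derivable_idC.
exact/ah/disc_exprn.
Qed.

(** Replace [h] by its first-order expansion at 0. On the circle of radius [r] the remainder,
    evaluated at [z ^+ k], is [o(r ^+ k)], so [coef_bound] makes its [k]-th coefficient arbitrarily
    small. *)
Lemma coef_mul_kfold f (h : C -> C) (k : nat) : (0 < k)%N -> analytic_in_disc f ->
  analytic_in_disc h ->
  coef (fun z => f z * h (z ^+ k)) k = h 0 * coef f k + derive1 h 0 * coef f 0.
Proof.
move=> k0 af ah; have d0 : disc (0 : C) by apply/disc_modulus; rewrite modulus0.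
pose E w := h w - h 0 - derive1 h 0 * w.
have aE : analytic_in_disc E.
  apply: analyticB; first by apply: analyticB; [exact: ah|exact: analytic_cst].
  by apply: analyticZ; move=> z _; exact: derivable_idC.
have aD : analytic_in_disc (fun z => f z * E (z ^+ k)).
  by apply: analyticM; [exact: af|exact: analytic_kfold].
have -> : (fun z => f z * h (z ^+ k)) =
   fun z => h 0 * f z + derive1 h 0 * (z ^+ k * f z) + f z * E (z ^+ k).
  by apply/funext => z; rewrite /E; ring.
have aXf : analytic_in_disc (fun z => z ^+ k * f z) by apply: analyticM; [exact: analyticX|exact: af].
have a1 := @analyticZ (h 0) _ af; have a2 := @analyticZ (derive1 h 0) _ aXf.
rewrite (coefD _ (analyticD a1 a2) aD) (coefD _ a1 a2) (coefZ _ _ af) (coefZ _ _ aXf).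
rewrite coef_mulX subrr -[RHS]addr0; congr (_ + _).
apply/eqP; rewrite -modulus_eq0 -normr_le0; apply/ler_addgt0Pr => e e0; rewrite add0r.
rewrite ger0_norm ?modulus_ge0 //.
have := derivable_continuous (af 0 d0).
move=> /(@cvg_modulus _ _ (nbhs (0 : C)) _ f (f 0)) /(_ 1 ltr01) /nbhs_modulus[d d00 hd].
pose M := modulus (f 0) + 1; have M0 : 0 < M by rewrite ltr_wpDl ?modulus_ge0.
have [d' d'0 hd'] := derivable_cder (ah 0 d0) (divr_gt0 e0 M0).
pose r := Num.min (d / 2) (Num.min 2^-1 (d' / 2)).
have r0 : 0 < r by rewrite !lt_min !divr_gt0 // invr_gt0 ltr0n.
have rd : r <= d / 2 by rewrite ge_min lexx.
have r2 : r <= 2^-1 by rewrite !ge_min lexx orbT.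
have rd' : r <= d' / 2 by rewrite !ge_min lexx !orbT.
have r1 : r < 1 by lra.
apply: le_trans (coef_bound k aD r0 r1) _.
have hm : mean (fun t => modulus (f (pt r t) * E (pt r t ^+ k))) <= e * r ^+ k.
  apply: mean_le_cst.
    by apply: contmod; apply: (continuous_circle_disc aD (ltW r0) r1).
  move=> t; rewrite modulusM.
  have h1 : modulus (f (pt r t)) <= M.
    have := hd (pt r t); rewrite subr0 modulus_pt ?(ltW r0) // => /(_ _)/wrap[|/ltW hh]; first lra.
    by have := modulusD (f (pt r t) - f 0) (f 0); rewrite subrK /M; lra.
  have h2 : modulus (E (pt r t ^+ k)) <= e / M * r ^+ k.
    have := hd' (pt r t ^+ k); rewrite subr0 modulusX modulus_pt ?(ltW r0) //.
    apply; apply: (@le_lt_trans _ _ r); last lra.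
    by rewrite -[leRHS]expr1; apply: ler_wiXn2l => //; lra.
  apply: (@le_trans _ _ (M * (e / M * r ^+ k))).
    by apply: ler_pM; rewrite ?modulus_ge0.
  by rewrite mulrA [M * _]mulrC divfK ?gt_eqF.
rewrite -exprnN -exprVn.
apply: (@le_trans _ _ (r^-1 ^+ k * (e * r ^+ k))).
  by rewrite ler_wpM2l // exprn_ge0 // invr_ge0 ltW.
by rewrite mulrCA -exprMn mulVf ?gt_eqF // expr1n mulr1.
Qed.

Lemma ofR_exprz_cvg (n : int) : ofR r ^ n @[r --> (1 : R)^'-] --> (1 : C).
Proof.
apply: cvg_at_left_filter; rewrite -[X in _ --> X](exp1rz _ n).
apply: (@cvg_comp _ _ _ (@ofR R) (fun z => z ^ n)).
  exact: continuous_ofR.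
by apply: derivable_continuous; apply: derivable_exprz; exact: oner_neq0.
Qed.

Lemma near_left1 (r0 : R) : r0 < 1 -> \forall r \near (1 : R)^'-, r0 < r < 1.
Proof.
move=> h; near=> r; apply/andP; split; near: r.
  exact: nbhs_left_gt.
exact: nbhs_left_lt.
Unshelve. all: by end_near. Qed.

Lemma real_le_limit (A B : R -> R) a b : A r @[r --> 1^'-] --> a -> B r @[r --> 1^'-] --> b ->
  (forall e, 0 < e -> \forall r \near (1 : R)^'-, A r <= B r + e) -> a <= b.
Proof.
move=> hA hB h; apply/ler_addgt0Pr => e e0.
apply: (@ler_cvg_to _ (1 : R)^'- _ _ A (fun r => B r + e) a (b + e) hA).
  by apply: cvgD; [exact: hB|exact: cvg_cst].
exact: h.
Qed.

Implicit Types (h : C -> C) (a : R).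

Lemma Re_affine_gt0 a w : 0 <= a <= 1 -> disc w -> 0 < Re (1 + ofR a * w).
Proof.
move=> /andP[a0 a1] /disc_modulus w1; rewrite ReD ReM [Re (ofR a)]/= [Im (ofR a)]/= mul0r subr0.
rewrite [Re 1]/=; have := normRe_le w; rewrite ler_norml => /andP[h _].
have : a * - modulus w <= a * Re w by rewrite ler_wpM2l.
have : a * modulus w <= 1 * modulus w by rewrite ler_wpM2r ?modulus_ge0.
by lra.
Qed.

Lemma affine_neq0 a w : 0 <= a <= 1 -> disc w -> 1 + ofR a * w != 0.
Proof.
move=> ha dw; have := Re_affine_gt0 ha dw.
by apply: contraTneq => ->; rewrite [Re 0]/= ltxx.
Qed.

Lemma derivable_affine (c : C) a w : derivable (fun w => c + ofR a * w) w 1.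
Proof.
apply: derivable_DC; first exact: derivable_cstC.
by apply: derivable_MC; [exact: derivable_cstC|exact: derivable_idC].
Qed.

Lemma analytic_shift a : analytic_in_disc (fun w : C => ofR a + w).
Proof. by move=> w dw; apply: derivable_DC; [exact: derivable_cstC|exact: derivable_idC]. Qed.

Lemma analytic_moebius a : 0 <= a <= 1 ->
  analytic_in_disc (fun w : C => (ofR a + w) / (1 + ofR a * w)).
Proof.
move=> ha; apply: analyticM; first exact: analytic_shift.
move=> w dw; apply: derivable_VC; [exact: affine_neq0|exact: derivable_affine].
Qed.

(** Source of both the bound for Moebius factors in the disc and the equality of moduli on the
    circle. *)
Lemma sqr_affine_diff a w : modulus (1 + ofR a * w) ^+ 2 - modulus (ofR a + w) ^+ 2 =
  (1 - a ^+ 2) * (1 - modulus w ^+ 2).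
Proof.
rewrite !sqr_modulus !ReD !ImD ReM ImM [Re (ofR a)]/= [Im (ofR a)]/= [Re 1]/= [Im 1]/=.
by ring.
Qed.

Lemma shift_le_affine a w : 0 <= a <= 1 -> modulus w <= 1 ->
  modulus (ofR a + w) <= modulus (1 + ofR a * w).
Proof.
move=> /andP[a0 a1] w1; rewrite -ler_sqr ?nnegrE ?modulus_ge0 // -subr_ge0 sqr_affine_diff.
by rewrite mulr_ge0 // subr_ge0 expr_le1 ?modulus_ge0.
Qed.

Lemma modulus_moebius a w : 0 <= a <= 1 -> disc w ->
  modulus ((ofR a + w) / (1 + ofR a * w)) <= 1.
Proof.
move=> ha dw; have n0 : 0 < modulus (1 + ofR a * w) by rewrite modulus_gt0 affine_neq0.
rewrite modulusM modulusV ler_pdivrMr // mul1r shift_le_affine //.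
exact/ltW/disc_modulus.
Qed.

End CoefficientAlgebra.

(** * Variational inequalities *)

Section Variation.
Variable R : realType.
Local Notation C := (Cplx R).
Local Notation Re := (@complex.Re R).
Local Notation Im := (@complex.Im R).
Implicit Types (f g : C -> C) (z w : C) (r : R) (n : int).

Lemma expR_le_quad (u : R) : u <= 1 / 2 -> expR u <= 1 + u + 2 * u ^+ 2.
Proof.
move=> hu; have h := expR_ge1Dx (- u).
have u1 : 0 < 1 - u by lra.
have e1 : expR u <= (1 - u)^-1.
  by rewrite -[expR u]invrK -expRN lef_pV2 ?posrE ?expR_gt0.
apply: le_trans e1 _; rewrite -[leLHS]mul1r ler_pdivrMr //.
have -> : (1 + u + 2 * u ^+ 2) * (1 - u) = 1 + u ^+ 2 * (1 - 2 * u) by ring.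
by rewrite lerDl mulr_ge0 ?sqr_ge0 //; lra.
Qed.

(** Since [2 ln s = ln (1 + 2 y) <= 2 y], the power is at most [expR (q * y)]. It is applied to
    [s = |1 + eps chi|], which may vanish; then the right-hand side, a positive quadratic in
    [q * y], suffices. *)
Lemma powR_le_quad (s q y : R) : 0 <= s -> 1 <= q -> s ^+ 2 = 1 + 2 * y -> q * y <= 1 / 2 ->
  s `^ q <= 1 + q * y + 2 * (q * y) ^+ 2.
Proof.
move=> s0 q1 sy qy; have [s00|sn0] := eqVneq s 0.
  rewrite s00 powR0; last by rewrite gt_eqF //; lra.
  have -> : 1 + q * y + 2 * (q * y) ^+ 2 = 2 * (q * y + 1 / 4) ^+ 2 + 7 / 8 by field.
  by have := sqr_ge0 (q * y + 1 / 4); lra.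
have sp : 0 < s by rewrite lt_def sn0.
apply: le_trans (expR_le_quad qy); rewrite /powR (negPf sn0) ler_expR ler_pM2l; last lra.
have h1 : ln (s ^+ 2) <= 2 * y by have := exprn_gt0 2 sp; rewrite sy => h; apply: le_ln1Dx; lra.
rewrite lnXn // mulr2n in h1; lra.
Qed.

(** Lets the coefficients of polynomials and of [kerQ] be read on the unit circle itself. *)
Lemma coefr_entire f r n : (forall z, derivable f z 1) -> 0 < r -> coefr f r n = coef f n.
Proof.
move=> df r0.
have H a b : 0 < a -> a <= b -> coefr f a n = coefr f b n.
  move=> a0 ab; apply: (@cmean_circle_const _ (fun z => f z * z ^ (- n)) a b a0 ab).
  move=> z /andP[h1 h2]; apply: derivable_MC; first exact: df.
  by apply: derivable_exprz; rewrite -modulus_eq0 gt_eqF //; lra.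
have [h|h] := leP r 2^-1; first exact: H.
by apply/esym/H; lra.
Qed.

(* What Hoelder's and Young's inequalities retain of [|f|_p <= 1], [sigma = 1/p];
   this form covers [p = oo] ([sigma = 0]) and avoids boundary values. *)
Definition young_means f (sigma : R) := forall e : R, 0 < e ->
  \forall r \near (1 : R)^'-, forall b B : R -> R, continuous b -> continuous B ->
    (forall t, 0 <= b t) -> (forall t, b t `^ (1 - sigma)^-1 <= B t) ->
    mean (fun t => modulus (f (pt r t)) * b t) <= sigma + e + (1 - sigma) * mean B.

Section Kernel.
Variables (gam : R) (k : nat).
Hypothesis k0 : (0 < k)%N.

(* On the unit circle [kerM] equals [kerQ z / z^k] and is the modulus to the
   p-th power of the extremal function. *)
Definition kerM z : R := modulus (1 + ofR gam * z ^+ k) ^+ 2 / (1 + gam ^+ 2).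
Definition kerQ z : C := (ofR gam + z ^+ k) * (1 + ofR gam * z ^+ k) / ofR (1 + gam ^+ 2).

Lemma g2_gt0 : 0 < 1 + gam ^+ 2.
Proof. by rewrite ltr_wpDr // sqr_ge0. Qed.

Lemma ofR_g2_neq0 : ofR (1 + gam ^+ 2) != 0 :> C.
Proof. by rewrite -ofR0 (inj_eq (@ofR_inj R)) gt_eqF // g2_gt0. Qed.

Lemma derivable_kerQ z : derivable kerQ z 1.
Proof.
apply: derivable_MC; last exact: derivable_cstC.
apply: derivable_MC.
  by apply: derivable_DC; [exact: derivable_cstC|exact/derivable_XC/derivable_idC].
apply: derivable_DC; first exact: derivable_cstC.
by apply: derivable_MC; [exact: derivable_cstC|exact/derivable_XC/derivable_idC].
Qed.

Lemma kerM_unit z : modulus z = 1 -> ofR (kerM z) = kerQ z * z ^ (- k%:Z).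
Proof.
move=> z1; have z0 : z != 0 by rewrite -modulus_eq0 z1 oner_eq0.
have cc : cconj (1 + ofR gam * z ^+ k) = 1 + ofR gam * z^-1 ^+ k.
  by rewrite cconjD cconjM cconjX (cconj_unit z1) cconj_ofR (cconj_ofR 1).
rewrite /kerM ofRM -mul_cconj cc ofRV /kerQ -exprnN -exprVn exprVn.
field; apply/andP; split; first exact: expf_neq0.
by have := ofR_g2_neq0; rewrite ofRD ofRX; apply.
Qed.

Lemma coef_kerQ n : coef kerQ n = (ofR (1 + gam ^+ 2))^-1 *
  ((if n == 0 then ofR gam else 0) + ofR (1 + gam ^+ 2) * (if n - k%:Z == 0 then 1 else 0)
   + ofR gam * (if n - (k + k)%:Z == 0 then 1 else 0)).
Proof.
have a1 := @analytic_cst R (ofR gam).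
have aX m : analytic_in_disc (fun z : C => z ^+ m * 1) by apply: analyticM; [exact: analyticX|exact: analytic_cst].
have a2 := @analyticZ _ (ofR (1 + gam ^+ 2)) _ (aX k).
have a3 := @analyticZ _ (ofR gam) _ (aX (k + k)%N).
have -> : kerQ = fun z => (ofR (1 + gam ^+ 2))^-1 *
   (ofR gam + ofR (1 + gam ^+ 2) * (z ^+ k * 1) + ofR gam * (z ^+ (k + k) * 1)).
  apply/funext => z; rewrite /kerQ mulrC exprD ofRD ofRX ofR1; congr (_ * _); ring.
rewrite coefZ; last exact: analyticD (analyticD a1 a2) a3.
rewrite (coefD _ (analyticD a1 a2) a3) (coefD _ a1 a2) (coefZ _ _ (aX k)) (coefZ _ _ (aX (k + k)%N)).
by rewrite !coef_mulX !coef_cst.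
Qed.

(** The divisor [1 + gam ^+ 2] of [kerQ] is chosen for this value, which gives [kerM] mean 1 on the
    unit circle. *)
Lemma coef_kerQ_k : coef kerQ k = 1.
Proof.
rewrite coef_kerQ subrr eqxx mulr1.
have kz : (k%:Z == 0) = false.
  by apply/negbTE/eqP => -[kk]; move: k0; rewrite kk.
have -> : (k%:Z - (k + k)%:Z == 0) = false.
  by rewrite PoszD opprD addrA subrr sub0r oppr_eq0.
rewrite kz mulr0 addr0 add0r mulVf //.
exact: ofR_g2_neq0.
Qed.

Lemma continuous_kerM z : {for z, continuous kerM}.
Proof.
pose m (w : C) := modulus (1 + ofR gam * w ^+ k).
have h : {for z, continuous m}.
  apply: (@continuous_comp _ _ _ (fun w => 1 + ofR gam * w ^+ k) (@modulus R)).
    apply: derivable_continuous; apply: derivable_DC; first exact: derivable_cstC.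
    by apply: derivable_MC; [exact: derivable_cstC|exact/derivable_XC/derivable_idC].
  exact: continuous_modulus.
apply: (@continuousM _ _ (fun w => m w * m w) (fun=> (1 + gam ^+ 2)^-1)).
  exact: (@continuousM _ _ m m).
exact: cst_continuous.
Qed.

Lemma mean_kerM_exprz (c : C) n :
  mean (fun t => kerM (pt 1 t) * Re (c * pt 1 t ^ n)) = Re (c * coef kerQ (k%:Z - n)).
Proof.
have r1 : (0 : R) < 1 by [].
have cQ : continuous (fun t => kerQ (pt 1 t) * pt 1 t ^ (- (k%:Z - n))).
  apply: contM; last exact: cont_exprz.
  apply: (@continuous_circle _ kerQ); first exact: ltW.
  by move=> z _; apply: derivable_continuous; exact: derivable_kerQ.
rewrite -(coefr_entire _ derivable_kerQ r1) /coefr -(cmeanZ _ cQ).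
apply: eq_mean => t; have m1 : modulus (pt 1 t : C) = 1 by rewrite modulus_pt.
have p0 := @pt_neq0 R 1 t r1.
have -> : - (k%:Z - n) = - k%:Z + n by rewrite opprB addrC.
rewrite expfzDr // [kerQ _ * _]mulrA -(kerM_unit m1) mulrCA.
by rewrite [RHS]ReM /= mul0r subr0.
Qed.

Lemma mean_kerM_unit : mean (fun t => kerM (pt 1 t)) = 1.
Proof.
have h := mean_kerM_exprz 1 0; rewrite subr0 mul1r coef_kerQ_k in h.
rewrite -[RHS]/(Re (1 : C)) -h.
by apply: eq_mean => t; rewrite expr0z mulr1 mulr1.
Qed.

Lemma kerM_mean_cvg : mean (fun t => kerM (pt r t)) @[r --> (1 : R)^'-] --> (1 : R).
Proof.
apply: cvg_at_left_filter; rewrite -[X in _ --> X]mean_kerM_unit.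
apply: mean_radius_cvg; near=> s => t; exact: continuous_kerM.
Unshelve. all: by end_near. Qed.

Lemma kerM_exprz_cvg (c : C) n :
  mean (fun t => kerM (pt r t) * Re (c * pt r t ^ n)) @[r --> (1 : R)^'-] -->
  Re (c * coef kerQ (k%:Z - n)).
Proof.
apply: cvg_at_left_filter; rewrite -mean_kerM_exprz.
apply: (@mean_radius_cvg _ (fun z => kerM z * Re (c * z ^ n))).
near=> s => t; have s0 : 0 < s by near: s; exact: lt_nbhsr.
apply: (@continuousM _ _ kerM (fun z => Re (c * z ^ n))); first exact: continuous_kerM.
apply: (@continuous_comp _ _ _ (fun z => c * z ^ n) Re); last exact: continuous_Re.
apply/derivable_continuous/derivable_MC; first exact: derivable_cstC.
by apply/derivable_exprz/pt_neq0.
Unshelve. all: by end_near. Qed.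
End Kernel.

Section YoungVariation.
Variables (f H : C -> C) (gam sigma : R) (k : nat).
Hypotheses (k0 : (0 < k)%N) (sigma01 : 0 <= sigma < 1).
Hypotheses (af : analytic_in_disc f) (aH : analytic_in_disc H).
Hypothesis young_f : young_means f sigma.
Hypothesis H_le : forall z, disc z ->
  modulus (H z) `^ (1 - sigma)^-1 <= modulus (1 + ofR gam * z ^+ k) ^+ 2.

Local Notation G := (fun z => f z * H z).
Local Notation V := ((1 + gam ^+ 2) `^ (1 - sigma)).
Local Notation q := ((1 - sigma)^-1).
Local Notation M := (kerM gam k).

Let V_gt0 : 0 < V. Proof. exact/powR_gt0/g2_gt0. Qed.

Let q_ge1 : 1 <= q.
Proof.
move: sigma01 => /andP[s0 s1]; have s2 : 0 < 1 - sigma by lra.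
by rewrite -[leLHS]invr1 lef_pV2 ?posrE //; lra.
Qed.

(* Bound the mean of [f H z^-k (1 + eps c z^n)] by Young's inequality against
   [|H (1 + eps c z^n)|]: the terms linear in [eps] must balance at equality, which
   determines every coefficient of [f H]. *)
Lemma young_variation (n : int) (c : C) (eps : R) : 0 <= eps ->
  6 * q * (eps * modulus c) <= 1 ->
  Re (coef G k + ofR eps * c * coef G (k%:Z - n)) <=
  V * (1 + eps ^+ 2 * (2 * modulus c) ^+ 2 * (5 * q) + eps * Re (c * coef (kerQ gam k) (k%:Z - n))).
Proof.
move=> eps0 hq; set a := 2 * modulus c; set K := 5 * q.
have aG : analytic_in_disc G by exact: analyticM.
have s1 : 0 < 1 - sigma by move: sigma01 => /andP[]; lra.
have a0 : 0 <= a by rewrite mulr_ge0 // modulus_ge0.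
rewrite -ler_pdivrMl //.
set X := Re _; set Y := Re (c * _).
(* The factor [r ^+ k] compensates the modulus of [z ^- k] on the circle of radius [r]. *)
apply: (@real_le_limit _ (fun r => V^-1 * X * r ^+ k)
  (fun r => sigma + (((1 - sigma) + eps ^+ 2 * a ^+ 2 * K) * mean (fun t => M (pt r t))
     + eps * mean (fun t => M (pt r t) * Re (c * pt r t ^ n))))).
- rewrite -[X in _ --> X]mulr1; apply: cvgM; first exact: cvg_cst.
  apply: cvg_at_left_filter; rewrite -[X in _ --> X](expr1n _ k).
  exact: exprn_continuous.
- have -> : 1 + eps ^+ 2 * a ^+ 2 * K + eps * Y =
    sigma + ((1 - sigma + eps ^+ 2 * a ^+ 2 * K) * 1 + eps * Y) by ring.
  apply: cvgD; first exact: cvg_cst.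
  apply: cvgD; (apply: cvgM; first exact: cvg_cst).
    exact: kerM_mean_cvg.
  exact: kerM_exprz_cvg.
move=> e e0.
(* The integer [n] may be negative; near the unit circle [|z ^ n| < 2], whence
   [a = 2 * modulus c]. *)
have zn : \forall r \near (1 : R)^'-, r ^ n < 2.
  have /cvg_modulus /(_ 1 ltr01) := @ofR_exprz_cvg R n.
  move=> h; near=> r; have r0 : 0 < r.
    by near: r; apply: filterS (near_left1 ltr01) => r /andP[].
  have : modulus (ofR r ^ n - 1 : C) < 1 by near: r.
  have := modulusD (ofR r ^ n - 1) (1 : C); rewrite subrK modulus1.
  by rewrite modulus_exprz modulus_ofR gtr0_norm //; lra.
apply: filterS3 (young_f e0) zn (near_left1 ltr01) => r yr rn /andP[r0 r1].
pose chi t : C := c * pt r t ^ n.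
pose y t := eps * Re (chi t) + eps ^+ 2 * modulus (chi t) ^+ 2 / 2.
have chi_le t : modulus (chi t) <= a.
  rewrite modulusM modulus_exprz modulus_pt ?(ltW r0) // mulrC.
  by apply: ler_wpM2r; [exact: modulus_ge0|exact: ltW].
have echi t : eps * modulus (chi t) <= eps * a by rewrite ler_wpM2l.
have ea1 : 3 * q * (eps * a) <= 1 by rewrite /a; lra.
have ea0 : 0 <= eps * a by exact: mulr_ge0.
have ea2 : eps * a <= 1 / 3.
  have : 3 * (eps * a) <= 3 * q * (eps * a).
    by rewrite ler_wpM2r // ler_peMr.
  by lra.
have cchi : continuous chi by apply: contZ; exact: cont_exprz.
have yb t : `|y t| <= 3 / 2 * (eps * a).
  have h1 : `|eps * Re (chi t)| <= eps * a.
    rewrite normrM ger0_norm //; apply: le_trans (echi t).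
    by rewrite ler_wpM2l // normRe_le.
  have h2 : eps ^+ 2 * modulus (chi t) ^+ 2 / 2 <= eps * a / 2.
    rewrite ler_wpM2r // -exprMn; apply: le_trans (echi t).
    rewrite expr2 ler_piMr ?mulr_ge0 ?modulus_ge0 //.
    by have := echi t; lra.
  have h3 : 0 <= eps ^+ 2 * modulus (chi t) ^+ 2 / 2.
    by rewrite divr_ge0 // mulr_ge0 // sqr_ge0.
  apply: le_trans (ler_normD _ _) _; rewrite (ger0_norm h3); lra.
have sq t : modulus (1 + ofR eps * chi t) ^+ 2 = 1 + 2 * y t.
  rewrite /y !sqr_modulus ReD ImD ReM ImM /=; by field.
(* The outer [q] cancels the [1 - sigma] in front of [mean B]; the constant term [q * (1 - sigma)]
   is 1. *)
pose B t := q * (M (pt r t) * ((1 - sigma) + eps * Re (chi t) + eps ^+ 2 * a ^+ 2 * K)).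
pose b t := modulus (H (pt r t)) * modulus (1 + ofR eps * chi t) / V.
have q0 : 0 < q by rewrite invr_gt0.
have g0 := g2_gt0 gam.
have M0 z : 0 <= M z by rewrite divr_ge0 ?sqr_ge0 // ltW.
have cHr : continuous (fun t => H (pt r t)) by exact: continuous_circle_disc (ltW r0) r1.
have cMr : continuous (fun t => M (pt r t)).
  by move=> t; apply: (@continuous_comp _ _ _ (pt r)); [exact: continuous_pt|exact: continuous_kerM].
have c1chi : continuous (fun t => 1 + ofR eps * chi t).
  by apply: contD; [exact: contcst|exact: contZ].
have cb : continuous b.
  apply: contMr; last exact: contcstr.
  by apply: contMr; exact: contmod.
have cRchi : continuous (fun t => Re (chi t)) by exact: contRe.
have cin : continuous (fun t => (1 - sigma) + eps * Re (chi t) + eps ^+ 2 * a ^+ 2 * K).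
  apply: contDr; last exact: contcstr.
  apply: contDr; first exact: contcstr.
  by apply: contMr; first exact: contcstr.
have cB : continuous B.
  apply: contMr; first exact: contcstr.
  exact: contMr.
have b0 t : 0 <= b t.
  by rewrite /b divr_ge0 ?(ltW V_gt0) // mulr_ge0 // modulus_ge0.
have bB t : b t `^ q <= B t.
  have dz : disc (pt r t : C) by apply: disc_pt; apply/andP; split; lra.
  have qy : q * y t <= 1 / 2.
    have := ler_norm (y t); have := yb t => h1 h2.
    have : q * y t <= q * (3 / 2 * (eps * a)) by rewrite ler_wpM2l ?(ltW q0) //; lra.
    lra.
  have hs := powR_le_quad (modulus_ge0 _) q_ge1 (sq t) qy.
  have VE : V `^ q = 1 + gam ^+ 2.
    by rewrite -powRrM mulfV ?gt_eqF // powRr1 // ltW.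
  have bE : b t `^ q * (1 + gam ^+ 2) =
     modulus (H (pt r t)) `^ q * modulus (1 + ofR eps * chi t) `^ q.
    rewrite -VE -powRM ?(ltW V_gt0) // -powRM ?modulus_ge0 //.
    by rewrite /b divfK // gt_eqF.
  have h1 : b t `^ q <= M (pt r t) * (1 + q * y t + 2 * (q * y t) ^+ 2).
    rewrite -(ler_pM2r g0) bE.
    have -> : M (pt r t) * (1 + q * y t + 2 * (q * y t) ^+ 2) * (1 + gam ^+ 2) =
      modulus (1 + ofR gam * pt r t ^+ k) ^+ 2 * (1 + q * y t + 2 * (q * y t) ^+ 2).
      by rewrite /kerM mulrAC divfK // gt_eqF.
    by apply: ler_pM; rewrite ?powR_ge0 //; exact: H_le.
  apply: le_trans h1 _; rewrite /B [leRHS]mulrCA; apply: ler_wpM2l; first exact: M0.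
  have RE : q * ((1 - sigma) + eps * Re (chi t) + eps ^+ 2 * a ^+ 2 * K) =
    1 + (q * (eps * Re (chi t)) + q * (eps ^+ 2 * a ^+ 2 * K)).
    by field; rewrite gt_eqF.
  rewrite RE -[leLHS]addrA lerD2l.
  have y2 : y t ^+ 2 <= (3 / 2 * (eps * a)) ^+ 2.
    have y32 : 0 <= 3 / 2 * (eps * a) by lra.
    rewrite -[leLHS]real_normK ?num_real //.
    by apply: lerXn2r; rewrite ?nnegrE //; exact: yb.
  have c2 : modulus (chi t) ^+ 2 <= a ^+ 2.
    by apply: lerXn2r; rewrite ?nnegrE ?modulus_ge0.
  have h2 : q * y t <= q * (eps * Re (chi t)) + q * (eps ^+ 2 * a ^+ 2 / 2).
    rewrite -mulrDr ler_wpM2l ?(ltW q0) // /y lerD2l ler_wpM2r // ler_wpM2l ?sqr_ge0 //.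
  have h3 : 2 * (q * y t) ^+ 2 <= q ^+ 2 * (9 / 2 * (eps ^+ 2 * a ^+ 2)).
    have -> : 2 * (q * y t) ^+ 2 = q ^+ 2 * (2 * y t ^+ 2) by ring.
    have -> : 9 / 2 * (eps ^+ 2 * a ^+ 2) = 2 * (3 / 2 * (eps * a)) ^+ 2 by field.
    by rewrite ler_wpM2l ?sqr_ge0 // ler_wpM2l.
  have h4 : q * (eps ^+ 2 * a ^+ 2 / 2) <= q ^+ 2 * (eps ^+ 2 * a ^+ 2 / 2).
    have T0 : 0 <= eps ^+ 2 * a ^+ 2 / 2 by rewrite -exprMn divr_ge0 // sqr_ge0.
    have qq : q <= q ^+ 2 by rewrite expr2 ler_peMr ?(ltW q0).
    exact: ler_wpM2r T0 _ _ qq.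
  (* Origin of [K = 5 q]: a share [1 / 2] comes from the quadratic part of [y], a share [9 / 2] from
     the square in [powR_le_quad] with [|y| <= 3 / 2 * (eps * a)]. *)
  have -> : q * (eps ^+ 2 * a ^+ 2 * K) = q ^+ 2 * (eps ^+ 2 * a ^+ 2 / 2) +
     q ^+ 2 * (9 / 2 * (eps ^+ 2 * a ^+ 2)) by rewrite /K; field; rewrite gt_eqF.
  lra.
have main := yr b B cb cB b0 bB.
have mB : (1 - sigma) * mean B = (1 - sigma + eps ^+ 2 * a ^+ 2 * K) * mean (fun t => M (pt r t))
     + eps * mean (fun t => M (pt r t) * Re (c * pt r t ^ n)).
  rewrite -(meanZ _ cB) -(meanZ _ cMr) -meanZ; last exact: contMr.
  rewrite -meanD.
  - apply: eq_mean => t; rewrite /B /chi.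
    by field; rewrite gt_eqF.
  - by apply: contMr; first exact: contcstr.
  - by apply: contMr; [exact: contcstr|exact: contMr].
rewrite -mB addrAC; apply: le_trans main.
have XE : X = Re (cmean (fun t => G (pt r t) * pt r t ^ (- k%:Z) * (1 + ofR eps * chi t))).
  congr Re; rewrite -(coefrE k aG r0 r1) -(coefrE (k%:Z - n) aG r0 r1) /coefr.
  have c1 := @cont_coef _ _ _ (- k%:Z) aG r0 r1.
  have c2 := @cont_coef _ _ _ (- (k%:Z - n)) aG r0 r1.
  rewrite -(cmeanZ _ c2) -(cmeanD c1 (@contZ _ _ _ c2)); apply: eq_cmean => t.
  have -> : - (k%:Z - n) = - k%:Z + n by rewrite opprB addrC.
  rewrite expfzDr ?pt_neq0 // /chi; ring.
have rk0 : 0 < r ^+ k by rewrite exprn_gt0.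
have cG : continuous (fun t => G (pt r t) * pt r t ^ (- k%:Z) * (1 + ofR eps * chi t)).
  apply: contM; last exact: c1chi.
  exact: (@cont_coef _ _ r (- k%:Z) aG r0 r1).
rewrite XE -mulrA mulrC.
apply: (@le_trans _ _ (mean (fun t => modulus (G (pt r t) * pt r t ^ (- k%:Z) * (1 + ofR eps * chi t))) * r ^+ k / V)).
  rewrite ler_pM2r ?invr_gt0 // ler_pM2r //; exact: Re_cmean_le.
rewrite -mulrA mulrC -meanZ; last exact: contmod.
rewrite le_eqVlt; apply/orP; left; apply/eqP/eq_mean => t.
rewrite !modulusM modulus_exprz modulus_pt ?(ltW r0) // /b -exprnN.
by field; rewrite !gt_eqF.
Unshelve. all: by end_near. Qed.

Lemma young_bound : Re (coef G k) <= V.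
Proof.
have := @young_variation 0 0 0 (lexx 0); rewrite modulus0 !mulr0 => /(_ ler01).
by rewrite ?(mul0r, mulr0, addr0, mulr1) expr0n /= ?(mul0r, mulr0, addr0, mulr1).
Qed.

(** For the defect [D] of the [m]-th coefficient, take [c = cconj D] and [n = k - m]. The linear
    terms of [young_variation] then differ by [eps * |D| ^+ 2] while the error is [eps ^+ 2 * K], so
    [|D| ^+ 2 <= eps * K] for all small [eps]. *)
Lemma young_rigidity : Re (coef G k) = V ->
  forall z, disc z -> G z = ofR V * kerQ gam k z.
Proof.
move=> GV; have aG : analytic_in_disc G by exact: analyticM.
have aQ : analytic_in_disc (kerQ gam k) by move=> z _; exact: derivable_kerQ.
have aVQ := @analyticZ _ (ofR V) _ aQ.
apply: (analytic_coef_inj aG aVQ) => m; rewrite (coefZ _ _ aQ).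
apply/subr0_eq; set D := _ - _.
apply/eqP; rewrite -modulus_eq0 -sqrf_eq0 -normr_le0 ger0_norm ?sqr_ge0 //.
apply/ler_addgt0Pr => e e0; rewrite add0r.
pose c := cconj D; pose K := V * ((2 * modulus c) ^+ 2 * (5 * q)).
have K0 : 0 <= K.
  by rewrite /K mulr_ge0 ?(ltW V_gt0) // mulr_ge0 ?sqr_ge0 // mulr_ge0 // (le_trans _ q_ge1).
have c0 := modulus_ge0 c.
have q0 : 0 < q by apply: lt_le_trans q_ge1.
pose eps := Num.min (e / (K + 1)) (6 * q * (modulus c + 1))^-1.
have eps0 : 0 < eps.
  rewrite lt_min divr_gt0 //; last lra.
  by rewrite invr_gt0 !mulr_gt0 //; lra.
have e1 : eps <= e / (K + 1) by rewrite ge_min lexx.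
have e2 : eps <= (6 * q * (modulus c + 1))^-1 by rewrite ge_min lexx orbT.
have hq : 6 * q * (eps * modulus c) <= 1.
  apply: (@le_trans _ _ (6 * q * (eps * (modulus c + 1)))).
    rewrite ler_wpM2l //; first by rewrite mulr_ge0 // ltW.
    by rewrite ler_wpM2l ?(ltW eps0) //; lra.
  rewrite mulrCA -ler_pdivlMr ?mul1r //.
  by rewrite !mulr_gt0 //; lra.
have := @young_variation (k%:Z - m%:Z) c eps (ltW eps0) hq.
rewrite subKr.
have -> : Re (coef G k + ofR eps * c * coef G m) = V + eps * Re (c * coef G m).
  rewrite ReD GV; congr (_ + _).
  by rewrite -mulrA [LHS]ReM [X in _ - X]mul0r subr0.
have cD : Re (c * coef G m) = Re (c * (ofR V * coef (kerQ gam k) m)) + modulus D ^+ 2.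
  have -> : coef G m = D + ofR V * coef (kerQ gam k) m by rewrite /D subrK.
  by rewrite mulrDr ReD addrC [c * D]mulrC mul_cconj.
have cV : Re (c * (ofR V * coef (kerQ gam k) m)) = V * Re (c * coef (kerQ gam k) m).
  by rewrite mulrCA [LHS]ReM [X in _ - X]mul0r subr0.
rewrite cD cV => h.
have h2 : eps * modulus D ^+ 2 <= eps * (eps * K) by rewrite /K; lra.
rewrite ler_pM2l // in h2; apply: le_trans h2 _.
apply: (@le_trans _ _ (e / (K + 1) * (K + 1))).
  by apply: ler_pM; rewrite ?(ltW eps0) //; lra.
by rewrite divfK // gt_eqF //; lra.
Qed.
End YoungVariation.
End Variation.

(** * Variations at exponent one *)

Section L1Variation.
Variable R : realType.
Local Notation C := (Cplx R).
Local Notation Re := (@complex.Re R).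
Local Notation Im := (@complex.Im R).
Implicit Types (f g : C -> C) (z w : C) (r : R) (n : int).

Definition l1_means f := forall e : R, 0 < e ->
  \forall r \near (1 : R)^'-, mean (fun t => modulus (f (pt r t))) <= 1 + e.

Section Symmetry.
Variables (f H : C -> C) (k : nat).
Hypotheses (af : analytic_in_disc f) (aH : analytic_in_disc H).
Hypothesis l1_f : l1_means f.
Hypothesis H_le : forall z, disc z -> modulus (H z) <= 1.
Local Notation G := (fun z => f z * H z).

Let aG : analytic_in_disc G. Proof. exact: analyticM. Qed.

Lemma cis_exprzN (t : R) n : cis t ^ (- n) = cconj (cis t ^ n).
Proof.
have cX (w : C) (m : nat) : modulus w = 1 -> cconj (w ^+ m) = w ^- m.
  by move=> w1; rewrite cconjX cconj_unit // exprVn.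
case: n => m; first by rewrite -exprnN -exprnP cX ?modulus_cis.
by rewrite NegzE opprK -exprnP -exprnN -exprVn cX ?modulusV ?modulus_cis ?invr1 // -exprVn invrK.
Qed.

(* At [p = 1] the multiplier has to be almost unimodular: [1 + i eps psi] with
   [psi = Re (c z^n)] has modulus [1 + O(eps^2)], and the linear term in [eps]
   yields the symmetry of the coefficients of [f H] about [k]. *)
Lemma l1_variation n (c : C) (eps : R) :
  Re (coef G k) - eps / 2 * Im (c * coef G (k%:Z - n) + cconj c * coef G (k%:Z + n))
   <= 1 + eps ^+ 2 * modulus c ^+ 2 / 2.
Proof.
pose W m := coef G m.
pose A r := Re (ofR r ^ k%:Z * W k + Complex 0 (eps / 2) *
   (c * (ofR r ^ (k%:Z - n) * W (k%:Z - n)) + cconj c * (ofR r ^ (k%:Z + n) * W (k%:Z + n)))).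
set K := 1 + _.
apply: (@real_le_limit _ A (fun=> K)).
- have -> : Re (coef G k) - eps / 2 * Im (c * W (k%:Z - n) + cconj c * W (k%:Z + n)) =
    Re (1 * W k + Complex 0 (eps / 2) * (c * (1 * W (k%:Z - n)) + cconj c * (1 * W (k%:Z + n)))).
    by rewrite !mul1r [RHS]ReD [X in _ = _ + X]ReM /= mul0r sub0r.
  have hh m : ofR r ^ m * W m @[r --> (1 : R)^'-] --> 1 * W m.
    by apply: cvgM; [exact: ofR_exprz_cvg|exact: cvg_cst].
  pose A' (r : R) : C := ofR r ^ k%:Z * W k + Complex 0 (eps / 2) *
   (c * (ofR r ^ (k%:Z - n) * W (k%:Z - n)) + cconj c * (ofR r ^ (k%:Z + n) * W (k%:Z + n))).
  have hA : A' r @[r --> (1 : R)^'-] -->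
      1 * W k + Complex 0 (eps / 2) * (c * (1 * W (k%:Z - n)) + cconj c * (1 * W (k%:Z + n))).
    apply: cvgD; first exact: hh.
    apply: cvgM; first exact: cvg_cst.
    by apply: cvgD; (apply: cvgM; [exact: cvg_cst|exact: hh]).
  exact: (cvg_comp A' Re hA (@continuous_Re R _)).
- exact: cvg_cst.
move=> e e0; have K0 : 0 < K.
  by rewrite ltr_wpDr // divr_ge0 // mulr_ge0 // sqr_ge0.
apply: filterS2 (l1_f (divr_gt0 e0 K0)) (near_left1 ltr01) => r fr /andP[r0 r1].
(* Built on [cis t] and not on [pt r t], so that the conjugate half of the real part is again a
   power, [cis t ^ (- n)]; this accounts for the powers of [ofR r] in [A]. *)
pose psi t := Re (c * cis t ^ n).
have cG : continuous (fun t => G (pt r t)) by exact: continuous_circle_disc aG (ltW r0) r1.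
have cpsi : continuous (fun t => 1 + Complex 0 (eps * psi t) : C).
  apply: contD; first exact: contcst.
  have -> : (fun t => Complex 0 (eps * psi t) : C) = fun t => Complex 0 eps * ofR (psi t).
    by apply/funext => t; apply: Cext; rewrite ?ReM ?ImM /=; ring.
  apply: contZ => t; apply: (@continuous_comp _ _ _ psi); last exact: continuous_ofR.
  by apply: contRe; apply: contZ; exact: cont_cis_exprz.
have cGk m : continuous (fun t => G (pt r t) * cis t ^ m).
  by apply: contM; [exact: cG|exact: cont_cis_exprz].
have AE : A r = Re (cmean (fun t => G (pt r t) * cis t ^ (- k%:Z) * (1 + Complex 0 (eps * psi t)))).
  rewrite /A /W -!(coef_cis _ aG r0 r1).
  have c0 := cGk (- k%:Z).
  have c1 := @contZ _ c _ (cGk (- (k%:Z - n))).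
  have c2 := @contZ _ (cconj c) _ (cGk (- (k%:Z + n))).
  have c3 := contD c1 c2.
  rewrite -(cmeanZ c (cGk (- (k%:Z - n)))) -(cmeanZ (cconj c) (cGk (- (k%:Z + n)))).
  rewrite -(cmeanD c1 c2) -(cmeanZ _ c3) -(cmeanD c0 (@contZ _ (Complex 0 (eps / 2)) _ c3)).
  congr Re; apply: eq_cmean => t.
  have -> : Complex 0 (eps * psi t) =
    Complex 0 (eps / 2) * (c * cis t ^ n + cconj c * cis t ^ (- n)) :> C.
    rewrite cis_exprzN -cconjM /psi; case: (c * _) => x y.
    by apply: Cext; rewrite ?ReM ?ImM ?ReD ?ImD /=; field.
  rewrite !opprD opprK !expfzDr ?cis_neq0 //; ring.
rewrite AE; apply: le_trans (Re_cmean_le _) _.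
  by apply: contM; [exact: cGk|exact: cpsi].
apply: (@le_trans _ _ (mean (fun t => K * modulus (f (pt r t))))).
  apply: le_mean.
  - by apply: contmod; apply: contM; [exact: cGk|exact: cpsi].
  - apply: contMr; first exact: contcstr.
    by apply/contmod/(continuous_circle_disc af (ltW r0) r1).
  move=> t; have dz : disc (pt r t : C) by apply: disc_pt; apply/andP; split; lra.
  rewrite !modulusM modulus_exprz modulus_cis exp1rz mulr1 mulrC.
  apply: ler_pM; rewrite ?mulr_ge0 ?modulus_ge0 //; last first.
    by rewrite ler_piMr ?modulus_ge0 //; exact: H_le.
  rewrite -(@ler_pXn2r _ 2) ?nnegrE ?modulus_ge0 ?(ltW K0) //.
  rewrite sqr_modulus ReD ImD /= addr0 add0r expr1n.
  have p2 : psi t ^+ 2 <= modulus c ^+ 2.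
    rewrite -[leLHS]real_normK ?num_real //.
    apply: lerXn2r; rewrite ?nnegrE ?modulus_ge0 //.
    apply: le_trans (normRe_le _) _.
    by rewrite modulusM modulus_exprz modulus_cis exp1rz mulr1.
  have := @ler_wpM2l _ (eps ^+ 2) (sqr_ge0 _) _ _ p2.
  have := sqr_ge0 (eps ^+ 2 * modulus c ^+ 2).
  rewrite /K exprMn; lra.
rewrite meanZ; last by apply/contmod/(continuous_circle_disc af (ltW r0) r1).
apply: (@le_trans _ _ (K * (1 + e / K))); first by rewrite ler_pM2l.
by rewrite mulrDr mulr1 mulrCA divff ?mulr1 // gt_eqF.
Qed.

Lemma l1_bound : Re (coef G k) <= 1.
Proof.
have := @l1_variation 0 0 0.
by rewrite expr0n /= ?(mul0r, mulr0, addr0, subr0, modulus0).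
Qed.

(** At equality, dividing [l1_variation] by [eps] and letting it tend to 0 fixes the sign of the
    linear term for every [c]. Replacing [c] by [- c] makes it zero, and [c = 1], [c = i] separate
    real and imaginary parts. *)
Lemma l1_symmetry : Re (coef G k) = 1 ->
  forall n, coef G (k%:Z + n) = cconj (coef G (k%:Z - n)).
Proof.
move=> G1 n.
have le0 c : 0 <= Im (c * coef G (k%:Z - n) + cconj c * coef G (k%:Z + n)).
  set Y := Im _; rewrite -oppr_le0; apply/ler_addgt0Pr => e e0; rewrite add0r.
  have c1 : 0 < modulus c ^+ 2 + 1 by rewrite ltr_wpDl // sqr_ge0.
  pose eps := e / (modulus c ^+ 2 + 1); have eps0 : 0 < eps by rewrite divr_gt0.
  have := @l1_variation n c eps; rewrite -/Y G1 => h.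
  have h2 : eps * - Y <= eps * (eps * modulus c ^+ 2) by lra.
  rewrite ler_pM2l // in h2; apply: (le_trans h2).
  by rewrite mulrAC ler_pdivrMr // ler_pM2l // lerDl.
have eq0 c : Im (c * coef G (k%:Z - n) + cconj c * coef G (k%:Z + n)) = 0.
  apply/eqP; rewrite eq_le le0 andbT -oppr_ge0 -ImN.
  by have := le0 (- c); rewrite cconjN !mulNr -opprD.
have h1 := eq0 1; have h2 := eq0 (Complex 0 1).
rewrite (cconj_ofR 1) !mul1r ImD in h1.
rewrite ImD !ImM Re_cconj Im_cconj -[Re (Complex 0 1)]/(0 : R) -[Im (Complex 0 1)]/(1 : R) in h2.
by apply: Cext; rewrite ?Re_cconj ?Im_cconj; lra.
Qed.
End Symmetry.

(* With [F = f / (1 + b z^k)], the symmetry kills the coefficients of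
   [(b + z^k) F] beyond [2 k]; beyond [k] those of [F] would then grow like
   [b^(- n / k)] and so vanish, [b] being less than 1. *)
Lemma l1_rigidity f (b t : R) (k : nat) : (0 < k)%N -> analytic_in_disc f -> l1_means f ->
  0 <= b < 1 -> f 0 = ofR t ->
  Re (coef (fun z => f z * ((ofR b + z ^+ k) / (1 + ofR b * z ^+ k))) k) = 1 ->
  forall z, disc z -> f z = ofR t * (1 + ofR b * z ^+ k) ^+ 2.
Proof.
move=> k0 af l1f /andP[b0 b1] f0 G1.
have b01 : 0 <= b <= 1 by rewrite b0 ltW.
have dnz z : disc z -> 1 + ofR b * z ^+ k != 0 by move=> /(disc_exprn k0); exact: affine_neq0 b01.
pose F z := f z / (1 + ofR b * z ^+ k).
have aF : analytic_in_disc F.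
  apply: analyticM; first exact: af.
  move=> z dz; apply: derivable_VC; first exact: dnz.
  apply: derivable_DC; first exact: derivable_cstC.
  by apply: derivable_MC; [exact: derivable_cstC|exact/derivable_XC/derivable_idC].
pose H (z : C) := (ofR b + z ^+ k) / (1 + ofR b * z ^+ k).
have aH : analytic_in_disc H := analytic_kfold k0 (analytic_moebius b01).
have H1 z : disc z -> modulus (H z) <= 1 by move=> /(disc_exprn k0); exact: modulus_moebius b01.
have sym := l1_symmetry af aH l1f H1 G1.
set G := (fun z => f z * H z) in sym.
have aXF : analytic_in_disc (fun z => z ^+ k * F z) by apply: analyticM; [exact: analyticX|exact: aF].
have GF n : coef G n = ofR b * coef F n + coef F (n - k%:Z).
  have -> : coef G n = coef (fun z => ofR b * F z + z ^+ k * F z) n.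
    by apply: coef_ext => z _; rewrite /G /H /F -mulrDl mulrCA.
  by rewrite (coefD _ (@analyticZ _ (ofR b) _ aF) aXF) (coefZ _ _ aF) coef_mulX.
have Gneg n : n < 0 -> coef F n = 0 by exact: coef_neg.
have G2k n : k%:Z < n -> coef G (k%:Z + n) = 0.
  move=> kn; rewrite sym coef_neg; [exact: (cconj_ofR 0)|exact: analyticM|].
  by rewrite subr_lt0.
have Fstep n : k%:Z < n -> coef F n = - ofR b * coef F (n + k%:Z).
  move=> kn; have h := G2k n kn; rewrite [k%:Z + n]addrC GF addrK in h.
  by rewrite mulNr; apply/eqP; rewrite -addr_eq0 [_ + _ * _]addrC h.
have Fj n (j : nat) : k%:Z < n -> modulus (coef F n) = b ^+ j * modulus (coef F (n + (j * k)%:Z)).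
  move=> kn; elim: j => [|j ih]; first by rewrite mul0n addr0 mul1r.
  rewrite ih Fstep; last by apply: (lt_le_trans kn); rewrite lerDl.
  rewrite modulusM modulusN modulus_ofR ger0_norm // mulrA -exprSr.
  by rewrite -addrA -PoszD mulSnr.
(* At this radius the gain [b ^+ j] of [Fj] beats the growth [r ^- (j * k)] that [coef_bound]
   allows. *)
have [r [r0 r1 rb]] : exists r : R, [/\ 0 < r, r < 1 & b < r ^+ k].
  have h : r ^+ k @[r --> (1 : R)^'-] --> (1 : R).
    apply: cvg_at_left_filter; rewrite -[X in _ --> X](expr1n _ k); exact: exprn_continuous.
  have : \forall r \near (1 : R)^'-, b < r ^+ k by exact: (cvgr_gt _ h).
  move=> hb; have [r] := @filter_ex _ _ _ _ (filterI hb (near_left1 ltr01)).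
  by move=> [h1 /andP[h2 h3]]; exists r.
have Fbig n : k%:Z < n -> coef F n = 0.
  move=> kn; apply/eqP; rewrite -modulus_eq0 -normr_le0 ger0_norm ?modulus_ge0 //.
  apply/ler_addgt0Pr => e e0; rewrite add0r.
  pose M := r ^ (- n) * mean (fun t => modulus (F (pt r t))).
  have rk : 0 < r ^+ k by rewrite exprn_gt0.
  have q1 : `|b / r ^+ k| < 1.
    by rewrite ger0_norm ?divr_ge0 ?(ltW rk) // ltr_pdivrMr // mul1r.
  have /cvgrPdist_lt /(_ _ e0) [N _ hN] := cvg_geometric M q1.
  have h := hN N (leqnn N); rewrite /= sub0r normrN in h.
  apply: (@le_trans _ _ (M * (b / r ^+ k) ^+ N)); last first.
    by apply: (le_trans (ler_norm _)); exact: ltW.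
  rewrite (Fj _ N kn) mulrC; have := coef_bound (n + (N * k)%:Z) aF r0 r1.
  move=> hb; apply: (@le_trans _ _ (r ^ (- (n + (N * k)%:Z)) * mean (fun t => modulus (F (pt r t))) * b ^+ N)).
    by apply: ler_wpM2r; first exact: exprn_ge0.
  have r00 : r != 0 by rewrite gt_eqF.
  rewrite opprD expfzDr // /M expr_div_n -exprnN mulnC exprM.
  rewrite le_eqVlt; apply/orP; left; apply/eqP; ring.
have F0 : coef F 0 = ofR t.
  by rewrite (coef0 aF) /F f0 expr0n gtn_eqF // mulr0 addr0 divr1.
(* Strictly between 0 and [k] the symmetry says that the [m]-th coefficient is [b] times the
   conjugate of the one at [k - m]. Used twice, it makes the coefficient equal to [b ^+ 2] times
   itself. *)
have Fmid n : 0 < n -> n < k%:Z -> coef F n = 0.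
  have st m : 0 < m -> m < k%:Z -> coef F m = ofR b * cconj (coef F (k%:Z - m)).
    move=> m0 mk; have := sym m; rewrite !GF addrAC subrr add0r [k%:Z - m - _]addrAC subrr add0r.
    rewrite (Fbig (k%:Z + m)) ?ltrDl // (Gneg (- m)) ?oppr_lt0 // mulr0 add0r addr0.
    by move=> ->; rewrite cconjM cconj_ofR.
  move=> n0 nk; have h1 := st n n0 nk.
  have := st (k%:Z - n); rewrite subKr subr_gt0 nk => /(_ isT).
  rewrite -subr_gt0 opprB addrCA subrr addr0 => /(_ n0) h2.
  rewrite h2 cconjM cconj_ofR cconjK mulrA in h1.
  have : (1 - ofR b * ofR b) * coef F n = 0 by rewrite mulrBl mul1r -h1 subrr.
  move=> /eqP; rewrite mulf_eq0 -ofRM => /orP[|/eqP//].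
  rewrite -ofR1 -ofRN -ofRD -ofR0 (inj_eq (@ofR_inj R)) => /eqP hb.
  by exfalso; nra.
have Fk : coef F k = ofR (b * t).
  have := sym k%:Z; rewrite !GF subrr addrK F0.
  rewrite (Fbig (k%:Z + k%:Z)) ?ltrDl ?ltz_nat //.
  rewrite (Gneg (0 - k%:Z)) ?sub0r ?oppr_lt0 ?ltz_nat // mulr0 add0r addr0 => ->.
  by rewrite cconjM !cconj_ofR ofRM.
have aT : analytic_in_disc (fun z : C => ofR t + ofR (b * t) * (z ^+ k * 1)).
  apply: analyticD; first exact: analytic_cst.
  by apply: analyticZ; apply: analyticM; [exact: analyticX|exact: analytic_cst].
have FE : forall z, disc z -> F z = ofR t + ofR (b * t) * (z ^+ k * 1).
  apply: (analytic_coef_inj aF aT) => m.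
  have aX1 : analytic_in_disc (fun z : C => z ^+ k * 1).
    by apply: analyticM; [exact: analyticX|exact: analytic_cst].
  rewrite (coefD _ (@analytic_cst _ (ofR t)) (@analyticZ _ (ofR (b * t)) _ aX1)).
  rewrite (coefZ _ _ aX1) coef_mulX !coef_cst.
  have [->|m0] := posnP m.
    rewrite F0 eqxx sub0r oppr_eq0; have -> : (k%:Z == 0) = false.
      by apply/negbTE/eqP => -[kk]; move: k0; rewrite kk.
    by rewrite mulr0 addr0.
  have -> : (m%:Z == 0) = false by apply/negbTE/eqP => -[kk]; move: m0; rewrite kk.
  rewrite add0r subr_eq0; have [[->]|mk] := eqVneq m%:Z k%:Z; first by rewrite mulr1.
  rewrite mulr0; have [h|h] := ltP m%:Z k%:Z; first by apply: Fmid.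
  by apply: Fbig; rewrite lt_neqAle eq_sym mk.
move=> z dz; have := FE z dz; rewrite /F => /(canRL (divfK (dnz z dz))) ->.
by rewrite ofRM; ring.
Qed.

End L1Variation.

(** * The Fejer-Riesz factorisation *)

Section FejerRiesz.
Variable R : realType.
Local Notation C := (Cplx R).
Local Notation Re := (@complex.Re R).
Local Notation Im := (@complex.Im R).
Implicit Types (P Q : {poly C}) (z w : C).

(** [C] is packaged as a [numFieldType] only; algebraic closedness is taken from the underlying
    [R[i]]. *)
Lemma poly_rootC P : (1 < size P)%N -> exists z, root P z.
Proof.
move=> sP; apply: (@closed_rootP (R[i] : closedFieldType) P).
by rewrite neq_ltn sP orbT.
Qed.

Lemma derivable_horner P z : derivable (fun w => P.[w]) z 1.
Proof.
elim/poly_ind: P => [|P c ih]; first by under eq_fun do rewrite horner0; exact: derivable_cstC.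
under eq_fun do rewrite hornerMXaddC.
by apply: derivable_DC; [apply: derivable_MC; [exact: ih|exact: derivable_idC]|exact: derivable_cstC].
Qed.

Definition circle_nonneg P (k : nat) := forall z, modulus z = 1 ->
  exists2 x : R, 0 <= x & P.[z] = ofR x * z ^+ k.

(* Infinitely many points of the circle. *)
Let cay (m : nat) : C := Complex 1 m%:R / Complex 1 (- m%:R).

Let cay_den (m : nat) : Complex 1 (- m%:R) != 0 :> C.
Proof. by rewrite eq_complex /= oner_eq0. Qed.

Let cay_unit m : modulus (cay m) = 1.
Proof.
rewrite modulusM modulusV /modulus /= sqrrN mulfV //.
Qed.

Let cay_inj : injective cay.
Proof.
move=> m n; rewrite /cay => h.
have h2 : (Complex 1 m%:R : C) * Complex 1 (- n%:R) = Complex 1 n%:R * Complex 1 (- m%:R).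
  by move/eqP: h; rewrite eqr_div ?cay_den // => /eqP.
have := congr1 Im h2; rewrite !ImM /= !mul1r !mulr1 => h3.
have h4 : (m%:R : R) = n%:R by lra.
by apply/eqP; rewrite -(eqr_nat R) h4.
Qed.

Lemma poly_eq_circle P Q : (forall z, modulus z = 1 -> P.[z] = Q.[z]) -> P = Q.
Proof.
move=> h; apply/eqP; rewrite -subr_eq0; apply/negP => /negP PQ0.
have := @max_poly_roots _ (P - Q) [seq cay m | m <- iota 0 (size (P - Q))] PQ0.
rewrite size_map size_iota ltnn (map_inj_uniq cay_inj) iota_uniq => /(_ _ isT).
have -> // : all (root (P - Q)) [seq cay m | m <- iota 0 (size (P - Q))].
  apply/allP => _ /mapP[m _ ->]; apply/rootP.
  by rewrite hornerD hornerN h ?subrr // cay_unit.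
by move/(_ isT).
Qed.

(** The reciprocal polynomial [z^k conj (P (1 / conj z))], see [horner_conj_rev]; [k] may exceed the
    degree of [P]. *)
Definition conj_rev (k : nat) P : {poly C} := \poly_(i < k.+1) cconj P`_(k - i).

Lemma horner_conj_rev (k : nat) P z : (size P <= k.+1)%N -> z != 0 ->
  (conj_rev k P).[z] = z ^+ k * cconj P.[(cconj z)^-1].
Proof.
move=> sP z0; have zc : cconj z != 0 by rewrite -modulus_eq0 modulus_cconj modulus_eq0.
have zV : cconj (cconj z)^-1 = z^-1.
  by apply: (mulfI z0); rewrite mulfV // -{1}(cconjK z) -cconjM mulfV // (cconj_ofR 1).
rewrite /conj_rev horner_poly (horner_coef_wide _ sP).
rewrite (big_morph _ (@cconjD R) (cconj_ofR 0)) mulr_sumr.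
rewrite (reindex_inj rev_ord_inj) /=; apply: eq_bigr => i _.
have hi : (i <= k)%N by rewrite -ltnS.
rewrite subSS (subKn hi) cconjM cconjX zV mulrCA; congr (_ * _).
have -> : z ^+ k = z ^+ (k - i) * z ^+ i by rewrite -exprD subnK.
by rewrite -mulrA -exprMn mulfV // expr1n mulr1.
Qed.

Lemma horner_conj_rev_unit (k : nat) P z : (size P <= k.+1)%N -> modulus z = 1 ->
  (conj_rev k P).[z] = z ^+ k * cconj P.[z].
Proof.
move=> sP z1; have z0 : z != 0 by rewrite -modulus_eq0 z1 oner_eq0.
by rewrite (horner_conj_rev sP z0) (cconj_unit z1) invrK.
Qed.

Lemma circle_factor_identity (lam z : C) : modulus z = 1 ->
  (lam - z) * (1 - cconj lam * z) = - z * ((lam - z) * cconj (lam - z)).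
Proof.
move=> z1; have z0 : z != 0 by rewrite -modulus_eq0 z1 oner_eq0.
by rewrite cconjB (cconj_unit z1); field.
Qed.

(** Since [z^-k P] is real on the circle, [P] agrees there with its reversal of order [2 k], hence
    everywhere. The nonzero roots are therefore symmetric under reflection in the circle. *)
Lemma circle_nonneg_reciprocal P k : (size P <= (k + k).+1)%N -> circle_nonneg P k ->
  (forall z, z != 0 -> P.[z] = z ^+ (k + k) * cconj (P.[(cconj z)^-1])) /\
  P`_(k + k) = cconj P`_0.
Proof.
move=> sP hP; have PE : P = conj_rev (k + k) P.
  apply: poly_eq_circle => z z1; have z0 : z != 0 by rewrite -modulus_eq0 z1 oner_eq0.
  rewrite (horner_conj_rev_unit sP z1); have [x _ ->] := hP z z1.
  rewrite cconjM cconj_ofR cconjX (cconj_unit z1) exprD mulrCA -mulrA -exprMn mulfV //.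
  by rewrite expr1n mulr1.
split; first by move=> z z0; rewrite {1}PE; exact: horner_conj_rev.
by rewrite {1}PE coef_poly ltnSn subnn.
Qed.

Lemma cis_sub1 (s : R) : cis s - 1 = cis (s / 2) * (Complex 0 1 * ofR (2 * sin (s / 2))).
Proof.
rewrite [X in cis X]splitr cisD.
have -> : 1 = cis (s / 2) * cis (- (s / 2)) :> C by rewrite -cisD subrr cis0.
rewrite -mulrBr; congr (_ * _).
by apply: Cext; rewrite ?ReD ?ImD ?ReN ?ImN ?ReM ?ImM /= ?cosN ?sinN; ring.
Qed.

Lemma circle_path_cvg (Q : {poly C}) (zeta : C) (k : nat) : modulus zeta = 1 ->
  {for (0 : R), continuous (fun s : R => Q.[zeta * cis s] * (zeta * cis s) ^- k)}.
Proof.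
move=> z1; have h : {for (0 : R), continuous (fun s : R => zeta * cis s)}.
  apply: (@contZ _ zeta (@cis R)); exact: continuous_cis.
apply: (@continuousM _ _ (fun s : R => Q.[zeta * cis s]) (fun s => (zeta * cis s) ^- k)).
  apply: (@continuous_comp _ _ _ (fun s : R => zeta * cis s) (fun w => Q.[w])); first exact: h.
  exact/derivable_continuous/derivable_horner.
apply: (@continuous_comp _ _ _ (fun s : R => zeta * cis s) (fun w => w ^- k)); first exact: h.
apply/derivable_continuous/derivable_VC; last exact/derivable_XC/derivable_idC.
by rewrite expf_neq0 // -modulus_eq0 modulusM z1 mul1r modulus_cis oner_eq0.
Qed.

Definition nonneg_real (z : C) := 0 <= Re z /\ Im z = 0.

Lemma nonneg_real_closed (F : set_system R) {FF : ProperFilter F} (g : R -> C) (l : C) :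
  g s @[s --> F] --> l -> (\forall s \near F, nonneg_real (g s)) -> nonneg_real l.
Proof.
move=> hg hn; split.
  have h : Re (g s) @[s --> F] --> Re l by apply: (cvg_comp g Re hg); exact: continuous_Re.
  apply: (@ler_cvg_to _ F _ _ (fun=> 0) _ 0 _ _ h); first exact: cvg_cst.
  by apply: filterS hn => s [].
have h : Im (g s) @[s --> F] --> Im l by apply: (cvg_comp g Im hg); exact: continuous_Im.
apply/eqP; rewrite eq_le; apply/andP; split.
  apply: (@ler_cvg_to _ F _ _ _ (fun=> 0) _ 0 h); first exact: cvg_cst.
  by apply: filterS hn => s [_ ->].
apply: (@ler_cvg_to _ F _ _ (fun=> 0) _ 0 _ _ h); first exact: cvg_cst.
by apply: filterS hn => s [_ ->].
Qed.

Lemma nonneg_realP (z w : C) : w != 0 ->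
  (exists2 x : R, 0 <= x & z = ofR x * w) <-> nonneg_real (z / w).
Proof.
move=> w0; split=> [[x x0 ->]|[h1 h2]]; first by rewrite mulfK.
exists (Re (z / w)) => //; rewrite -[LHS](divfK w0); congr (_ * _).
exact: Cext.
Qed.

Lemma circle_path_unit (zeta : C) (s : R) (k : nat) : modulus zeta = 1 ->
  modulus (zeta * cis s) = 1 /\ (zeta * cis s) ^+ k != 0.
Proof.
move=> z1; have h : modulus (zeta * cis s) = 1 by rewrite modulusM z1 mul1r modulus_cis.
by split=> //; rewrite expf_neq0 // -modulus_eq0 h oner_eq0.
Qed.

(** After a root [zeta] on the circle has been divided out, positivity of the quotient is known only
    away from [zeta]; continuity along the circle fills the gap. *)
Lemma circle_nonneg_extend Q (zeta : C) (k : nat) : modulus zeta = 1 ->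
  (forall z, modulus z = 1 -> z != zeta -> exists2 x : R, 0 <= x & Q.[z] = ofR x * z ^+ k) ->
  circle_nonneg Q k.
Proof.
move=> z1 hQ z zz; have [->|] := eqVneq z zeta; last exact: hQ.
have zk : zeta ^+ k != 0 by rewrite expf_neq0 // -modulus_eq0 z1 oner_eq0.
apply/nonneg_realP => //.
have h : Q.[zeta * cis s] * (zeta * cis s) ^- k @[s --> (0 : R)] -->
   Q.[zeta * cis 0] * (zeta * cis 0) ^- k by exact: circle_path_cvg.
rewrite cis0 mulr1 in h.
apply: nonneg_real_closed (cvg_at_right_filter h) _.
near=> s; have [u1 uk] := circle_path_unit s k z1.
apply/(nonneg_realP _ uk); apply: hQ => //.
have s0 : 0 < s by near: s; exact: nbhs_right_gt.
have sp : s < pi by near: s; apply: nbhs_right_lt; exact: pi_gt0.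
apply/eqP => /(canRL (mulKf _)) hh.
have z0 : zeta != 0 by rewrite -modulus_eq0 z1 oner_eq0.
have := hh z0; rewrite mulVf // => /(congr1 Im) /= h2.
by have := @sin_gt0_pi _ s; rewrite s0 sp h2 ltxx => /(_ isT).
Unshelve. all: by end_near. Qed.

(* Along [zeta cis s] the factor [z - zeta] changes sign with [s] up to a
   continuous unimodular factor, so the cofactor must vanish at [zeta]. *)
Lemma circle_root_double P P1 (zeta : C) (k : nat) : modulus zeta = 1 ->
  circle_nonneg P k -> P = ('X - zeta%:P) * P1 -> root P1 zeta.
Proof.
move=> z1 hP PE; have z0 : zeta != 0 by rewrite -modulus_eq0 z1 oner_eq0.
pose W (s : R) : C := P1.[zeta * cis s] * (zeta * cis s) ^- k * (zeta * (Complex 0 2 * cis (2^-1 * s))).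
have cW : W s @[s --> (0 : R)] --> W 0.
  apply: (@continuousM _ _ (fun s => P1.[zeta * cis s] * (zeta * cis s) ^- k)
     (fun s => zeta * (Complex 0 2 * cis (2^-1 * s)))); first exact: circle_path_cvg.
  apply: contZ; apply: contZ => s.
  apply: (@continuous_comp _ _ _ (fun s : R => 2^-1 * s) (@cis R)); last exact: continuous_cis.
  by apply: cvgM; [exact: cvg_cst|exact: cvg_id].
have WE s : P.[zeta * cis s] / (zeta * cis s) ^+ k = W s * ofR (sin (s / 2)).
  rewrite PE hornerM hornerXsubC /W -{2}[zeta]mulr1 -mulrBr cis_sub1.
  have -> : Complex 0 1 * ofR (2 * sin (s / 2)) = Complex 0 2 * ofR (sin (s / 2)) :> C.
    by apply: Cext; rewrite ?ReM ?ImM /=; ring.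
  rewrite [2^-1 * s]mulrC; ring.
have Wpos s : nonneg_real (W s * ofR (sin (s / 2))).
  rewrite -WE; have [u1 uk] := circle_path_unit s k z1.
  by apply/(nonneg_realP _ uk); exact: hP.
have W0 : W 0 = 0.
  have h1 : nonneg_real (W 0).
    apply: nonneg_real_closed (cvg_at_right_filter cW) _; near=> s.
    have s0 : 0 < s by near: s; exact: nbhs_right_gt.
    have sp : s < pi by near: s; apply: nbhs_right_lt; exact: pi_gt0.
    have sn : 0 < sin (s / 2) by apply: sin_gt0_pi; apply/andP; split; lra.
    have [] := Wpos s; rewrite ReM ImM /= !mulr0 subr0 add0r => h2 /eqP.
    by rewrite mulf_eq0 (gt_eqF sn) orbF => /eqP h3; split; rewrite // -(pmulr_lge0 _ sn).
  have h2 : nonneg_real (- W 0).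
    have cN : - W s @[s --> (0 : R)] --> - W 0 by exact: cvgN.
    apply: nonneg_real_closed (cvg_at_left_filter cN) _; near=> s.
    have s0 : s < 0 by near: s; exact: nbhs_left_lt.
    have sp : - pi < s by near: s; apply: nbhs_left_gt; rewrite oppr_lt0; exact: pi_gt0.
    have sn : 0 < sin (- s / 2) by apply: sin_gt0_pi; apply/andP; split; lra.
    have [] := Wpos s; rewrite ReM ImM /= !mulr0 subr0 add0r.
    rewrite -[s / 2]opprK -mulNr sinN !mulrN => h3 /eqP.
    rewrite oppr_eq0 mulf_eq0 (gt_eqF sn) orbF => /eqP h4; split; rewrite ?ReN ?ImN ?h4 ?oppr0 //.
    by rewrite -(pmulr_lge0 _ sn) mulNr.
  move: h1 h2 => [a1 a2] [a3 a4]; apply: Cext => //=; rewrite ReN in a3.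
  by apply/eqP; rewrite eq_le a1 andbT -oppr_ge0.
apply/rootP; move/eqP: W0; rewrite /W cis0 !mulr1 !mulr0 cis0 mulr1 !mulf_eq0.
rewrite invr_eq0 expf_eq0 (negPf z0) andbF !orbF => /orP[/eqP//|].
by rewrite eq_complex /= pnatr_eq0 andbF.
Unshelve. all: by end_near. Qed.

(** On the circle the removed pair [- (lam - z) (1 - cconj lam z)] equals [z |lam - z|^2]; the
    factor [z] accounts for the drop from [k.+1] to [k]. *)
Lemma circle_quotient (z lam p p2 : C) (x : R) (k : nat) : modulus z = 1 -> z != lam ->
  0 <= x -> p = ofR x * z ^+ k.+1 -> p = - (lam - z) * (1 - cconj lam * z) * p2 ->
  exists2 y : R, 0 <= y & p2 = ofR y * z ^+ k.
Proof.
move=> z1 zl x0 hx hp; have z0 : z != 0 by rewrite -modulus_eq0 z1 oner_eq0.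
have d0 : lam - z != 0 by rewrite subr_eq0 eq_sym.
have m0 : modulus (lam - z) ^+ 2 != 0 by rewrite expf_neq0 // modulus_eq0.
exists (x / modulus (lam - z) ^+ 2); first by rewrite divr_ge0 // sqr_ge0.
have E : - (lam - z) * (1 - cconj lam * z) = z * ofR (modulus (lam - z) ^+ 2).
  by rewrite mulNr circle_factor_identity // mul_cconj mulNr opprK.
have ED : ofR (modulus (lam - z) ^+ 2) != 0 :> C by rewrite -ofR0 (inj_eq (@ofR_inj R)).
apply: (mulfI (mulf_neq0 z0 ED)); rewrite -E -hp hx E.
rewrite ofRM ofRV exprS; rewrite [RHS]mulrAC; move: (ofR _) ED => D D0; field; exact: D0.
Qed.

(** Induction on [k]: each step removes a root together with its reflection in the circle, and calls
    [lam] the one in the closed disc. The reflection of the root 0 is a missing top coefficient; a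
    root on the circle is its own reflection and has to be double. *)
Lemma fejer_riesz (k : nat) P : (size P <= (k + k).+1)%N -> circle_nonneg P k ->
  exists (c : C) (lambda : 'I_k -> C), (forall j, modulus (lambda j) <= 1) /\
    forall z, P.[z] = c * \prod_(j < k) ((lambda j - z) * (1 - cconj (lambda j) * z)).
Proof.
elim: k P => [|k ih] P sP hP.
  exists P`_0, (fun=> 0); split=> [[]//|z]; rewrite big_ord0 mulr1.
  by rewrite {1}(size1_polyC sP) hornerC.
suff [lam [P2 [l1 sP2 PE]]] : exists lam P2, [/\ modulus lam <= 1,
    (size P2 <= (k + k).+1)%N &
    forall z, P.[z] = - (lam - z) * (1 - cconj lam * z) * P2.[z]].
  have hP2 : circle_nonneg P2 k.
    have [lam1|lam1] := eqVneq (modulus lam) 1; last first.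
      move=> z z1; have [x x0 hx] := hP z z1.
      by apply: (circle_quotient z1 _ x0 hx (PE z)); apply: contra_neq lam1 => <-.
    apply: (circle_nonneg_extend lam1) => z z1 zl; have [x x0 hx] := hP z z1.
    exact: (circle_quotient z1 zl x0 hx (PE z)).
  have [c [lambda [hl hc]]] := ih P2 sP2 hP2.
  exists (- c), (fun j => oapp lambda lam (unlift ord0 j)); split.
    by move=> j; case: unliftP => [j' _|_] /=; [exact: hl|exact: l1].
  move=> z; rewrite big_ord_recl unlift_none /= PE hc.
  under [in RHS]eq_bigr do rewrite liftK /=.
  by ring.
have [rec rec0] := circle_nonneg_reciprocal sP hP.
(* A root at 0 lowers the degree bound by two: the division takes one, and the top coefficient,
   conjugate to the bottom one, vanishes. *)
have [P0|P0] := eqVneq P`_0 0.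
  have /factor_theorem[P1 PE] : root P 0 by apply/rootP; rewrite horner_coef0.
  exists 0, P1; split; first by rewrite modulus0.
  - rewrite polyC0 subr0 in PE.
    have -> : P1 = \poly_(i < (k + k).+1) P1`_i; last exact: size_poly.
    apply/polyP => i; rewrite coef_poly; case: ltnP => // hi.
    have -> : P1`_i = P`_i.+1 by rewrite PE coefMX.
    have [->|ne] := eqVneq i.+1 (k.+1 + k.+1)%N; first by rewrite rec0 P0 (cconj_ofR 0).
    apply/nth_default/(leq_trans sP); rewrite ltn_neqAle eq_sym ne /=.
    by rewrite addSn addnS !ltnS.
  - move=> z; rewrite PE hornerM hornerXsubC (cconj_ofR 0); ring.
have sPE : size P = (k.+1 + k.+1).+1.
  apply/eqP; rewrite eqn_leq sP ltnNge; apply/negP => h.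
  by move/eqP: (nth_default 0 h); rewrite rec0 -modulus_eq0 modulus_cconj modulus_eq0 (negPf P0).
have [zeta rz] : exists z, root P z by apply: poly_rootC; rewrite sPE addSn.
have z0 : zeta != 0.
  by apply: contraNneq P0 => h; rewrite -horner_coef0 -[X in P.[X]]h; exact: rz.
pose eta := (cconj zeta)^-1.
have cz0 : cconj zeta != 0 by rewrite -modulus_eq0 modulus_cconj modulus_eq0.
have e0 : eta != 0 by rewrite invr_eq0.
have ez : (cconj eta)^-1 = zeta.
  apply: (mulIf (x := cconj eta)); first by rewrite -modulus_eq0 modulus_cconj modulus_eq0.
  rewrite mulVf -?modulus_eq0 ?modulus_cconj ?modulus_eq0 //.
  by rewrite -{1}(cconjK zeta) -cconjM /eta mulfV // (cconj_ofR 1).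
have re : root P eta.
  apply/rootP; rewrite rec // ez; move/rootP: rz => ->.
  by rewrite (cconj_ofR 0) mulr0.
have [P2 P2E] : exists P2, P = P2 * ('X - eta%:P) * ('X - zeta%:P).
  have /factor_theorem[P1 PE] := rz.
  suff /factor_theorem[P2 P1E] : root P1 eta by exists P2; rewrite -P1E.
  (* Equality means [modulus zeta = 1], where divisibility by the square comes from positivity. *)
  have [ee|ne] := eqVneq eta zeta.
    rewrite ee; apply: (@circle_root_double P _ _ k.+1) => //; last by rewrite mulrC.
    have m0 : modulus zeta != 0 by rewrite modulus_eq0.
    have := congr1 (@modulus R) ee; rewrite modulusV modulus_cconj => hm.
    have m2 : modulus zeta * modulus zeta = 1 by rewrite -{1}hm mulVf.
    have := modulus_ge0 zeta => mz.
    have : (modulus zeta - 1) * (modulus zeta + 1) = 0 by rewrite mulrDr mulrBl m2 !mulr1 mul1r; ring.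
    by move=> /eqP; rewrite mulf_eq0 => /orP[]/eqP; lra.
  move/rootP: re; rewrite PE hornerM hornerXsubC => /eqP; rewrite mulf_eq0.
  by rewrite subr_eq0 (negPf ne) orbF => /eqP/rootP.
have P20 : P2 != 0.
  by apply/eqP => h; move: sPE; rewrite P2E h !mul0r size_poly0.
have sP2 : size P2 = (k + k).+1.
  have := sPE; rewrite P2E size_Mmonic ?monicXsubC ?mulf_neq0 ?polyXsubC_eq0 //.
  by rewrite size_XsubC addn2 /= size_Mmonic ?monicXsubC // size_XsubC addn2 /= addSn addnS => -[].
have fin lam : modulus lam <= 1 -> lam != 0 ->
    P = P2 * ('X - ((cconj lam)^-1)%:P) * ('X - lam%:P) ->
    exists lam P2, [/\ modulus lam <= 1, (size P2 <= (k + k).+1)%N &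
    forall z, P.[z] = - (lam - z) * (1 - cconj lam * z) * P2.[z]].
  move=> l1 l0 PE; exists lam, (- (cconj lam)^-1 *: P2); split=> //.
    by apply: leq_trans (size_scale_leq _ _) _; rewrite sP2.
  move=> z; rewrite PE !hornerM !hornerXsubC hornerZ.
  have cl0 : cconj lam != 0 by rewrite -modulus_eq0 modulus_cconj modulus_eq0.
  by field.
have [zl|zl] := leP (modulus zeta) 1; first exact: fin P2E.
apply: (fin eta) => //.
  by rewrite modulusV modulus_cconj invf_le1 ?ltW // (lt_trans _ zl).
by rewrite ez {1}P2E mulrAC.
Qed.
End FejerRiesz.

(** * Principal powers *)

Section ComplexPower.
Variable R : realType.
Local Notation C := (Cplx R).
Local Notation Re := (@complex.Re R).
Local Notation Im := (@complex.Im R).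
Implicit Types (z w : C) (s : R).

Lemma Re_unit_bound z : z != 0 -> -1 <= Re z / modulus z <= 1.
Proof.
rewrite -modulus_gt0 => m0; rewrite -ler_norml normrM normfV [`|modulus z|]ger0_norm ?(ltW m0) //.
by rewrite ler_pdivrMr // mul1r normRe_le.
Qed.

Lemma sqr_unit z : z != 0 -> 1 - (Re z / modulus z) ^+ 2 = (Im z / modulus z) ^+ 2.
Proof.
move=> z0; have m0 : modulus z != 0 by rewrite modulus_eq0.
have h := sqr_modulus z; rewrite !expr_div_n.
apply: (mulIf (x := modulus z ^+ 2)); first by rewrite expf_neq0.
by rewrite mulrBl !divfK ?expf_neq0 // mul1r h addrC addKr.
Qed.

Lemma cis_Arg z : z != 0 -> cis (Arg z) = z / ofR (modulus z).
Proof.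
move=> z0; have m0 : 0 < modulus z by rewrite modulus_gt0.
have hb := Re_unit_bound z0.
have hb' : Re z / modulus z \in `[(-1), 1] by rewrite in_itv.
have -> : z / ofR (modulus z) = Complex (Re z / modulus z) (Im z / modulus z).
  by rewrite -ofRV; apply: Cext; rewrite ?ReM ?ImM /=; ring.
rewrite /Arg; case: ifPn => [i0|]; last rewrite -ltNge => i0.
  rewrite /cis (acosK hb') sin_acos // sqr_unit // sqrtr_sqr ger0_norm //.
  by rewrite divr_ge0 // ltW.
rewrite /cis cosN sinN (acosK hb') sin_acos // sqr_unit // sqrtr_sqr ltr0_norm ?opprK //.
by rewrite pmulr_llt0 // invr_gt0.
Qed.

Definition clog z : C := Complex (ln (modulus z)) (Arg z).

Lemma cexp_clog z : z != 0 -> cexp (clog z) = z.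
Proof.
move=> z0; have m0 : modulus z != 0 by rewrite modulus_eq0.
rewrite /cexp /= lnK ?posrE ?modulus_gt0 // cis_Arg // mulrC divfK //.
by rewrite -ofR0 (inj_eq (@ofR_inj R)).
Qed.

Lemma cpowE z s : z != 0 -> cpow z s = cexp (ofR s * clog z).
Proof.
move=> z0; rewrite /cpow /cexp ReM ImM /= !mul0r subr0 addr0; congr (ofR _ * _).
by rewrite /powR modulus_eq0 (negPf z0).
Qed.

Lemma cpowD z s s' : z != 0 -> cpow z (s + s') = cpow z s * cpow z s'.
Proof. by move=> z0; rewrite !cpowE // ofRD mulrDl cexpD. Qed.
Lemma cpow_1 z : z != 0 -> cpow z 1 = z.
Proof. by move=> z0; rewrite cpowE // ofR1 mul1r cexp_clog. Qed.
Lemma cpow_2 z : z != 0 -> cpow z 2 = z ^+ 2.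
Proof. by move=> z0; rewrite -[2]/(1 + 1) cpowD // cpow_1. Qed.
Lemma modulus_cpow z s : modulus (cpow z s) = modulus z `^ s.
Proof. by rewrite modulusM modulus_cis mulr1 modulus_ofR ger0_norm // powR_ge0. Qed.
Lemma cpow_neq0 z s : z != 0 -> cpow z s != 0.
Proof. by move=> z0; rewrite cpowE // cexp_neq0. Qed.
Lemma cpow1 s : cpow 1 s = 1 :> C.
Proof.
rewrite /cpow modulus1 powR1 ofR1 mul1r /Arg modulus1 divr1 /= lexx acos1 mulr0.
exact: cis0.
Qed.

(** The definition of [Arg] splits at the real axis; on the right half-plane, which contains every
    [1 + a w] in use, [asin] gives a single continuous formula. *)
Lemma Arg_asin z : 0 < Re z -> Arg z = asin (Im z / modulus z).
Proof.
move=> r0; have z0 : z != 0 by apply: contraTneq r0 => ->; rewrite ltxx.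
have m0 : 0 < modulus z by rewrite modulus_gt0.
have hb := Re_unit_bound z0.
have hb' : Re z / modulus z \in `[(-1), 1] by rewrite in_itv.
have [a0 ap] : 0 <= acos (Re z / modulus z) /\ acos (Re z / modulus z) <= pi / 2.
  split; first exact: acos_ge0.
  rewrite leNgt; apply/negP => h.
  have := acos_lepi hb => h2.
  have : cos (acos (Re z / modulus z)) < cos (pi / 2).
    by rewrite ltr_cos ?in_itv /= ?acos_ge0 ?acos_lepi //; have := pi_gt0 R; lra.
  by rewrite (acosK hb') cos_pihalf ltNge divr_ge0 ?(ltW r0) ?(ltW m0).
have sE : sin (Arg z) = Im z / modulus z.
  have := congr1 Im (cis_Arg z0); rewrite /= => ->.
  by rewrite -ofRV ImM /=; ring.
transitivity (asin (sin (Arg z))); last by congr asin; exact: sE.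
rewrite sinK // in_itv /= /Arg; have := pi_gt0 R.
by case: ifP => _; move=> pp; apply/andP; split; lra.
Qed.

Lemma clog_continuous z : 0 < Re z -> {for z, continuous clog}.
Proof.
move=> r0; have z0 : z != 0 by apply: contraTneq r0 => ->; rewrite ltxx.
have m0 : 0 < modulus z by rewrite modulus_gt0.
have h1 : {for z, continuous (fun w => ln (modulus w))}.
  apply: (@continuous_comp _ _ _ (@modulus R) (@ln R)); first exact: continuous_modulus.
  exact: continuous_ln.
apply: (@cvg_pair _ _ (nbhs z) _ clog (clog z)); first exact: h1.
have h : {for z, continuous (fun w => asin (Im w / modulus w))}.
  apply: (@continuous_comp _ _ _ (fun w => Im w / modulus w) (@asin R)).
    apply: (@continuousM _ _ (Im : C -> R) (fun w => (modulus w)^-1)); first exact: continuous_Im.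
    have mn : modulus z != 0 by rewrite modulus_eq0.
    exact: (cvgV mn (@continuous_modulus R z)).
  apply: continuous_asin; rewrite -ltr_norml -(@ltr_pXn2r _ 2) ?nnegrE //.
  rewrite real_normK ?num_real // -sqr_unit // expr1n ltrBlDr ltrDl.
  by rewrite exprn_gt0 // divr_gt0.
rewrite /= Arg_asin //; apply: cvg_trans h; apply: near_eq_cvg.
have : \forall w \near z, 0 < Re w by exact: (cvgr_gt _ (@continuous_Re R z)).
by apply: filterS => w w0; rewrite /= Arg_asin.
Qed.

(** An inverse function argument: for [d = clog w - clog z] one has [w - z = z (cexp d - 1)].
    Continuity of [clog] makes [d] small, and [cder_cexp0] compares [d] with [cexp d - 1]. *)
Lemma derivable_clog z : 0 < Re z -> derivable clog z 1.
Proof.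
move=> r0; have z0 : z != 0 by apply: contraTneq r0 => ->; rewrite ltxx.
have m0 : 0 < modulus z by rewrite modulus_gt0.
suff : cder clog z z^-1 by move=> /cder_is_derive[].
move=> e e0.
(* The bound [1 / 2] yields [|d| <= 2 |cexp d - 1|]; the other then turns [e' |d|] into at most
   [e |w - z|], up to the factor [modulus z^-1] contained in [cexp d - 1]. *)
pose e' := Num.min (1 / 2) (e * modulus z / 2).
have e'0 : 0 < e' by rewrite lt_min !divr_gt0 // mulr_gt0.
have e1 : e' <= 1 / 2 by rewrite ge_min lexx.
have e2 : e' <= e * modulus z / 2 by rewrite ge_min lexx orbT.
have [d1 d10 h1] := @cder_cexp0 R e' e'0.
have cl := clog_continuous r0.
have := cl.
move=> /(@cvg_modulus _ _ (nbhs z) _ clog (clog z)) /(_ d1 d10) /nbhs_modulus[d2 d20 h2].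
have rn : \forall w \near z, 0 < Re w by exact: (cvgr_gt _ (@continuous_Re R z)).
move: rn => /nbhs_modulus[d3 d30 h3].
exists (Num.min d2 d3); first by rewrite lt_min d20.
move=> w; rewrite lt_min => /andP[w2 w3].
have w0 : w != 0 by apply: contraTneq (h3 w w3) => ->; rewrite ltxx.
pose d := clog w - clog z.
have hd : modulus d < d1 by exact: h2.
have := h1 d; rewrite subr0 => /(_ hd); rewrite cexp0 mul1r => H.
have wz : w - z = z * (cexp d - 1).
  have dz : clog w = clog z + d by rewrite /d addrC subrK.
  rewrite mulrBr mulr1; congr (_ - _).
  by rewrite -[LHS](cexp_clog w0) dz cexpD (cexp_clog z0).
have E : clog w - clog z - z^-1 * (w - z) = - (cexp d - 1 - d).
  by rewrite wz mulKf // -/d; ring.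
rewrite E modulusN; apply: (le_trans H).
have h4 : modulus d <= 2 * modulus (cexp d - 1).
  have := modulusB (cexp d - 1) (cexp d - 1 - d); rewrite opprB addrC subrK => h5.
  have h6 : e' * modulus d <= 1 / 2 * modulus d by rewrite ler_wpM2r ?modulus_ge0.
  by lra.
have -> : modulus (w - z) = modulus z * modulus (cexp d - 1) by rewrite wz modulusM.
apply: (@le_trans _ _ (e' * (2 * modulus (cexp d - 1)))); first by rewrite ler_wpM2l // ltW.
rewrite !mulrA ler_wpM2r ?modulus_ge0 //; lra.
Qed.

Lemma derivable_cpow z s : 0 < Re z -> derivable (fun w => cpow w s) z 1.
Proof.
move=> r0.
have rn : \forall w \near z, 0 < Re w by exact: (cvgr_gt _ (@continuous_Re R z)).
apply: (@near_eq_derivable _ _ _ (fun w => cexp (ofR s * clog w))).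
  apply: filterS rn => w w0; rewrite cpowE //.
  by apply: contraTneq w0 => ->; rewrite ltxx.
apply: derivable_compC; last exact: derivable_cexp.
by apply: derivable_MC; [exact: derivable_cstC|exact: derivable_clog].
Qed.
End ComplexPower.

(** * Hardy norms *)

Section HardyMeans.
Variable R : realType.
Local Notation C := (Cplx R).
Local Notation Re := (@complex.Re R).
Local Notation Im := (@complex.Im R).
Implicit Types (f g : C -> C) (z w : C) (r q t : R).

Definition qmean q f r := mean (fun t => modulus (f (pt r t)) `^ q).

Lemma powR_continuous_nonneg (q : R) (T : topologicalType) (m : T -> R) (x : T) : 1 <= q ->
  (forall y, 0 <= m y) -> {for x, continuous m} -> {for x, continuous (fun y => m y `^ q)}.
Proof.
move=> q1 m0 cm; have [mx|mx] := eqVneq (m x) 0; last first.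
  have mp : 0 < m x by rewrite lt_def mx m0.
  apply: (@continuous_comp _ _ _ m (fun y => y `^ q)); first exact: cm.
  have [dq _] := is_derive1_powR q mp.
  by move/derivable1_diffP: dq => /differentiable_continuous.
have q0 : q != 0 by rewrite gt_eqF //; lra.
apply/cvgrPdist_lt => e e0.
(* Where [m] vanishes, continuity follows from [u ^ q <= u] for [0 <= u <= 1]. *)
have d0 : 0 < Num.min 1 e by rewrite lt_min ltr01.
move/cvgrPdist_lt : cm => /(_ _ d0); apply: filterS => y.
rewrite mx powR0 // !sub0r !normrN !ger0_norm ?powR_ge0 //.
rewrite lt_min => /andP[y1 ye]; apply: le_lt_trans ye.
have [->|y0] := eqVneq (m y) 0; first by rewrite powR0.
apply: ge1r_powR; last exact: q1.
apply/andP; split; first by rewrite lt_def y0 m0.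
exact: ltW.
Qed.

Lemma contpow q (F : R -> C) : 1 <= q -> continuous F -> continuous (fun t => modulus (F t) `^ q).
Proof.
move=> q1 cF t; apply: (@powR_continuous_nonneg q _ (fun t => modulus (F t)) t q1).
  by move=> y; exact: modulus_ge0.
exact: contmod.
Qed.

Lemma circle_meanE q f r : 1 <= q -> continuous (fun t => f (pt r t)) ->
  circle_mean q f r = (qmean q f r)%:E.
Proof.
move=> q1 cf; have cp := contpow q1 cf.
have int := cont_on_integrable (continuous_cont_on cp : cont_on _ 0 (2 * pi)).
rewrite /circle_mean /qmean /mean EFinM; congr (_ * _)%E.
by rewrite /rint /Rintegral fineK //; exact: integrable_fin_num.
Qed.

Lemma qmean_ge0 q f r : 1 <= q -> continuous (fun t => f (pt r t)) -> 0 <= qmean q f r.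
Proof. by move=> q1 cf; apply: mean_ge0; [exact: contpow|move=> t; exact: powR_ge0]. Qed.

Lemma circle_mean_near q f : 1 <= q -> analytic_in_disc f ->
  \forall r \near (1 : R)^'-, circle_mean q f r = (qmean q f r)%:E /\ 0 <= qmean q f r.
Proof.
move=> q1 af; apply: filterS (near_left1 ltr01) => r /andP[r0 r1].
have cf := continuous_circle_disc af (ltW r0) r1.
by rewrite circle_meanE // qmean_ge0.
Qed.

(** Turns the extended-real norm into a real limit. A limit [+oo] is excluded because its power with
    the nonzero exponent [q^-1] is [+oo]. *)
Lemma admissible_qmean q t f : 1 <= q -> admissible q%:E t f ->
  exists2 l : R, l <= 1 & qmean q f r @[r --> (1 : R)^'-] --> l.
Proof.
move=> q1 [[af cv _] nf _]; rewrite /= in cv.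
have q0 : q^-1 != 0 by rewrite invr_eq0 gt_eqF //; lra.
have qp : 0 < q^-1 by rewrite invr_gt0; lra.
have [L hL] := proj1 (cvg_ex _) cv.
have EL : lim (circle_mean q f r @[r --> (1 : R)^'-]) = L by exact: cvg_lim.
have nE := circle_mean_near q1 af.
have L0 : (0 <= L)%E.
  apply: (cvge_to_ge hL); apply: filterS nE => r [-> h]; by rewrite lee_fin.
move: nf; rewrite /Hnorm EL => nf.
case: L hL L0 EL nf => [l| |] // hL L0 EL nf; last first.
  by move: nf; rewrite poweRE (negPf q0) eqxx.
exists l.
  move: nf; rewrite poweR_EFin lee_fin => nf; rewrite leNgt; apply/negP => l1.
  have := @gt0_ltr_powR _ _ qp 1 l; rewrite !nnegrE ler01 -lee_fin L0 => /(_ isT isT l1).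
  by rewrite powR1 ltNge nf.
apply: cvg_trans (fine_cvg hL); apply: near_eq_cvg.
by apply: filterS nE => r [/= -> _].
Qed.

Lemma Hnorm_of_qmean q f l : 1 <= q -> analytic_in_disc f ->
  qmean q f r @[r --> (1 : R)^'-] --> l ->
  [/\ 0 <= l, Hardy q%:E f & Hnorm q%:E f = (l `^ q^-1)%:E].
Proof.
move=> q1 af hl; have nE := circle_mean_near q1 af.
have hL : circle_mean q f r @[r --> (1 : R)^'-] --> l%:E.
  apply: cvg_EFin; first by apply: filterS nE => r [-> _].
  apply: cvg_trans hl; apply: near_eq_cvg.
  by apply: filterS nE => r [/= -> _].
have l0 : 0 <= l.
  apply: (@ler_cvg_to _ (1 : R)^'- _ _ (fun=> 0) _ 0 _ _ hl); first exact: cvg_cst.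
  by apply: filterS nE => r [].
have EL : lim (circle_mean q f r @[r --> (1 : R)^'-]) = l%:E by exact: cvg_lim.
have HE : Hnorm q%:E f = (l `^ q^-1)%:E by rewrite /Hnorm EL poweR_EFin.
split=> //; split=> //; first by apply/cvg_ex; exists l%:E.
by rewrite HE ltry.
Qed.

Lemma admissible_of_qmean q t f l : 1 <= q -> analytic_in_disc f -> f 0 = ofR t ->
  qmean q f r @[r --> (1 : R)^'-] --> l -> l <= 1 -> admissible q%:E t f.
Proof.
move=> q1 af f0 hl l1; have [l0 Hf HE] := Hnorm_of_qmean q1 af hl.
split=> //; rewrite HE lee_fin.
have qp : 0 <= q^-1 by rewrite invr_ge0; lra.
have := @ge0_ler_powR _ _ qp l 1; rewrite !nnegrE ler01 l0 => /(_ isT isT l1).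
by rewrite powR1.
Qed.

Lemma qmean1 f r : qmean 1 f r = mean (fun t => modulus (f (pt r t))).
Proof. by apply: eq_mean => t; rewrite powRr1 // modulus_ge0. Qed.

Lemma admissible_l1_means t f : admissible 1%:E t f -> l1_means f.
Proof.
move=> /(admissible_qmean (lexx 1))[l l1 hl] e e0.
have : \forall r \near (1 : R)^'-, qmean 1 f r < l + e.
  by apply: (cvgr_lt _ hl); rewrite ltrDl.
by apply: filterS => r; rewrite qmean1; lra.
Qed.

Lemma admissible_analytic (p : \bar R) t f : admissible p t f -> analytic_in_disc f.
Proof. by case=> -[]. Qed.

Lemma inv_exponent_lt1 (p : \bar R) : (1 < p)%E -> 0 <= inv_exponent p < 1.
Proof.
case: p => [q| |] //= p1; last by rewrite lexx ltr01.
rewrite lte_fin in p1.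
by rewrite invr_ge0 invf_lt1 ?p1 ?andbT; lra.
Qed.

(** For finite [p] this is Young's inequality under the mean, with [qmean] eventually below [1 + e];
    at [p = +oo] it is the bound [|f| <= 1]. *)
Lemma admissible_young (p : \bar R) t f : (1 < p)%E -> admissible p t f ->
  young_means f (inv_exponent p).
Proof.
case: p => [q| |] // p1 adm e e0; have af := admissible_analytic adm.
  rewrite lte_fin in p1; rewrite /inv_exponent.
  have q0 : 0 < q by lra.
  have qi0 : 0 < q^-1 by rewrite invr_gt0.
  have qi1 : q^-1 < 1 by rewrite invf_lt1.
  have s0 : 0 < 1 - q^-1 by lra.
  have [l l1 hl] := admissible_qmean (ltW p1) adm.
  have hl' : \forall r \near (1 : R)^'-, qmean q f r < l + e.
    by apply: (cvgr_lt _ hl); rewrite ltrDl.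
  apply: filterS2 hl' (near_left1 ltr01) => r hr /andP[r0 r1] b B cb cB b0 bB.
  have cf := continuous_circle_disc af (ltW r0) r1.
  have cp := contpow (ltW p1) cf.
  apply: (@le_trans _ _ (q^-1 * qmean q f r + (1 - q^-1) * mean B)).
    rewrite /qmean -(meanZ _ cp) -(meanZ _ cB) -meanD; first last.
    - by apply: contMr; [exact: contcstr|exact: cB].
    - by apply: contMr; [exact: contcstr|exact: cp].
    apply: le_mean.
    - by apply: contMr; [exact: contmod|exact: cb].
    - by apply: contDr; (apply: contMr; first exact: contcstr).
    move=> u; have s0' : 0 < (1 - q^-1)^-1 by rewrite invr_gt0.
    have := @conjugate_powR _ _ _ q (1 - q^-1)^-1 (modulus_ge0 (f (pt r u))) (b0 u) q0 s0'.
    rewrite invrK subrKC => /(_ erefl) h; apply: (le_trans h).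
    rewrite mulrC lerD2l mulrC ler_wpM2l ?(ltW s0) //.
  rewrite lerD2r; apply: (@le_trans _ _ (q^-1 * (l + e))); first by rewrite ler_wpM2l ?(ltW qi0) // ltW.
  rewrite mulrDr; have : q^-1 * l <= q^-1 * 1 by rewrite ler_wpM2l ?(ltW qi0).
  have : q^-1 * e <= 1 * e by rewrite ler_wpM2r ?(ltW e0) // ltW.
  by lra.
have f1 z : disc z -> modulus (f z) <= 1.
  case: adm => _ nf _ dz; rewrite -lee_fin; apply: le_trans nf.
  by apply: ereal_sup_ubound; exists z.
apply: filterS (near_left1 ltr01) => r /andP[r0 r1] b B cb cB b0 bB.
have cf := continuous_circle_disc af (ltW r0) r1.
rewrite /inv_exponent add0r subr0 mul1r.
apply: (@le_trans _ _ (mean B)); last by rewrite lerDr ltW.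
apply: le_mean; [by apply: contMr; [exact: contmod|exact: cb]|exact: cB|].
move=> u; have := bB u; rewrite /inv_exponent subr0 invr1 powRr1 //; apply: le_trans.
rewrite ler_piMl // f1 //; apply: disc_pt; apply/andP; split; lra.
Qed.

Lemma Re_coefE (k : nat) f : analytic_in_disc f -> Re_coef k f = Re (coef f k).
Proof. by move=> af; rewrite /Re_coef coef_derive1n. Qed.

(* Fixing [f 0 = t], an affine functional of the [k]-th coefficient serves in
   place of it; at [h0 = 0] every admissible [f] attains the bound. *)
Lemma unique_extremal_of_functional (k : nat) (p : \bar R) t (g : C -> C) (h0 h1 : R) :
  admissible p t g -> 0 <= h0 ->
  (forall f, admissible p t f ->
     h0 * Re_coef k f + h1 <= h0 * Re_coef k g + h1 /\
     (h0 * Re_coef k f + h1 = h0 * Re_coef k g + h1 -> forall z, disc z -> f z = g z)) ->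
  unique_extremal k p t g.
Proof.
move=> ag h00 H.
have le f : admissible p t f -> Re_coef k f <= Re_coef k g.
  move=> adf; have [h2 h3] := H f adf.
  have [h0z|h0n] := eqVneq h0 0.
    have fg : forall z, disc z -> f z = g z by apply: h3; rewrite h0z !mul0r.
    rewrite (Re_coefE k (admissible_analytic ag)) (Re_coefE k (admissible_analytic adf)).
    by rewrite (coef_ext _ fg).
  have hp : 0 < h0 by rewrite lt_def h0n.
  by move: h2; rewrite lerD2r ler_pM2l.
have PE : Phi k p t = (Re_coef k g)%:E.
  apply/eqP; rewrite eq_le; apply/andP; split.
    by apply: ge_ereal_sup => _ [f adf <-]; rewrite lee_fin le.
  by apply: ereal_sup_ubound; exists g.
split; first by split.
move=> f [adf]; rewrite PE => -[fE].
by apply: (H f adf).2; rewrite fE.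
Qed.
End HardyMeans.

(** * The case p = 1 *)

Section ExponentOne.
Variable R : realType.
Local Notation C := (Cplx R).
Local Notation Re := (@complex.Re R).
Local Notation Im := (@complex.Im R).
Implicit Types (f g : C -> C) (z w : C) (r t : R) (P : {poly C}).

Lemma mean_le0_eq0 (g : R -> R) : continuous g -> (forall t, 0 <= g t) -> mean g <= 0 ->
  forall t, 0 <= t <= 2 * pi -> g t = 0.
Proof.
move=> cg g0 mg t /andP[t0 t1]; apply/eqP; rewrite eq_le g0 andbT leNgt; apply/negP => gt0.
have : \forall s \near t, g t / 2 < g s.
  by apply: (cvgr_gt _ (cg t)); rewrite ltr_pdivrMr //; lra.
move=> /nbhs_ballP[d /= d0 hd].
(* The neighbourhood is clipped to [[0, 2 pi]] and keeps positive length even when [t] is an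
   endpoint. *)
pose a := Num.max 0 (t - d / 2); pose b := Num.min (2 * pi) (t + d / 2).
have pi0 := pi_gt0 R.
have a0 : 0 <= a by rewrite le_max lexx.
have b1 : b <= 2 * pi by rewrite ge_min lexx.
have ab : a < b by rewrite gt_max !lt_min; apply/andP; split; apply/andP; split; lra.
have at' : t - d / 2 <= a by rewrite le_max lexx orbT.
have bt : b <= t + d / 2 by rewrite ge_min lexx orbT.
have cc a' b' : cont_on g a' b' by exact: continuous_cont_on.
have h1 : rint g a b >= g t / 2 * (b - a).
  rewrite -(rint_cst _ (ltW ab)); apply: le_rint; [|exact: cc|].
    by move=> x _; exact: cst_continuous.
  move=> x /andP[x1 x2]; apply/ltW/hd; rewrite /ball /= ltr_norml; apply/andP; split; lra.
have nn a' b' : a' <= b' -> 0 <= rint g a' b'.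
  move=> ab'; rewrite -(mul0r (b' - a')) -(rint_cst _ ab'); apply: le_rint; [|exact: cc|].
    by move=> x _; exact: cst_continuous.
  by move=> x _; exact: g0.
have h2 : rint g 0 (2 * pi) = rint g 0 a + (rint g a b + rint g b (2 * pi)).
  rewrite (@rint_split _ _ 0 (2 * pi) a) //; last by lra.
  by rewrite (@rint_split _ _ a (2 * pi) b) //; exact: ltW.
have h3 : 0 < rint g 0 (2 * pi).
  rewrite h2; have := nn 0 a a0; have := nn b (2 * pi) b1.
  have : 0 < g t / 2 * (b - a) by rewrite mulr_gt0 ?divr_gt0 ?subr_gt0.
  by lra.
by move: mg; rewrite leNgt mulr_gt0 // invr_gt0; lra.
Qed.

Lemma cis_surj z : modulus z = 1 -> exists2 t : R, 0 <= t <= 2 * pi & z = cis t.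
Proof.
move=> z1; have r1 : -1 <= Re z <= 1 by rewrite -ler_norml -z1 normRe_le.
have r1' : Re z \in `[(-1), 1] by rewrite in_itv.
have s2 : 1 - Re z ^+ 2 = Im z ^+ 2.
  by have := sqr_modulus z; rewrite z1 expr1n => ->; rewrite addrC addKr.
have a0 := acos_ge0 r1; have a1 := acos_lepi r1; have pi0 := pi_gt0 R.
have sE : sin (acos (Re z)) = `|Im z| by rewrite sin_acos // s2 sqrtr_sqr.
have [i0|i0] := leP 0 (Im z).
  exists (acos (Re z)); first by apply/andP; split; lra.
  by apply: Cext => /=; rewrite ?acosK // sE ger0_norm.
exists (2 * pi - acos (Re z)); first by apply/andP; split; lra.
rewrite cisD cis2pi mul1r; apply: Cext => /=; first by rewrite cosN acosK.
by rewrite sinN sE ltr0_norm ?opprK.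
Qed.

Lemma analytic_horner P : analytic_in_disc (fun z => P.[z]).
Proof. by move=> z _; exact: derivable_horner. Qed.

Lemma coef_horner P (m : nat) : coef (fun z => P.[z]) m = P`_m.
Proof.
elim/poly_ind: P m => [|P c ih] m.
  rewrite (_ : (fun z => _) = fun=> 0); last by apply/funext => z; rewrite horner0.
  by rewrite coef_cst poly.coef0; case: ifP.
have aX : analytic_in_disc (fun z : C => z ^+ 1 * P.[z]).
  by apply: analyticM; [exact: analyticX|exact: analytic_horner].
rewrite (_ : (fun z => _) = fun z => z ^+ 1 * P.[z] + c); last first.
  by apply/funext => z; rewrite hornerMXaddC mulrC.
rewrite (coefD _ aX (@analytic_cst _ c)) coef_mulX coef_cst !poly.coefD coefMX coefC.
case: m => [|m].
  by rewrite (@coef_neg _ _ (0%:Z - 1) (@analytic_horner P)).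
by rewrite -[m.+1%:Z - 1]/(m.+1 - 1)%:Z subn1 ih addr0.
Qed.

Lemma symmetric_coef_real (k : nat) f :
  (forall n : int, coef f (k%:Z + n) = cconj (coef f (k%:Z - n))) ->
  coef f k = ofR (Re (coef f k)).
Proof.
move=> sym; apply: Cext; first exact: erefl.
have := congr1 Im (sym 0); rewrite addr0 ?subr0 Im_cconj.
by move: (Im _) => x hx; change (x = 0); lra.
Qed.

Lemma continuous_horner P : continuous (fun w => P.[w]).
Proof. by move=> z; exact/derivable_continuous/derivable_horner. Qed.

Lemma horner_mean_cvg P : mean (fun u => modulus P.[pt r u]) @[r --> (1 : R)^'-] -->
  mean (fun u => modulus P.[pt 1 u]).
Proof.
apply: cvg_at_left_filter; apply: (@mean_radius_cvg _ (fun w => modulus P.[w])).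
near=> s => u; apply: (@continuous_comp _ _ _ (fun w => P.[w]) (@modulus R)).
  exact: continuous_horner.
exact: continuous_modulus.
Unshelve. all: by end_near. Qed.

(** Coefficients of negative index vanish, so the symmetry about [k] annihilates those beyond [2 k].
    For positivity, [|P| - Re (z^-k P)] is nonnegative on the circle and its mean is at most
    [1 - 1], hence it is identically 0. *)
Lemma l1_poly (k : nat) f : analytic_in_disc f -> l1_means f -> Re (coef f k) = 1 ->
  exists P, [/\ (size P <= (k + k).+1)%N, forall z, disc z -> f z = P.[z],
    circle_nonneg P k & (forall m : nat, (m <= k + k)%N -> P`_m = coef f m) /\
      forall n : int, coef f (k%:Z + n) = cconj (coef f (k%:Z - n))].
Proof.
move=> af l1f fk.
have a1 := @analytic_cst R 1.
have f1E : (fun z => f z * 1) = f by apply/funext => z; rewrite mulr1.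
have sym := @l1_symmetry R f (fun=> 1) k af a1 l1f.
rewrite f1E in sym; have {}sym := sym _ fk.
have {}sym : forall n : int, coef f (k%:Z + n) = cconj (coef f (k%:Z - n)).
  by apply: sym => z _; rewrite modulus1.
pose P : {poly C} := \poly_(i < (k + k).+1) coef f i.
have aP := @analytic_horner P.
have cP (m : nat) : coef (fun z => P.[z]) m = if (m < (k + k).+1)%N then coef f m else 0.
  by rewrite coef_horner coef_poly.
have fP : forall z, disc z -> f z = P.[z].
  apply: (analytic_coef_inj af aP) => m; rewrite cP ltnS; case: leqP => // hm.
  have -> : m%:Z = k%:Z + (m%:Z - k%:Z) by rewrite addrC subrK.
  rewrite sym coef_neg; [exact: (cconj_ofR 0)|exact: af|].
  by rewrite opprB addrA subr_lt0 -PoszD ltz_nat.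
have cPm (m : nat) : (m <= k + k)%N -> P`_m = coef f m by move=> hm; rewrite coef_poly ltnS hm.
exists P; split; [exact: size_poly|exact: fP| |by split].
have cPc : continuous (fun t => P.[pt 1 t]).
  by apply: (@continuous_circle _ (fun w => P.[w])) => // z _; exact: continuous_horner.
have cz := @cont_exprz R 1 (- k%:Z) ltr01.
pose g u := modulus P.[pt 1 u] - Re (P.[pt 1 u] * pt 1 u ^ (- k%:Z)).
have mz u : modulus (pt 1 u ^ (- k%:Z)) = 1 by rewrite modulus_exprz modulus_pt // exp1rz.
have cg : continuous g.
  exact: contBr (contmod cPc) (contRe (contM cPc cz)).
have g0 u : 0 <= g u.
  by rewrite subr_ge0; apply: le_trans (Re_le _) _; rewrite modulusM mz mulr1.
have mg : mean g <= 0.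
  rewrite (meanB (contmod cPc) (contRe (contM cPc cz))).
  have -> : mean (fun u => Re (P.[pt 1 u] * pt 1 u ^ (- k%:Z))) = 1.
    transitivity (Re (coef f k)); last exact: fk.
    rewrite (coef_ext _ fP).
    rewrite -(@coefr_entire _ (fun w => P.[w]) 1 k (@derivable_horner R P) ltr01).
    exact: erefl.
  rewrite subr_le0.
  have h := @horner_mean_cvg P.
  apply: (@real_le_limit _ _ (fun=> 1) _ 1 h); first exact: cvg_cst.
  move=> e e0; apply: filterS2 (l1f e e0) (near_left1 ltr01) => r hr /andP[r0 r1].
  apply: le_trans hr; rewrite le_eqVlt; apply/orP; left; apply/eqP/eq_mean => u.
  by rewrite fP //; apply: disc_pt; apply/andP; split; lra.
move=> z z1; have [u hu ->] := cis_surj z1.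
have := mean_le0_eq0 cg g0 mg hu; rewrite /g => /subr0_eq hg.
have pu : pt 1 u = cis u :> C by rewrite /pt ofR1 mul1r.
have E : P.[cis u] * cis u ^ (- k%:Z) = ofR (modulus P.[cis u]).
  set X := _ * _.
  have mX : modulus X = modulus P.[cis u] by rewrite /X modulusM -pu mz mulr1.
  have XE : Re X = modulus X by rewrite mX /X -pu hg.
  have X2 : Im X ^+ 2 = 0.
    by have := sqr_modulus X; rewrite -XE -{1}[Re X ^+ 2]addr0 => /addrI.
  have iX : Im X = 0 by apply/eqP; rewrite -sqrf_eq0 X2.
  rewrite -mX -XE; apply: Cext; [exact: erefl|exact: iX].
exists (modulus P.[cis u]); first exact: modulus_ge0.
by rewrite -E -mulrA -exprnN mulVf ?mulr1 // expf_neq0 // cis_neq0.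
Qed.

(** On the unit circle [|P| = z^-k P], so the mean of [|P|] there is the [k]-th coefficient. *)
Lemma poly_qmean (k : nat) f P : (forall z, disc z -> f z = P.[z]) -> circle_nonneg P k ->
  qmean 1 f r @[r --> (1 : R)^'-] --> Re (coef f k).
Proof.
move=> fP cn.
have -> : Re (coef f k) = mean (fun u => modulus P.[pt 1 u]).
  rewrite (coef_ext _ fP).
  rewrite -(@coefr_entire _ (fun w => P.[w]) 1 k (@derivable_horner R P) ltr01) /coefr.
  apply: eq_mean => u; have u1 : modulus (pt 1 u : C) = 1 by rewrite modulus_pt.
  have [x x0 ->] := cn _ u1.
  rewrite -mulrA exprnP -expfzDr ?subrr ?expr0z ?mulr1 ?pt_neq0 //=.
  by rewrite modulusM modulus_ofR modulus_exprz u1 exp1rz mulr1 ger0_norm.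
apply: cvg_trans (@horner_mean_cvg P); apply: near_eq_cvg; apply: filterS (near_left1 ltr01) => r /andP[r0 r1].
rewrite qmean1; apply: eq_mean => u; rewrite fP //.
by apply: disc_pt; apply/andP; split; lra.
Qed.
End ExponentOne.

(** * Nonnegative trigonometric polynomials as squared moduli *)

Section ExtremalPolynomials.
Variable R : realType.
Local Notation C := (Cplx R).
Local Notation Re := (@complex.Re R).
Local Notation Im := (@complex.Im R).
Implicit Types (f g : C -> C) (z w : C) (r t : R) (P p : {poly C}).

Lemma circle_prod_identity (k : nat) (lambda : 'I_k -> C) z : modulus z = 1 ->
  \prod_(j < k) ((lambda j - z) * (1 - cconj (lambda j) * z)) =
  (- z) ^+ k * ofR (modulus (\prod_(j < k) (lambda j - z)) ^+ 2).
Proof.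
move=> z1.
have cp (F : 'I_k -> C) : cconj (\prod_(j < k) F j) = \prod_(j < k) cconj (F j).
  exact: (big_morph _ (@cconjM R) (cconj_ofR 1)).
rewrite (eq_bigr _ (fun j _ => circle_factor_identity (lambda j) z1)) big_split /=.
by rewrite prodr_const card_ord -mul_cconj cp -big_split.
Qed.

Lemma conj_rev_circle (k : nat) p z : (size p <= k.+1)%N -> modulus z = 1 ->
  (p * conj_rev k p).[z] = ofR (modulus p.[z] ^+ 2) * z ^+ k.
Proof. by move=> sp z1; rewrite hornerM (horner_conj_rev_unit sp z1) -mul_cconj; ring. Qed.

Lemma conj_rev_coef (k : nat) p :
  (p * conj_rev k p)`_k = ofR (\sum_(i < k.+1) modulus p`_i ^+ 2).
Proof.
rewrite coefM (big_morph _ (@ofRD R) (@ofR0 R)).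
apply: eq_bigr => i _; have hi : (i <= k)%N by rewrite -ltnS.
by rewrite coef_poly ltnS leq_subr subKn // -mul_cconj.
Qed.

(** On the circle each pair of factors is [- z |lambda_j - z|^2], so both sides equal a constant
    times [z^k |p|^2] there; polynomials that agree on the circle are equal. *)
Lemma factored_spectral (k : nat) P (c : C) (lambda : 'I_k -> C) :
  (forall z, P.[z] = c * \prod_(j < k) ((lambda j - z) * (1 - cconj (lambda j) * z))) ->
  exists p, (size p <= k.+1)%N /\ P = (c * (-1) ^+ k) *: (p * conj_rev k p).
Proof.
move=> hP; pose p : {poly C} := \prod_(j < k) ((lambda j)%:P - 'X).
have sp : (size p <= k.+1)%N.
  rewrite /p; apply: leq_trans (size_prod_leq _ _) _.
  rewrite card_ord leq_subLR; apply: (@leq_trans (\sum_(j < k) 2).+1).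
    rewrite ltnS; apply: leq_sum => j _.
    by rewrite -opprB size_polyN size_XsubC.
  by rewrite sum_nat_const card_ord muln2 -addnn addnS.
exists p; split=> //; apply: poly_eq_circle => z z1.
rewrite hP hornerZ (conj_rev_circle sp z1) circle_prod_identity //.
have -> : p.[z] = \prod_(j < k) (lambda j - z).
  by rewrite /p horner_prod; apply: eq_bigr => j _; rewrite hornerD hornerN hornerC hornerX.
by rewrite [(- z) ^+ k]exprNn; ring.
Qed.

(* Writing [P] as [s p conj_rev k p], the coefficients 0 and [k] give
   [sum |p_i|^2 = 2 |p_0| |p_k|], so only [p_0] and [p_k] survive. *)
Lemma half_rigidity (k : nat) P : (0 < k)%N -> (size P <= (k + k).+1)%N -> circle_nonneg P k ->
  P`_0 = ofR 2^-1 -> P`_k = 1 -> forall z, P.[z] = (1 + z ^+ k) ^+ 2 / 2.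
Proof.
move=> k0 sP cn P0 Pk z; have [c [lambda [_ hP]]] := fejer_riesz sP cn.
have [p [sp PE]] := factored_spectral hP; move: (c * _) PE => s PE.
have qE (i : nat) : (i <= k)%N -> (conj_rev k p)`_i = cconj p`_(k - i).
  by move=> hi; rewrite coef_poly ltnS hi.
pose N : R := \sum_(i < k.+1) modulus p`_i ^+ 2.
have sN : s * ofR N = 1.
  by rewrite -Pk PE poly.coefZ conj_rev_coef.
have s0 : s * (p`_0 * cconj p`_k) = ofR 2^-1.
  by rewrite -P0 PE poly.coefZ coefM big_ord_recl big_ord0 addr0 qE // subn0.
have nk : (ord_max : 'I_k.+1) != ord0 by rewrite -val_eqE /= -lt0n.
pose rest := \sum_(i < k.+1 | (i != ord0) && (i != ord_max)) modulus p`_i ^+ 2.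
have NE : N = modulus p`_0 ^+ 2 + (modulus p`_k ^+ 2 + rest).
  by rewrite /N (bigD1 ord0) //= (bigD1 ord_max) //=.
have r0 : 0 <= rest by apply: sumr_ge0 => i _; exact: sqr_ge0.
have N0 : 0 < N.
  rewrite lt_def; apply/andP; split; last by rewrite NE !addr_ge0 ?sqr_ge0.
  apply/eqP => h; move/eqP: sN; rewrite h mulr0 eq_sym oner_eq0 //.
have mN : modulus s * N = 1.
  by rewrite -[RHS](@modulus1 R) -sN modulusM modulus_ofR gtr0_norm.
have m0 : modulus s * (modulus p`_0 * modulus p`_k) = 2^-1.
  by have := congr1 (@modulus R) s0; rewrite !modulusM modulus_cconj modulus_ofR gtr0_norm ?invr_gt0.
have ms : 0 < modulus s.
  rewrite modulus_gt0; apply: contraTneq isT => h.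
  by move/eqP: sN; rewrite h mul0r eq_sym oner_eq0.
have E : N = 2 * (modulus p`_0 * modulus p`_k).
  apply: (mulfI (x := modulus s)); first by rewrite gt_eqF.
  by rewrite mN mulrCA m0 divff.
have rest0 : rest = 0.
  apply/eqP; rewrite eq_le r0 andbT; have := sqr_ge0 (modulus p`_0 - modulus p`_k).
  rewrite NE in E; rewrite sqrrB; lra.
have pz (i : 'I_k.+1) : i != ord0 -> i != ord_max -> p`_i = 0.
  move=> h1 h2; have h0 : forall j : 'I_k.+1, (j != ord0) && (j != ord_max) -> 0 <= modulus p`_j ^+ 2.
    by move=> j _; exact: sqr_ge0.
  by have /eqP := psumr_eq0P h0 rest0 (introT andP (conj h1 h2)); rewrite sqrf_eq0 modulus_eq0 => /eqP.
have pE : p.[z] = p`_0 + p`_k * z ^+ k.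
  rewrite (horner_coef_wide _ sp) (bigD1 ord0) //= (bigD1 ord_max) //= expr0 mulr1.
  rewrite big1 ?addr0 // => i /andP[h1 h2]; by rewrite pz ?mul0r.
have sq : (size (conj_rev k p) <= k.+1)%N by exact: size_poly.
have cE : (conj_rev k p).[z] = cconj p`_k + cconj p`_0 * z ^+ k.
  rewrite (horner_coef_wide _ sq) (bigD1 ord0) //= (bigD1 ord_max) //= expr0 mulr1.
  rewrite qE // subn0 qE // subnn big1 ?addr0 // => i /andP[h1 h2].
  have hi : (i <= k)%N by rewrite -ltnS.
  rewrite qE //; have := pz (rev_ord i); rewrite /= subSS => ->.
  - by rewrite (cconj_ofR 0) mul0r.
  - by apply: contra h2 => /eqP/(congr1 val) /= /eqP; rewrite subSS subn_eq0 -val_eqE /= eqn_leq hi.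
  - apply: contra h1 => /eqP/(congr1 val) /= /eqP; rewrite subSS => h3.
    by rewrite -val_eqE /= -(subKn hi) (eqP h3) subnn.
have s0' : s * (p`_k * cconj p`_0) = ofR 2^-1.
  have sr : cconj s = s.
    have : s = ofR N^-1.
      apply: (mulIf (x := ofR N)); first by rewrite -ofR0 (inj_eq (@ofR_inj R)) gt_eqF.
      by rewrite sN -ofRM mulVf // gt_eqF.
    by move=> ->; rewrite cconj_ofR.
  have := congr1 (@cconj R) s0; rewrite !cconjM cconjK sr cconj_ofR => <-.
  by rewrite [cconj _ * _]mulrC.
have s1 : s * (p`_0 * cconj p`_0 + p`_k * cconj p`_k) = 1.
  by rewrite !mul_cconj -ofRD -sN NE rest0 addr0.
rewrite PE hornerZ hornerM pE cE.
transitivity (s * (p`_0 * cconj p`_k) + s * (p`_0 * cconj p`_0 + p`_k * cconj p`_k) * z ^+ k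
  + s * (p`_k * cconj p`_0) * (z ^+ k) ^+ 2); first by ring.
rewrite s0 s0' s1 ofRV ofR_nat; by field.
Qed.

End ExtremalPolynomials.

(** * The extremals at exponent one for t at most 1/2 *)

Section ExponentOneExtremals.
Variable R : realType.
Local Notation C := (Cplx R).
Local Notation Re := (@complex.Re R).
Local Notation Im := (@complex.Im R).
Implicit Types (f g : C -> C) (z w : C) (r t : R) (P p : {poly C}).

Lemma admissible_poly (k : nat) t f P : analytic_in_disc f ->
  (forall z, disc z -> f z = P.[z]) -> circle_nonneg P k -> f 0 = ofR t ->
  Re (coef f k) <= 1 -> admissible 1%:E t f.
Proof.
move=> af fP cn f0 l1.
exact: (admissible_of_qmean (lexx 1) af f0 (poly_qmean fP cn) l1).
Qed.

Lemma Re_coef_le1 (k : nat) t f : admissible 1%:E t f -> Re_coef k f <= 1.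
Proof.
move=> adm; have af := admissible_analytic adm; rewrite (Re_coefE k af).
have f1E : (fun z => f z * 1) = f by apply/funext => z; rewrite mulr1.
have := l1_bound k af (@analytic_cst R 1) (admissible_l1_means adm).
by rewrite f1E; apply=> z _; rewrite modulus1.
Qed.

(** The bound [Re_coef_le1] is attained by [t + z^k + t z^(2 k)]: on the circle its product with
    [z^-k] is [1 + 2 t Re (z^k)], nonnegative because [t <= 1 / 2]. *)
Lemma Phi_exponent1 (k : nat) t : (0 < k)%N -> 0 <= t <= 2^-1 -> Phi k 1%:E t = 1%:E.
Proof.
move=> k0 /andP[t0 t1].
pose P : {poly C} := (ofR t)%:P + 'X^k + ofR t *: 'X^(k + k).
have PE z : P.[z] = ofR t + z ^+ k + ofR t * z ^+ (k + k).
  by rewrite !hornerD hornerZ hornerC !hornerXn.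
have aP := @analytic_horner R P.
have Pk : coef (fun z => P.[z]) k = 1.
  rewrite coef_horner !poly.coefD poly.coefZ coefC !coefXn eqxx (gtn_eqF k0) add0r.
  by rewrite -[k in (k == _)]addn0 eqn_add2l (ltn_eqF k0) mulr0 addr0.
have P0 : P.[0] = ofR t.
  by rewrite PE !expr0n addn_eq0 (gtn_eqF k0) mulr0 !addr0.
have cn : circle_nonneg P k.
  move=> z z1; exists (1 + t * (2 * Re (z ^+ k))).
    have := normRe_le (z ^+ k); rewrite modulusX z1 expr1n ler_norml => /andP[h _].
    have : t * -1 <= t * Re (z ^+ k) by rewrite ler_wpM2l.
    by lra.
  have w1 : modulus (z ^+ k) = 1 by rewrite modulusX z1 expr1n.
  have w0 : z ^+ k != 0 by rewrite -modulus_eq0 w1 oner_eq0.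
  have rE : ofR (2 * Re (z ^+ k)) = z ^+ k + (z ^+ k)^-1.
    rewrite -(cconj_unit w1); apply: Cext; rewrite ?ReD ?ImD ?Re_cconj ?Im_cconj.
      by rewrite mulr_natl mulr2n.
    by rewrite subrr.
  rewrite PE ofRD ofRM rE exprD ofR1.
  by field.
have ad : admissible 1%:E t (fun z => P.[z]).
  by apply: (@admissible_poly k t _ P aP) => //; rewrite Pk.
apply/eqP; rewrite eq_le; apply/andP; split.
  by apply: ge_ereal_sup => _ [f adf <-]; rewrite lee_fin (Re_coef_le1 k adf).
apply: ereal_sup_ubound; exists (fun z => P.[z]) => //=.
by rewrite (Re_coefE k aP) Pk.
Qed.

Lemma modulus_le1 z : (`|z| <= 1) = (modulus z <= 1).
Proof. by rewrite norm_modulus -leofR ofR1. Qed.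

Lemma extremal_factor (k : nat) t f : (0 < k)%N -> 0 <= t <= 2^-1 -> extremal k 1%:E t f ->
  exists (c : C) (lambda : 'I_k -> C),
    [/\ forall j, `|lambda j| <= 1,
        forall z, disc z -> f z = c * \prod_(j < k) ((lambda j - z) * (1 - cconj (lambda j) * z)),
        Hnorm 1%E f = 1%E, f 0 = ofR t & 0 < derive1n k f 0].
Proof.
move=> k0 ht [adm]; rewrite Phi_exponent1 // => -[fk].
have af := admissible_analytic adm; rewrite (Re_coefE k af) in fk.
have [P [sP fP cn [_ sym]]] := l1_poly af (admissible_l1_means adm) fk.
have [c [lambda [l1 hP]]] := fejer_riesz sP cn.
exists c, lambda; split.
- by move=> j; rewrite modulus_le1.
- by move=> z dz; rewrite fP.
- have [_ _ ->] := Hnorm_of_qmean (lexx 1) af (poly_qmean fP cn).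
  by rewrite fk powR1.
- by case: adm.
have f1 : coef f k = 1 by rewrite (symmetric_coef_real sym) fk.
have := coef_derive1n k af; rewrite f1 => h.
have F0 : 0 < (k`!%:R : C) by rewrite ltr0n fact_gt0.
by rewrite -[derive1n k f 0](divfK (lt0r_neq0 F0)) h mul1r.
Qed.

(** On the circle the product is [D z^k |p|^2], and its [k]-th coefficient is [D * M] with [M >= 0].
    Positivity of the derivative thus forces [D > 0]; the norm then equals that coefficient, which
    the norm condition sets to 1. *)
Lemma factor_extremal (k : nat) t f (c : C) (lambda : 'I_k -> C) :
  (0 < k)%N -> 0 <= t <= 2^-1 ->
  (forall z, disc z -> f z = c * \prod_(j < k) ((lambda j - z) * (1 - cconj (lambda j) * z))) ->
  Hnorm 1%E f = 1%E -> f 0 = ofR t -> 0 < derive1n k f 0 -> extremal k 1%:E t f.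
Proof.
move=> k0 ht fE nf f0 df.
have [P PE] : exists P : {poly C}, forall z,
    P.[z] = c * \prod_(j < k) ((lambda j - z) * (1 - cconj (lambda j) * z)).
  exists (c *: \prod_(j < k) (((lambda j)%:P - 'X) * (1 - (cconj (lambda j)) *: 'X))) => z.
  rewrite hornerZ horner_prod; congr (_ * _); apply: eq_bigr => j _.
  by rewrite hornerM !hornerD !hornerN hornerZ !hornerC hornerX.
have fP z : disc z -> f z = P.[z] by move=> dz; rewrite PE fE.
have af : analytic_in_disc f.
  move=> z dz; apply: (@near_eq_derivable _ _ _ (fun w => P.[w])).
  - by apply: filterS (disc_near dz) => w dw; rewrite fP.
  - exact: derivable_horner.
have [p [sp hp]] := factored_spectral PE; move: (c * _) hp => D hp.
pose M := \sum_(i < k.+1) modulus p`_i ^+ 2.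
have M0 : 0 <= M by apply: sumr_ge0 => i _; exact: sqr_ge0.
have fkE : coef f k = D * ofR M.
  by rewrite (coef_ext _ fP) coef_horner hp poly.coefZ conj_rev_coef.
have : 0 < coef f k by rewrite -(coef_derive1n k af) divr_gt0.
rewrite fkE => DM.
have M1 : 0 < M.
  by rewrite lt_def M0 andbT; apply: contraTneq DM => ->; rewrite ofR0 mulr0 ltxx.
have M2 : 0 < (ofR M : C) by rewrite -ofR0 ltofR.
have D0 : 0 < D by rewrite -(pmulr_lgt0 _ M2).
have [d d0 Dd] : exists2 d : R, 0 <= d & D = ofR d.
  exists (modulus D); first exact: modulus_ge0.
  by rewrite -norm_modulus gtr0_norm.
have cn : circle_nonneg P k.
  move=> z z1; exists (d * modulus p.[z] ^+ 2); first by rewrite mulr_ge0 ?sqr_ge0.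
  by rewrite hp hornerZ (conj_rev_circle sp z1) Dd ofRM mulrA.
have [l0 _] := Hnorm_of_qmean (lexx 1) af (poly_qmean fP cn).
rewrite nf invr1 powRr1 // => nE.
have fk1 : Re (coef f k) = 1 by exact: (esym (congr1 (@fine R) nE)).
split; last by rewrite (Re_coefE k af) fk1 Phi_exponent1.
by apply: (admissible_poly af fP cn f0); rewrite fk1.
Qed.

End ExponentOneExtremals.

(** * The functions f1 (z^k) *)

Section CandidateExtremals.
Variable R : realType.
Local Notation C := (Cplx R).
Local Notation Re := (@complex.Re R).
Local Notation Im := (@complex.Im R).
Implicit Types (f g h : C -> C) (z w : C) (r t a b s q : R).

Lemma continuous_powR_quad s : continuous (fun x : R => (1 + x ^+ 2) `^ s).
Proof.
move=> x; have p0 : 0 < 1 + x ^+ 2 by rewrite ltr_pwDl ?sqr_ge0.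
apply: (@continuous_comp _ _ _ (fun x : R => 1 + x ^+ 2) (fun y => y `^ s)).
  by apply: continuousD; [exact: cst_continuous|exact: exprn_continuous].
have [dq _] := is_derive1_powR s p0.
by move/derivable1_diffP: dq => /differentiable_continuous.
Qed.

Lemma alphaP (p : \bar R) t : 0 <= t -> t < 2 `^ (- inv_exponent p) ->
  0 <= alpha p t < 1 /\ t = alpha p t * (1 + alpha p t ^+ 2) `^ (- inv_exponent p).
Proof.
move=> t0 t1; pose s := - inv_exponent p; rewrite -/s in t1.
suff h : exists a, 0 <= a < 1 /\ t = a * (1 + a ^+ 2) `^ s by exact: (xgetPex 0 h).
pose F x := x * (1 + x ^+ 2) `^ s.
have cF : {within `[0, 1], continuous F}.
  apply: continuous_subspaceT => x; apply: (@continuousM _ _ (fun x : R => x)); first exact: cvg_id.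
  exact: continuous_powR_quad.
have F0 : F 0 = 0 by rewrite /F mul0r.
have F1 : F 1 = 2 `^ s by rewrite /F mul1r expr1n.
have [|x] := @IVT R F 0 1 t ler01 cF.
  by rewrite F0 F1 min_l ?powR_ge0 // max_r ?powR_ge0 // t0 ltW.
rewrite in_itv /= => /andP[x0 x1] Fx; exists x; split=> //.
apply/andP; split=> //; rewrite lt_neqAle x1 andbT.
by apply: contraTneq t1 => x1'; rewrite -Fx x1' F1 ltxx.
Qed.

Lemma betaP (p : \bar R) t : t <= 1 -> 2 `^ (- inv_exponent p) <= t ->
  0 <= beta p t <= 1 /\ t = (1 + beta p t ^+ 2) `^ (- inv_exponent p).
Proof.
move=> t1 t0; pose s := - inv_exponent p; rewrite -/s in t0.
suff h : exists b, 0 <= b <= 1 /\ t = (1 + b ^+ 2) `^ s by exact: (xgetPex 0 h).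
have cF : {within `[0, 1], continuous (fun x : R => (1 + x ^+ 2) `^ s)}.
  by apply: continuous_subspaceT; exact: continuous_powR_quad.
have [|x] := @IVT R _ 0 1 t ler01 cF.
  rewrite expr0n addr0 powR1 expr1n; apply/andP; split.
    by rewrite ge_min t0 orbT.
  by rewrite le_max t1.
by rewrite in_itv /= => h <-; exists x.
Qed.

Lemma analytic_cpow a s : 0 <= a <= 1 -> analytic_in_disc (fun w => cpow (1 + ofR a * w) s).
Proof.
move=> ha w dw.
apply: (@derivable_compC _ (fun w => 1 + ofR a * w) (fun u => cpow u s)); first exact: derivable_affine.
exact/derivable_cpow/Re_affine_gt0.
Qed.

Lemma shift_eq_affine a w : modulus w = 1 -> modulus (ofR a + w) = modulus (1 + ofR a * w).
Proof.
move=> w1; apply/eqP; rewrite -(@eqrXn2 _ 2) ?modulus_ge0 //.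
by rewrite eq_sym -subr_eq0 sqr_affine_diff w1 expr1n subrr mulr0.
Qed.

End CandidateExtremals.

Section CandidateHardy.
Variable R : realType.
Local Notation C := (Cplx R).
Local Notation Re := (@complex.Re R).
Local Notation Im := (@complex.Im R).
Implicit Types (f g h : C -> C) (z w : C) (r t a b s q : R).

Definition alpha_form a s w : C :=
  ((ofR a + w) / (1 + ofR a * w)) * (cpow (1 + ofR a * w) (2 * s) / ofR ((1 + a ^+ 2) `^ s)).

Definition beta_form b s w : C := cpow (1 + ofR b * w) (2 * s) / ofR ((1 + b ^+ 2) `^ s).

Lemma f1_alpha (p : \bar R) t : t < 2 `^ (- inv_exponent p) ->
  f1 p t = alpha_form (alpha p t) (inv_exponent p).
Proof. by move=> h; apply/funext => w; rewrite /f1 h. Qed.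

Lemma f1_beta (p : \bar R) t : 2 `^ (- inv_exponent p) <= t ->
  f1 p t = beta_form (beta p t) (inv_exponent p).
Proof. by move=> h; apply/funext => w; rewrite /f1 ltNge h. Qed.

Lemma analytic_beta_form b s : 0 <= b <= 1 -> analytic_in_disc (beta_form b s).
Proof.
move=> hb; apply: analyticM; last exact: analytic_cst.
exact: analytic_cpow.
Qed.

Lemma analytic_alpha_form a s : 0 <= a <= 1 -> analytic_in_disc (alpha_form a s).
Proof.
move=> ha; apply: analyticM; first exact: analytic_moebius.
exact: (@analytic_beta_form a s).
Qed.

Lemma beta_form0 b s : beta_form b s 0 = ofR ((1 + b ^+ 2) `^ (- s)).
Proof. by rewrite /beta_form mulr0 addr0 cpow1 powRN ofRV mul1r. Qed.

Lemma alpha_form0 a s : alpha_form a s 0 = ofR (a * (1 + a ^+ 2) `^ (- s)).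
Proof.
by rewrite /alpha_form -/(beta_form a s 0) beta_form0 mulr0 !addr0 divr1 ofRM.
Qed.

Lemma powR_quad_gt0 a s : 0 < (1 + a ^+ 2) `^ s.
Proof. by rewrite powR_gt0 // g2_gt0. Qed.

Lemma modulus_beta_form b s w :
  modulus (beta_form b s w) = modulus (1 + ofR b * w) `^ (2 * s) / (1 + b ^+ 2) `^ s.
Proof.
rewrite modulusM modulus_cpow modulusV modulus_ofR gtr0_norm //.
exact: powR_quad_gt0.
Qed.

Lemma beta_form_powR (k : nat) b q z : 0 < q ->
  modulus (beta_form b q^-1 (z ^+ k)) `^ q = kerM b k z.
Proof.
move=> q0; have m0 := modulus_ge0 (1 + ofR b * z ^+ k).
rewrite modulus_beta_form powRM ?powR_ge0 ?invr_ge0 //; last exact: powR_ge0.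
rewrite -powRrM -mulrA mulVf ?gt_eqF // mulr1.
rewrite -powRN -powRrM mulNr mulVf ?gt_eqF // powR_inv1; last exact/ltW/g2_gt0.
by rewrite powR_mulrn.
Qed.

Lemma alpha_form_powR (k : nat) a q z : 0 < q ->
  modulus (alpha_form a q^-1 (z ^+ k)) `^ q =
  modulus ((ofR a + z ^+ k) / (1 + ofR a * z ^+ k)) `^ q * kerM a k z.
Proof.
move=> q0; rewrite -(beta_form_powR k a z q0) -powRM ?modulus_ge0 //.
by rewrite -modulusM.
Qed.

Lemma admissible_beta_form (k : nat) b q t : (0 < k)%N -> 1 <= q -> 0 <= b <= 1 ->
  t = (1 + b ^+ 2) `^ (- q^-1) -> admissible q%:E t (fun z => beta_form b q^-1 (z ^+ k)).
Proof.
move=> k0 q1 hb tE; have q0 : 0 < q by lra.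
apply: (admissible_of_qmean q1 (l := 1)) => //.
- exact: (analytic_kfold k0 (@analytic_beta_form b q^-1 hb)).
- by rewrite expr0n gtn_eqF // beta_form0 -tE.
apply: cvg_trans (@kerM_mean_cvg R b k k0); apply: near_eq_cvg; apply: filterE => r.
by apply: eq_mean => u; rewrite beta_form_powR.
Qed.

Lemma addr1_neq0 z : modulus z < 1 -> 1 + z != 0.
Proof.
apply: contraTneq => h; have -> : z = - 1 by rewrite -[LHS](addKr 1) h addr0.
by rewrite modulusN modulus1 ltxx.
Qed.

Lemma admissible_alpha_form (k : nat) a q t : (0 < k)%N -> 1 <= q -> 0 <= a < 1 ->
  t = a * (1 + a ^+ 2) `^ (- q^-1) -> admissible q%:E t (fun z => alpha_form a q^-1 (z ^+ k)).
Proof.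
move=> k0 q1 /andP[a0 a1] tE; have q0 : 0 < q by lra.
have ha : 0 <= a <= 1 by rewrite a0 ltW.
apply: (admissible_of_qmean q1 (l := 1)) => //.
- exact: (analytic_kfold k0 (@analytic_alpha_form a q^-1 ha)).
- by rewrite expr0n gtn_eqF // alpha_form0 -tE.
pose B z := (ofR a + z ^+ k) / (1 + ofR a * z ^+ k).
pose F z := modulus (B z) `^ q * kerM a k z.
have F1 : mean (fun u => F (pt 1 u)) = 1.
  rewrite -[RHS](@mean_kerM_unit R a k k0); apply: eq_mean => u.
  have w1 : modulus (pt 1 u ^+ k : C) = 1 by rewrite modulusX modulus_pt // expr1n.
  have wn : modulus (1 + ofR a * pt 1 u ^+ k) != 0.
    by rewrite modulus_eq0 addr1_neq0 // modulusM modulus_ofR ger0_norm // w1 mulr1.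
  by rewrite /F /B modulusM modulusV (shift_eq_affine _ w1) mulfV // powR1 mul1r.
rewrite -[X in _ --> X]F1.
have h : mean (fun u => F (pt r u)) @[r --> (1 : R)^'-] --> mean (fun u => F (pt 1 u)).
  apply: cvg_at_left_filter; apply: mean_radius_cvg.
  (* Because [a < 1], the pole of the Moebius factor keeps away from the unit circle, and the means
     extend continuously to radius 1. *)
  have n1 : \forall s \near (1 : R), a * `|s| ^+ k < 1.
    have cs : {for (1 : R), continuous (fun s : R => a * `|s| ^+ k)}.
      apply: (@continuousM _ _ (fun=> a)); first exact: cst_continuous.
      apply: (@continuous_comp _ _ _ (fun s : R => `|s|) (fun x => x ^+ k)).
        exact: norm_continuous.
      exact: exprn_continuous.
    by apply: (cvgr_lt _ cs); rewrite normr1 expr1n mulr1.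
  apply: filterS n1 => s hs u.
  have nz : 1 + ofR a * pt s u ^+ k != 0.
    by rewrite addr1_neq0 // modulusM modulus_ofR ger0_norm // modulusX modulusM modulus_cis mulr1 modulus_ofR.
  apply: (@continuousM _ _ (fun z => modulus (B z) `^ q)); last exact: continuous_kerM.
  apply: (powR_continuous_nonneg q1) => [y|]; first exact: modulus_ge0.
  apply: (@continuous_comp _ _ _ B); last exact: continuous_modulus.
  apply: derivable_continuous; apply: derivable_MC.
    by apply: derivable_DC; [exact: derivable_cstC|exact/derivable_XC/derivable_idC].
  apply: derivable_VC; first exact: nz.
  apply: derivable_DC; first exact: derivable_cstC.
  by apply: derivable_MC; [exact: derivable_cstC|exact/derivable_XC/derivable_idC].
apply: cvg_trans h; apply: near_eq_cvg; apply: filterE => r.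
by apply: eq_mean => u; rewrite alpha_form_powR.
Qed.

End CandidateHardy.

(** * Extremality and uniqueness of the candidates *)

Section CandidateExtremality.
Variable R : realType.
Local Notation C := (Cplx R).
Local Notation Re := (@complex.Re R).
Local Notation Im := (@complex.Im R).
Implicit Types (f g h : C -> C) (z w : C) (r t a b s q : R).

Lemma admissible_pinfty t f : analytic_in_disc f -> (forall z, disc z -> modulus (f z) <= 1) ->
  f 0 = ofR t -> admissible +oo%E t f.
Proof.
move=> af f1 f0; have n1 : (Hnorm +oo%E f <= 1)%E.
  by apply: ge_ereal_sup => _ [z dz <-]; rewrite lee_fin f1.
split=> //; split=> //; exact: (le_lt_trans n1 (ltry 1)).
Qed.

Lemma modulus_beta_form0 b w : modulus (beta_form b 0 w) = 1.
Proof. by rewrite modulus_beta_form mulr0 !powRr0 divr1. Qed.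

Lemma admissible_f1 (k : nat) (p : \bar R) t : (0 < k)%N -> (1 <= p)%E -> 0 <= t <= 1 ->
  admissible p t (fun z => f1 p t (z ^+ k)).
Proof.
move=> k0 p1 /andP[t0 t1]; have [h|h] := ltP t (2 `^ (- inv_exponent p)).
  have [/andP[a0 a1] tE] := alphaP t0 h; rewrite (f1_alpha h); move: (alpha p t) a0 a1 tE => a a0 a1.
  have ha : 0 <= a < 1 by rewrite a0.
  have ha' : 0 <= a <= 1 by rewrite a0 ltW.
  case: p p1 {h} => [q| |] //= p1 tE; first exact: admissible_alpha_form.
  apply: admissible_pinfty.
  - exact: (analytic_kfold k0 (@analytic_alpha_form R a 0 ha')).
  - move=> z dz; rewrite modulusM -/(beta_form a 0 (z ^+ k)) modulus_beta_form0 mulr1.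
    exact/modulus_moebius/disc_exprn.
  - by rewrite expr0n gtn_eqF // alpha_form0 -tE.
have [hb tE] := betaP t1 h; rewrite (f1_beta h); move: (beta p t) hb tE => b hb.
case: p p1 {h} => [q| |] //= p1 tE; first exact: admissible_beta_form.
apply: admissible_pinfty.
- exact: (analytic_kfold k0 (@analytic_beta_form R b 0 hb)).
- by move=> z dz; rewrite modulus_beta_form0.
- by rewrite expr0n gtn_eqF // beta_form0 -tE.
Qed.

(** Cancellation of [h] is left as a hypothesis because [h] may vanish in the disc: in the case
    [gam = b < 1] it does so where [z ^+ k = - b]. *)
Lemma young_unique_extremal (k : nat) (p : \bar R) t g h (gam h0 : R) :
  (0 < k)%N -> (1 < p)%E -> admissible p t g -> analytic_in_disc h ->
  0 <= h0 -> h 0 = ofR h0 ->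
  (forall w, disc w -> modulus (h w) `^ (1 - inv_exponent p)^-1 <= modulus (1 + ofR gam * w) ^+ 2) ->
  (forall z, disc z -> g z * h (z ^+ k) =
     ofR ((1 + gam ^+ 2) `^ (1 - inv_exponent p)) * kerQ gam k z) ->
  (forall f, analytic_in_disc f -> (forall z, disc z -> f z * h (z ^+ k) = g z * h (z ^+ k)) ->
     forall z, disc z -> f z = g z) ->
  unique_extremal k p t g.
Proof.
move=> k0 p1 adg ah h00 h0E hb gE canc; set V := _ `^ _ in gE.
have s01 := inv_exponent_lt1 p1.
have aH := analytic_kfold k0 ah.
have hb' z : disc z -> modulus (h (z ^+ k)) `^ (1 - inv_exponent p)^-1 <= modulus (1 + ofR gam * z ^+ k) ^+ 2.
  by move=> dz; apply/hb/disc_exprn.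
pose h1 := Re (derive1 h 0 * ofR t).
have cE f : admissible p t f -> Re (coef (fun z => f z * h (z ^+ k)) k) = h0 * Re_coef k f + h1.
  move=> adf; have af := admissible_analytic adf; have [_ _ f0] := adf.
  rewrite (coef_mul_kfold k0 af ah) coef0 // f0 h0E ReD (Re_coefE k af); congr (_ + _).
  by rewrite ReM [Re (ofR _)]/= [Im (ofR _)]/= mul0r subr0.
have gV : h0 * Re_coef k g + h1 = V.
  rewrite -(cE _ adg) (coef_ext _ gE) coefZ; last by move=> z _; exact: derivable_kerQ.
  by rewrite coef_kerQ_k // mulr1.
apply: (@unique_extremal_of_functional R k p t g h0 h1 adg h00) => f adf.
have af := admissible_analytic adf; have yf := admissible_young p1 adf.
rewrite gV -(cE _ adf); split.
  exact: (young_bound k0 s01 af aH yf hb').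
move=> fV; apply: (canc f af) => z dz; rewrite gE //.
exact: (young_rigidity k0 s01 af aH yf hb' fV).
Qed.

End CandidateExtremality.

Section MainCases.
Variable R : realType.
Local Notation C := (Cplx R).
Local Notation Re := (@complex.Re R).
Local Notation Im := (@complex.Im R).
Implicit Types (f g h : C -> C) (z w : C) (r t a b s q : R).

Lemma ofR_powR_quad a s :
  ofR ((1 + a ^+ 2) `^ (1 - s)) / ofR (1 + a ^+ 2) = (ofR ((1 + a ^+ 2) `^ s))^-1 :> C.
Proof.
have g0 := g2_gt0 a; rewrite -!ofRV -ofRM; congr (ofR _).
have E : (1 + a ^+ 2) `^ (1 - s) * (1 + a ^+ 2) `^ s = 1 + a ^+ 2.
  by rewrite -powRD ?subrK ?powRr1 ?(ltW g0) // gt_eqF // implybT.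
by rewrite -[X in _ / X]E invfM mulrA divff ?mul1r // gt_eqF // powR_gt0.
Qed.

Lemma alpha_form_kerQ (k : nat) a s z : (0 < k)%N -> 0 <= a <= 1 -> disc z ->
  alpha_form a s (z ^+ k) * cpow (1 + ofR a * z ^+ k) (2 * (1 - s)) =
  ofR ((1 + a ^+ 2) `^ (1 - s)) * kerQ a k z.
Proof.
move=> k0 ha dz; have n0 := affine_neq0 ha (disc_exprn k0 dz).
rewrite /kerQ [RHS]mulrCA ofR_powR_quad /alpha_form.
set w := z ^+ k in n0 *; set c := (ofR (_ `^ s))^-1.
have -> : (ofR a + w) / (1 + ofR a * w) * (cpow (1 + ofR a * w) (2 * s) * c) *
    cpow (1 + ofR a * w) (2 * (1 - s)) = (ofR a + w) / (1 + ofR a * w) * c *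
    (cpow (1 + ofR a * w) (2 * s) * cpow (1 + ofR a * w) (2 * (1 - s))) by ring.
rewrite -cpowD // -mulrDr subrKC mulr1 cpow_2 //; by field.
Qed.

Lemma beta_form_kerQ (k : nat) b s z : (0 < k)%N -> 0 <= b <= 1 -> disc z ->
  beta_form b s (z ^+ k) * ((ofR b + z ^+ k) * cpow (1 + ofR b * z ^+ k) (1 - 2 * s)) =
  ofR ((1 + b ^+ 2) `^ (1 - s)) * kerQ b k z.
Proof.
move=> k0 hb dz; have n0 := affine_neq0 hb (disc_exprn k0 dz).
rewrite /kerQ [RHS]mulrCA ofR_powR_quad /beta_form.
set w := z ^+ k in n0 *; set c := (ofR (_ `^ s))^-1.
have -> : cpow (1 + ofR b * w) (2 * s) * c * ((ofR b + w) * cpow (1 + ofR b * w) (1 - 2 * s)) =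
   (ofR b + w) * c * (cpow (1 + ofR b * w) (2 * s) * cpow (1 + ofR b * w) (1 - 2 * s)) by ring.
by rewrite -cpowD // subrKC cpow_1 //; ring.
Qed.

(** The factor may have zeros, so one argues on coefficients: those of [f - g] satisfy
    [b d_n + d_(n - k) = 0]. This determines them upwards from negative indices if [b != 0], and at
    once if [b = 0]. *)
Lemma shift_cancel (k : nat) b f g : (0 < k)%N -> analytic_in_disc f -> analytic_in_disc g ->
  (forall z, disc z -> f z * (ofR b + z ^+ k) = g z * (ofR b + z ^+ k)) ->
  forall z, disc z -> f z = g z.
Proof.
move=> k0 af ag fg; have aD := analyticB af ag.
have aX : analytic_in_disc (fun z => z ^+ k * (f z - g z)).
  by apply: analyticM; [exact: analyticX|exact: aD].
pose D := coef (fun z => f z - g z).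
have rec n : ofR b * D n + D (n - k%:Z) = 0.
  rewrite /D -(coef_mulX k) -(coefZ _ _ aD) -(coefD _ (@analyticZ _ _ _ aD) aX).
  rewrite (@coef_ext _ _ (fun=> 0)) ?coef_cst; first by case: ifP.
  move=> z dz; have := fg z dz; move/eqP; rewrite -subr_eq0 -mulrBl => /eqP h.
  by rewrite -mulrDl mulrC.
have D0 (m : nat) : D m = 0.
  have [b0|b0] := eqVneq b 0.
    by have := rec (m%:Z + k%:Z); rewrite b0 ofR0 mul0r add0r addrK.
  have b0' : ofR b != 0 :> C by rewrite -ofR0 (inj_eq (@ofR_inj R)).
  elim/ltn_ind: m => m ih; have := rec m; have [km|km] := leqP k m.
    rewrite subzn // (ih (m - k)%N) ?addr0 ?ltn_subrL ?k0 ?(leq_trans k0 km) // => /eqP.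
    by rewrite mulf_eq0 (negPf b0') => /eqP.
  have -> : D (m%:Z - k%:Z) = 0 by apply: (coef_neg aD); rewrite subr_lt0 ltz_nat.
  by rewrite addr0 => /eqP; rewrite mulf_eq0 (negPf b0') => /eqP.
by move=> z dz; apply/subr0_eq; exact: (analytic_coef_eq0 aD D0).
Qed.

Lemma alpha_young (k : nat) (p : \bar R) t : (0 < k)%N -> (1 < p)%E -> 0 <= t <= 1 ->
  t < 2 `^ (- inv_exponent p) -> unique_extremal k p t (fun z => f1 p t (z ^+ k)).
Proof.
move=> k0 p1 ht h; have adg := admissible_f1 k0 (ltW p1) ht; move: adg.
have /andP[s0 s1] := inv_exponent_lt1 p1; case/andP: ht => t0 t1.
have [/andP[a0 a1] _] := alphaP t0 h; rewrite (f1_alpha h).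
move: (alpha p t) a0 a1 => a a0 a1 adg; have ha : 0 <= a <= 1 by rewrite a0 ltW.
set s := inv_exponent p in s0 s1 adg *.
apply: (@young_unique_extremal R k p t _ (fun w => cpow (1 + ofR a * w) (2 * (1 - s))) a 1) => //.
- exact: analytic_cpow.
- by rewrite mulr0 addr0 cpow1.
- move=> w dw; rewrite modulus_cpow -powRrM -mulrA divff ?subr_eq0 ?gt_eqF // mulr1.
  by rewrite powR_mulrn ?modulus_ge0.
- by move=> z dz; rewrite alpha_form_kerQ.
move=> f af fg z dz; apply: (mulIf _ (fg z dz)).
exact/cpow_neq0/affine_neq0/disc_exprn.
Qed.

Lemma beta_young (k : nat) (p : \bar R) t : (0 < k)%N -> (1 < p)%E -> 0 <= t <= 1 ->
  2 `^ (- inv_exponent p) <= t -> unique_extremal k p t (fun z => f1 p t (z ^+ k)).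
Proof.
move=> k0 p1 ht h; have adg := admissible_f1 k0 (ltW p1) ht; move: adg.
have /andP[s0 s1] := inv_exponent_lt1 p1; case/andP: ht => t0 t1.
have [hb _] := betaP t1 h; rewrite (f1_beta h).
move: (beta p t) hb => b hb adg; set s := inv_exponent p in s0 s1 adg *.
have [b0 b1] := andP hb.
apply: (@young_unique_extremal R k p t _
  (fun w => (ofR b + w) * cpow (1 + ofR b * w) (1 - 2 * s)) b b) => //.
- by apply: analyticM; [exact: analytic_shift|exact: analytic_cpow].
- by rewrite mulr0 !addr0 cpow1 mulr1.
- move=> w dw; have n0 : modulus (1 + ofR b * w) != 0 by rewrite modulus_eq0 affine_neq0.
  have x0 : 0 <= (1 - inv_exponent p)^-1 by rewrite invr_ge0 subr_ge0 ltW.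
  have E : modulus (1 + ofR b * w) ^+ 2 =
      (modulus (1 + ofR b * w) `^ (2 * (1 - s))) `^ (1 - s)^-1.
    rewrite -powRrM -mulrA divff ?subr_eq0 ?gt_eqF // mulr1 powR_mulrn ?modulus_ge0 //.
  rewrite E; apply: ge0_ler_powR => //; rewrite ?nnegrE ?modulus_ge0 ?powR_ge0 //.
  have -> : 2 * (1 - s) = 1 + (1 - 2 * s) by ring.
  rewrite powRD ?n0 ?implybT // powRr1 ?modulus_ge0 // modulusM modulus_cpow.
  by rewrite ler_wpM2r ?powR_ge0 // shift_le_affine //; exact/ltW/disc_modulus.
- by move=> z dz; rewrite beta_form_kerQ.
move=> f af fg; apply: (shift_cancel k0 af (admissible_analytic adg) (b := b)) => z dz.
apply: (mulIf (x := cpow (1 + ofR b * z ^+ k) (1 - 2 * s))); last first.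
  exact: etrans (esym (mulrA _ _ _)) (etrans (fg z dz) (mulrA _ _ _)).
exact/cpow_neq0/affine_neq0/disc_exprn.
Qed.

End MainCases.

Section ExponentOneCandidate.
Variable R : realType.
Local Notation C := (Cplx R).
Local Notation Re := (@complex.Re R).
Local Notation Im := (@complex.Im R).
Implicit Types (f g h : C -> C) (z w : C) (r t a b s q : R).

Lemma beta_exponent1 (k : nat) t : (0 < k)%N -> 2^-1 <= t <= 1 ->
  unique_extremal k 1%:E t (fun z => f1 1%:E t (z ^+ k)).
Proof.
move=> k0 /andP[t0 t1].
have ht : 0 <= t <= 1 by apply/andP; split; lra.
have i1 : inv_exponent (1%:E : \bar R) = 1 by rewrite /inv_exponent invr1.
have hB : 2 `^ (- inv_exponent 1%:E) <= t by rewrite i1 powR_inv1.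
have := admissible_f1 k0 (lexx 1%:E) ht.
have [hb tE] := betaP t1 hB; rewrite (f1_beta hB) i1.
rewrite i1 in tE; move: (beta _ t) hb tE => b hb.
have g0 := g2_gt0 b; rewrite powR_inv1 ?(ltW g0) // => tE adg.
have ag := admissible_analytic adg.
have gE z : disc z -> beta_form b 1 (z ^+ k) = ofR t * (1 + ofR b * z ^+ k) ^+ 2.
  move=> dz; have n0 := affine_neq0 hb (disc_exprn k0 dz).
  by rewrite /beta_form mulr1 cpow_2 // powRr1 ?(ltW g0) // tE ofRV mulrC.
have [b0 b1] := andP hb.
(* The value [b = 1] is [t = 1 / 2]: the Moebius multiplier degenerates to the constant 1, and
   [half_rigidity] takes the place of [l1_rigidity]. *)
have [b1'|b1'] := eqVneq b 1.
  have gQ z : disc z -> beta_form b 1 (z ^+ k) = kerQ 1 k z.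
    move=> dz; rewrite gE // tE b1' /kerQ ofR1 expr1n !mul1r ofRV [RHS]mulrC.
    by rewrite [_ + z ^+ k]/(1 + z ^+ k) -expr2.
  have gk : Re_coef k (fun z => beta_form b 1 (z ^+ k)) = 1.
    by rewrite (Re_coefE k ag) (coef_ext _ gQ) coef_kerQ_k.
  apply: (@unique_extremal_of_functional R k 1%:E t _ 1 0 adg ler01) => f adf.
  rewrite !mul1r !addr0 gk; split; first exact: (Re_coef_le1 k adf).
  have af := admissible_analytic adf; rewrite (Re_coefE k af) => fk.
  have [P [sP fP cn [cP sym]]] := l1_poly af (admissible_l1_means adf) fk.
  have [_ _ f0] := adf.
  move=> z dz; rewrite fP // (half_rigidity k0 sP cn).
  - by rewrite gQ // /kerQ ofR1 expr1n mul1r -expr2 ofRD ofR1.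
  - rewrite cP // coef0 // f0 tE b1' expr1n //.
  - by rewrite cP ?leq_addr // (symmetric_coef_real sym) fk.
have b1s : b < 1 by rewrite lt_neqAle b1' b1.
have hb' : 0 <= b < 1 by rewrite b0.
pose h w : C := (ofR b + w) / (1 + ofR b * w).
have ah : analytic_in_disc h by exact: analytic_moebius.
have aH := analytic_kfold k0 ah.
have hle z : disc z -> modulus (h (z ^+ k)) <= 1.
  by move=> dz; apply: modulus_moebius => //; exact: disc_exprn.
pose h1 := Re (derive1 h 0 * ofR t).
have cE f : admissible 1%:E t f -> Re (coef (fun z => f z * h (z ^+ k)) k) = b * Re_coef k f + h1.
  move=> adf; have af := admissible_analytic adf; have [_ _ f0] := adf.
  rewrite (coef_mul_kfold k0 af ah) coef0 // f0 ReD (Re_coefE k af); congr (_ + _).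
  rewrite /h mulr0 !addr0 divr1.
  by rewrite ReM [Re (ofR _)]/= [Im (ofR _)]/= mul0r subr0.
have gV : b * Re_coef k (fun z => beta_form b 1 (z ^+ k)) + h1 = 1.
  rewrite -(cE _ adg) (@coef_ext _ _ (kerQ b k)) ?coef_kerQ_k // => z dz.
  have n0 := affine_neq0 hb (disc_exprn k0 dz).
  rewrite gE // /h /kerQ tE ofRV; move: n0 (@ofR_g2_neq0 R b); move: (ofR (1 + _)) (ofR b) (z ^+ k) => d x w.
  by move=> n0 d0; field; rewrite d0 n0.
apply: (@unique_extremal_of_functional R k 1%:E t _ b h1 adg b0) => f adf.
have af := admissible_analytic adf; have lf := admissible_l1_means adf.
have [_ _ f0] := adf.
rewrite gV -(cE _ adf); split; first exact: (l1_bound k af aH lf hle).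
by move=> f1 z dz; rewrite gE // (l1_rigidity k0 af lf hb' f0 f1).
Qed.

End ExponentOneCandidate.

Theorem theorem15 (R : realType) (k : nat) (p : \bar R) (t : R)
    (hk : (2 <= k)%N) (hp : (1 <= p)%E) (ht : 0 <= t <= 1) :
  [/\ (1 < p)%E ->
        unique_extremal k p t (fun z : Cplx R => f1 p t (z ^+ k)),
      p = 1%E -> 2^-1 <= t ->
        unique_extremal k p t (fun z : Cplx R => f1 p t (z ^+ k))
    & p = 1%E -> t < 2^-1 ->
        forall f : Cplx R -> Cplx R,
          extremal k p t f <->
          exists (c : Cplx R) (lambda : 'I_k -> Cplx R),
            [/\ forall j, `|lambda j| <= 1,
                forall z, disc z ->
                  f z = c * \prod_(j < k)
                    ((lambda j - z) * (1 - cconj (lambda j) * z)),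
                Hnorm 1%E f = 1%E,
                f 0 = ofR t
              & 0 < derive1n k f 0]].
Proof.
have k0 : (0 < k)%N := ltnW hk; have [t0 t1] := andP ht.
split.
- move=> p1; have [h|h] := ltP t (2 `^ (- inv_exponent p)).
    exact: alpha_young.
  exact: beta_young.
- by move=> -> h; apply: beta_exponent1 => //; rewrite h.
move=> -> h f; have ht' : 0 <= t <= 2^-1 by rewrite t0 ltW.
split; first exact: extremal_factor.
by move=> [c [lambda [_ fE nf f0 df]]]; exact: (factor_extremal k0 ht' fE nf f0 df).
Qed.
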